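(* Let $\mathbf{A}$ and $\mathbf{B}$ be two arenas. Then $\mathbf{A}$ and $\mathbf{B}$ are isomorphic in the category $\mathbf{Inn}$ if and only if there exists a path isomorphism between the set of paths of $\mathbf{A}$ and the set of paths of $\mathbf{B}$.
   Context: An arena is $\mathbf{A}=(M_{\mathbf{A}},\lambda_{\mathbf{A}},\vdash_{\mathbf{A}})$ where $M_{\mathbf{A}}$ is a set of moves, $\lambda_{\mathbf{A}}:M_{\mathbf{A}}\to\{O,P\}\times\{Q,A\}$ (projections $\lambda^{OP},\lambda^{QA}$; $\overline{\lambda}$ is $\lambda$ with $O$ and $P$ swapped), and $\vdash_{\mathbf{A}}\subseteq (M_{\mathbf{A}}+\{\star\})\times M_{\mathbf{A}}$ such that: $\star\vdash m\Rightarrow\lambda(m)=OQ$; $m\vdash n$ and $\lambda^{QA}(n)=A$ imply $\lambda^{QA}(m)=Q$; $m\vdash n$, $m\ne\star$ imply $\lambda^{OP}(m)\ne\lambda^{OP}(n)$. Moves with $\star\vdash m$ are initial. A justified sequence is a finite sequence of moves where each non-initial move occurrence $m$ carries a pointer to an earlier occurrence $n$ with $n\vdash m$. P-view: $\ulcorner sm\urcorner=\ulcorner s\urcorner m$ if $m$ is a P-move; $\ulcorner sm\urcorner=m$ if $m$ is initial without pointer; $\ulcorner s_1 m s_2 n\urcorner=\ulcorner s_1\urcorner mn$ if $n$ is an O-move pointing to $m$; O-view dually. Legal plays: justified sequences satisfying alternation of O/P labels, bracketing (each answer points to the last unanswered question) and visibility (a non-initial P-move points into the P-view of the preceding prefix,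 a non-initial O-move into its O-view). A strategy is a nonempty prefix-closed set of even-length legal plays; it is innocent if $sab\in\sigma$, $t\in\sigma$, $ta$ legal and $\ulcorner sa\urcorner=\ulcorner ta\urcorner$ imply $tab\in\sigma$. The arrow arena $\mathbf{A}\Rightarrow\mathbf{B}$ has moves $M_{\mathbf{A}}+M_{\mathbf{B}}$, labelling $[\overline{\lambda_{\mathbf{A}}},\lambda_{\mathbf{B}}]$, and $m\vdash n$ iff $m\vdash_{\mathbf{A}}n$ or $m\vdash_{\mathbf{B}}n$ ($m\ne\star$), or $m$ initial in $\mathbf{B}$ and $n$ initial in $\mathbf{A}$, or $m=\star$ and $n$ initial in $\mathbf{B}$. $\mathbf{Inn}$ is the category of arenas with morphisms $\mathbf{A}\to\mathbf{B}$ the innocent strategies on $\mathbf{A}\Rightarrow\mathbf{B}$, composition by parallel interaction plus hiding, and identities the copycat strategies. A path in $\mathbf{A}$ is a finite sequence of moves $a_1,\dots,a_n$ with $a_i\vdash_{\mathbf{A}}a_{i+1}$ for all $1\le i\le n-1$. For a non-empty path $p$, $ip(p)$ denotes its immediate prefix (remove the last move). A path isomorphism between $\mathbf{A}$ and $\mathbf{B}$ is a bijection $\phi$ from the set of paths of $\mathbf{A}$ to the set of paths of $\mathbf{B}$ such that $\phi(ip(p))=ip(\phi(p))$ for every non-empty path $p$ of $\mathbf{A}$.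
   Formalization: Paths are required to start at an initial move, and a path isomorphism must also preserve the question/answer label of the last move of each path; without either condition the stated equivalence is false. *)

(* Defs.v *)
From mathcomp Require Import all_boot.
From mathcomp Require Import boolp classical_sets functions.

Set Implicit Arguments.
Unset Strict Implicit.
Unset Printing Implicit Defensive.

Local Open Scope classical_set_scope.

Inductive player := Opponent | Proponent.
Inductive kind := Question | Answer.

Definition dual (x : player) : player :=
  if x is Opponent then Proponent else Opponent.

Definition same_player (x y : player) : bool :=
  match x, y with
  | Opponent, Opponent | Proponent, Proponent => true
  | _, _ => false
  end.

(* [enables (Some m) n] is m |- n and [enables None n] is star |- n. As in the
   source, a move may be both initial and enabled by other moves. *)
Record arena := Arena {
  move : Type;
  label : move -> player * kind;
  enables : option move -> move -> Prop;
  initial_label : forall m, enables None m -> label m = (Opponent, Question);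
  answer_enabled : forall m n, enables (Some m) n ->
    (label n).2 = Answer -> (label m).2 = Question;
  enables_alternates : forall m n, enables (Some m) n ->
    (label m).1 <> (label n).1
}.

Arguments enables : clear implicits.

Section Arrow.
Variables A B : arena.

Definition arrow_label (x : move A + move B) : player * kind :=
  match x with
  | inl a => (dual (label a).1, (label a).2)
  | inr b => label b
  end.

Definition arrow_enables (x : option (move A + move B)) (y : move A + move B) :
    Prop :=
  match x, y with
  | Some (inl m), inl n => enables A (Some m) n
  | Some (inr m), inr n => enables B (Some m) n
  | Some (inr m), inl n => enables B None m /\ enables A None n
  | None, inr n => enables B None n
  | _, _ => False
  end.

Lemma arrow_initial_label m :
  arrow_enables None m -> arrow_label m = (Opponent, Question).
Proof. by case: m => //= b /initial_label. Qed.

Lemma arrow_answer_enabled m n : arrow_enables (Some m) n ->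
  (arrow_label n).2 = Answer -> (arrow_label m).2 = Question.
Proof.
case: m n => [a|b] [a'|b'] //=; try exact: answer_enabled.
by case=> /initial_label ->.
Qed.

Lemma arrow_enables_alternates m n : arrow_enables (Some m) n ->
  (arrow_label m).1 <> (arrow_label n).1.
Proof.
case: m n => [a|b] [a'|b'] //=; try exact: enables_alternates.
- by move=> /enables_alternates; case: (label a).1 (label a').1 => -[].
- by case=> /initial_label -> /initial_label ->.
Qed.

Definition arrow : arena :=
  Arena arrow_initial_label arrow_answer_enabled arrow_enables_alternates.

End Arrow.

(* Sequences of moves with pointers: an occurrence is a pair of a move and the
   position (counted from 0) of its justifier, or [None] if it has no pointer. *)
Definition jseq (M : Type) := seq (M * option nat).

Section Plays.
Variable A : arena.
Implicit Types (s t : jseq (move A)) (m n : move A) (X : player).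

(* An occurrence without pointer is initial. *)
Definition justified s : Prop :=
  forall i m p, onth s i = Some (m, p) ->
    match p with
    | None => enables A None m
    | Some j => exists n q,
        [/\ j < i, onth s j = Some (n, q) & enables A (Some n) m]
    end.

(* [view_upto X s k n] lists the positions of the X-view of [take n s]. Pointers
   go strictly backwards in a justified sequence, so fuel [k >= n] suffices. *)
Fixpoint view_upto X s (k n : nat) : seq nat :=
  match k, n with
  | k'.+1, i.+1 =>
      match onth s i with
      | Some (m, p) =>
          if same_player (label m).1 X then rcons (view_upto X s k' i) i
          else match p with
               | None => [:: i]
               | Some j => view_upto X s k' j ++ [:: j; i]
               end
      | None => [::]
      end
  | _, _ => [::]
  end.

Definition view X s : seq nat := view_upto X s (size s) (size s).

(* The X-view as a sequence with pointers. *)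
Definition view_seq X s : jseq (move A) :=
  let v := view X s in
  let ptr j := if j \in v then Some (index j v) else None in
  pmap (fun i => omap (fun x => (x.1, obind ptr x.2)) (onth s i)) v.

Definition alternating s : Prop :=
  forall i m p n q, onth s i = Some (m, p) -> onth s i.+1 = Some (n, q) ->
    (label m).1 <> (label n).1.

Definition unanswered s (j : nat) : Prop :=
  (exists m p, onth s j = Some (m, p) /\ (label m).2 = Question) /\
  ~ (exists k m, onth s k = Some (m, Some j) /\ (label m).2 = Answer).

Definition last_unanswered s (j : nat) : Prop :=
  unanswered s j /\ forall k, unanswered s k -> k <= j.

Definition bracketed s : Prop :=
  forall i m p, onth s i = Some (m, p) -> (label m).2 = Answer ->
    exists2 j, p = Some j & last_unanswered (take i s) j.

Definition visible s : Prop :=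
  forall i m j, onth s i = Some (m, Some j) ->
    j \in view (label m).1 (take i s).

Definition legal s : Prop :=
  [/\ justified s, alternating s, bracketed s & visible s].

Definition strategy (sigma : set (jseq (move A))) : Prop :=
  [/\ sigma !=set0,
      forall s, sigma s -> legal s /\ ~~ odd (size s)
    & forall s t, sigma (s ++ t) -> ~~ odd (size s) -> sigma s].

(* As positions in [s] and [t] differ, the two occurrences of the move a are
   [a] and [a'], and the b of tab is justified by the element of the view of
   ta that corresponds to the justifier of b in the view of sa. *)
Definition innocent (sigma : set (jseq (move A))) : Prop :=
  strategy sigma /\
  forall s a b t a',
    sigma (s ++ [:: a; b]) -> sigma t -> legal (rcons t a') ->
    view_seq Proponent (rcons s a) = view_seq Proponent (rcons t a') ->
    let v := view Proponent (rcons s a) in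
    let w := view Proponent (rcons t a') in
    sigma (t ++ [:: a'; (b.1, omap (fun j => nth 0 w (index j v)) b.2)]).

End Plays.

Section Restriction.
Variables (M N : Type) (f : M -> option N).

(* Follows pointers until a position of [v] is reached and returns its rank in
   [v]; as pointers go strictly backwards, fuel [size s] suffices. *)
Fixpoint skip_pointer (k : nat) (v : seq nat) (s : jseq M) (p : option nat) :
    option nat :=
  match k, p with
  | k'.+1, Some j =>
      if j \in v then Some (index j v)
      else skip_pointer k' v s (obind snd (onth s j))
  | _, _ => None
  end.

(* The restriction of [s] to the occurrences on which [f] is defined, renamed
   along [f]. A pointer into the deleted part is replaced by the pointer
   reached from there, if any: when B is hidden from an interaction on A, B, C,
   a move of A pointing to a B-move justified in C ends up pointing into C. *)
Definition restrict (s : jseq M) : jseq N :=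
  let v := [seq i <- iota 0 (size s) | obind (fun x => f x.1) (onth s i)] in
  pmap (fun i => obind (fun x =>
          omap (fun n => (n, skip_pointer (size s) v s x.2)) (f x.1))
        (onth s i)) v.

End Restriction.

Definition in_left (M N : Type) (x : M + N) : option M :=
  if x is inl m then Some m else None.
Definition in_right (M N : Type) (x : M + N) : option N :=
  if x is inr n then Some n else None.

Definition copycat (A : arena) : set (jseq (move (arrow A A))) :=
  [set s | [/\ legal (A := arrow A A) s, ~~ odd (size s)
    & forall n, ~~ odd n ->
        restrict (@in_left (move A) (move A)) (take n s) =
        restrict (@in_right (move A) (move A)) (take n s)]].

Arguments copycat : clear implicits.

Section Composition.
Variables A B C : arena.

Definition in_AB (x : (move A + move B) + move C) : option (move A + move B) :=
  in_left x.
Definition in_BC (x : (move A + move B) + move C) : option (move B + move C) :=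
  match x with
  | inl (inl _) => None
  | inl (inr b) => Some (inl b)
  | inr c => Some (inr c)
  end.
Definition in_AC (x : (move A + move B) + move C) : option (move A + move C) :=
  match x with
  | inl (inl a) => Some (inl a)
  | inl (inr _) => None
  | inr c => Some (inr c)
  end.

(* The enabling relation of (A => B) => C is the one of interactions: initial
   moves of C enable those of B, which enable those of A. Only its enabling
   relation is used here, not its labelling. *)
Definition interaction (u : jseq (move (arrow (arrow A B) C))) : Prop :=
  [/\ justified u,
      legal (A := arrow A B) (restrict in_AB u),
      legal (A := arrow B C) (restrict in_BC u)
    & legal (A := arrow A C) (restrict in_AC u)].

Definition compose (sigma : set (jseq (move (arrow A B))))
    (tau : set (jseq (move (arrow B C)))) : set (jseq (move (arrow A C))) :=
  [set s | exists u, [/\ interaction u, sigma (restrict in_AB u),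
                         tau (restrict in_BC u) & s = restrict in_AC u]].

End Composition.

Definition Inn_isomorphic (A B : arena) : Prop :=
  exists (sigma : set (jseq (move (arrow A B))))
         (tau : set (jseq (move (arrow B A)))),
    [/\ innocent sigma, innocent tau,
        compose sigma tau = copycat A & compose tau sigma = copycat B].

Fixpoint enabled_chain (A : arena) (x : option (move A)) (p : seq (move A)) :
    Prop :=
  if p is a :: p' then enables A x a /\ enabled_chain (Some a) p' else True.

(* Paths are rooted, i.e. start from an initial move. Otherwise an arena with a
   single, non-initial, move would have more paths than the empty arena,
   although both have only the empty play. *)
Definition paths (A : arena) : set (seq (move A)) :=
  [set p | enabled_chain None p].

Arguments paths : clear implicits.

Definition ip (T : Type) (p : seq T) : seq T := take (size p).-1 p.

(* The last clause makes the bijection respect question/answer labels (it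
   respects O/P labels automatically). It cannot be dropped: if q is initial
   and enables only an answer in A, and only a question in B, then A and B
   have isomorphic sets of paths, but bracketing forbids any isomorphism. *)
Definition path_isomorphism (A B : arena) (phi : seq (move A) -> seq (move B)) :
    Prop :=
  [/\ set_bij (paths A) (paths B) phi,
      forall p, paths A p -> p <> [::] -> phi (ip p) = ip (phi p)
    & forall p a q b, paths A (rcons p a) -> phi (rcons p a) = rcons q b ->
        (label b).2 = (label a).2].

(* Main.v *)
(* Call a play of A => B zigzag if it is a sequence of pairs (Opponent move,
   Proponent move), the two moves of a pair lying in different components and
   being justified by the two moves of one earlier pair (or by nothing in their
   component). Such a play is a forest of pairs, whose branches pair a path of A
   with a path of B of the same length.

   Given a path isomorphism, the zigzag legal plays all of whose branches are
   related by it form an innocent strategy: Proponent's view is exactly the branch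
   that is being extended. Composing it with the one of the inverse isomorphism
   gives the copycat strategy, because an interaction of two zigzag plays
   decomposes into triples (a move of each component), so that hiding the middle
   one leaves a zigzag play again.

   Conversely, let sigma and tau be inverse to each other. By induction on k,
   every path of length k belongs to exactly one branch played by both sigma and
   tau. A branch of length k + 1 is found in an interaction that produces the
   copycat play along the path. This needs that after a branch of length k the
   strategy sigma answers in the other component, justified by the previous pair.
   Otherwise, the interaction along that branch, followed by the faulty answer of
   sigma and, if it is in the other component, by the answer of tau (which is
   known by innocence, as its view is a shorter branch), would be a play of the
   composite that is not a copycat play. *)

From mathcomp Require Import all_boot.
From mathcomp Require Import boolp classical_sets functions.
From mathcomp Require Import zify.
Require Import Defs.

Set Implicit Arguments.
Unset Strict Implicit.
Unset Printing Implicit Defensive.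

(** The converse is a mutual induction: branches exist for all paths of length at most k once
    answers are correct after all shorter branches, and correctness after a branch of length k uses
    only paths of length at most k. The latter works because a faulty pointer goes to an earlier
    block: the path along which the reply is looked up leaves the branch there, so it is not longer
    than the branch. Two obstacles shape the contradiction. If the faulty answer were an [Answer]
    move, the offending composite might be illegal by bracketing; bracketing itself rules this case
    out, and matched branches pair moves of the same kind. Moreover a move may be both initial and
    enabled, so a faulty answer can open a new tree for the other strategy, which requires a case of
    its own. Apart from justification, legality depends only on labels and pointers. It is therefore
    copied, wherever possible, between plays of different arrow arenas. Blocks point to blocks
    rather than to positions, so that the three restrictions of an interaction are images of a
    single thread. *)

Section Onth.
Variable T : Type.
Implicit Types (s t : seq T) (x : T).

Lemma onth_rcons s x i : onth (rcons s x) i =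
  if i < size s then onth s i else if i == size s then Some x else None.
Proof.
rewrite -cats1 onth_cat; case: ltnP => // h.
case: eqP => [->|ne]; first by rewrite subnn.
by rewrite onth_default //=; lia.
Qed.

Lemma onth_last s x : onth (rcons s x) (size s) = Some x.
Proof. by rewrite onth_rcons ltnn eqxx. Qed.

Lemma onth_lt s i x : onth s i = Some x -> i < size s.
Proof. by move=> h; rewrite -onthTE h. Qed.

Lemma onth_prefix s t i : i < size s -> onth (s ++ t) i = onth s i.
Proof. by move=> h; rewrite onth_cat h. Qed.

Lemma onth_ex s i : i < size s -> exists x, onth s i = Some x.
Proof. by rewrite -onthTE; case: onth => // x _; exists x. Qed.

Lemma onth_catl s t i x : onth s i = Some x -> onth (s ++ t) i = Some x.
Proof. by move=> h; rewrite onth_prefix // (onth_lt h). Qed.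

Lemma onth_take s n i : onth (take n s) i = if i < n then onth s i else None.
Proof.
case: ltnP => h; last by rewrite onth_default // size_take; case: ifP; lia.
case: (ltnP i (size s)) => h'.
  by rewrite -[in RHS](cat_take_drop n s) onth_prefix // size_take; case: ifP; lia.
by rewrite !onth_default // size_take; case: ifP; lia.
Qed.

End Onth.

(** The part of [justified] that makes the fuel of views and restrictions sufficient. It mentions no
    arena, so it applies to the restriction of any sequence. *)
Definition backward (M : Type) (s : jseq M) : Prop :=
  forall i m j, onth s i = Some (m, Some j) -> j < i.

Lemma justified_backward (A : arena) (s : jseq (move A)) :
  justified s -> backward s.
Proof. by move=> js i m j /js[n [q []]]. Qed.

Lemma backward_prefix (M : Type) (s t : jseq M) : backward (s ++ t) -> backward s.
Proof. by move=> b i m j h; apply: (b _ m); apply: onth_catl h. Qed.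

Lemma backward_rcons (M : Type) (s : jseq M) x : backward (rcons s x) -> backward s.
Proof. rewrite -cats1; exact: backward_prefix. Qed.

(** * Restriction as a left fold *)

Section Rst.
Variables (M N : Type) (f : M -> option N).
Implicit Types u : jseq M.

(* The second component records, for every position of the sequence, where a
   pointer to that position leads after restriction. *)
Definition rst_step (acc : jseq N * seq (option nat)) (x : M * option nat) :=
  let p := obind (nth None acc.2) x.2 in
  match f x.1 with
  | Some n => (rcons acc.1 (n, p), rcons acc.2 (Some (size acc.1)))
  | None => (acc.1, rcons acc.2 p)
  end.

Definition rst u := foldl rst_step ([::], [::]) u.

Lemma rst_rcons u x : rst (rcons u x) = rst_step (rst u) x.
Proof. by rewrite /rst foldl_rcons. Qed.

Lemma size_rst2 u : size (rst u).2 = size u.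
Proof.
elim/last_ind: u => // u x IH; rewrite rst_rcons /rst_step.
by case: (f x.1) => [n|] /=; rewrite !size_rcons IH.
Qed.

Lemma rst_cat u w : exists2 w', (rst (u ++ w)).1 = (rst u).1 ++ w' &
  exists t, (rst (u ++ w)).2 = (rst u).2 ++ t.
Proof.
elim/last_ind: w => [|w x [w' h [t h2]]].
  by exists [::]; [rewrite !cats0 | exists [::]; rewrite !cats0].
rewrite -rcons_cat rst_rcons /rst_step h h2.
case: (f x.1) => [n|] /=; rewrite !rcons_cat.
  by exists (rcons w' (n, obind (nth None ((rst u).2 ++ t)) x.2)) => //; eexists.
by exists w' => //; eexists.
Qed.

Lemma rst2_cat u w j : j < size u ->
  nth None (rst (u ++ w)).2 j = nth None (rst u).2 j.
Proof.
by move=> h; have [w' _ [t ->]] := rst_cat u w; rewrite nth_cat size_rst2 h.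
Qed.

Let kept u := [seq i <- iota 0 (size u) | obind (fun x => f x.1) (onth u i)].

Let kept_rcons u x : kept (rcons u x) = kept u ++ (if f x.1 then [:: size u] else [::]).
Proof.
rewrite /kept size_rcons -addn1 iotaD filter_cat /= add0n; congr (_ ++ _).
  apply: eq_in_filter => i; rewrite mem_iota onth_rcons => /andP[_ ->] //.
by rewrite onth_last /=; case: (f x.1).
Qed.

Let kept_lt u i : i \in kept u -> i < size u.
Proof. by rewrite mem_filter mem_iota => /andP[_ /andP[]]. Qed.

(** Pointers lead backwards, so the search from [j] meets neither the appended occurrence nor the
    end of the fuel. *)
Let skip_rcons u x j k k' : backward u -> j < size u -> j < k -> j < k' ->
  skip_pointer k (kept (rcons u x)) (rcons u x) (Some j) =
  skip_pointer k' (kept u) u (Some j).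
Proof.
move=> b; elim/ltn_ind: j k k' => j IH [//|k] [//|k'] ju jk jk' /=.
have E : (j \in kept (rcons u x)) = (j \in kept u).
  rewrite kept_rcons mem_cat; case: (f x.1) => //=; rewrite ?inE ?orbF //.
  by rewrite (ltn_eqF ju) orbF.
rewrite E; case: ifP => [jv|_]; first by rewrite kept_rcons index_cat jv.
rewrite onth_rcons ju; case o: (onth u j) => [[m [i|]]|] /=.
- by have ij := b _ _ _ o; apply: IH => //; lia.
- by case: (k) (k') => [|?] [|?].
- by case: (k) (k') => [|?] [|?].
Qed.

Let size_kept u : size (kept u) = size (rst u).1.
Proof.
elim/last_ind: u => // u x IH; rewrite kept_rcons size_cat rst_rcons /rst_step IH.
by case: (f x.1) => [n|] /=; rewrite ?size_rcons ?addn1 ?addn0.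
Qed.

(** Correctness of the table: it stores the results of all searches, so that later lookups need no
    fuel. *)
Let skip_rst u j k : backward u -> j < size u -> j < k ->
  skip_pointer k (kept u) u (Some j) = nth None (rst u).2 j.
Proof.
elim/last_ind: u j k => [//|u x IH] j k b.
have bu := backward_rcons b.
rewrite size_rcons ltnS leq_eqVlt => /predU1P[->|ju] jk; last first.
  rewrite (@skip_rcons u x j k k) // IH // rst_rcons /rst_step.
  by case: (f x.1) => [n|] /=; rewrite nth_rcons size_rst2 ju.
case: k jk => // k jk /=; rewrite kept_rcons mem_cat rst_rcons /rst_step.
have nk : (size u \in kept u) = false by apply/negP => /kept_lt; rewrite ltnn.
rewrite nk index_cat nk size_kept /= onth_last.
case E: (f x.1) => [n|] /=; first by rewrite inE eqxx nth_rcons size_rst2 ltnn eqxx addn0.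
rewrite nth_rcons size_rst2 ltnn eqxx.
move: b E; case: x => m [i|] /= b E; last by case: (k).
have iu : i < size u by apply: (b _ m); rewrite onth_last.
rewrite -(IH i (size u)) //; rewrite -(@skip_rcons u (m, Some i) i k (size u)) //; last by lia.
by rewrite kept_rcons E.
Qed.

Lemma restrict_rst u : backward u -> restrict f u = (rst u).1.
Proof.
elim/last_ind: u => // u x IH b; have bu := backward_rcons b.
rewrite rst_rcons /rst_step; rewrite /restrict -/(kept (rcons u x)).
set v := kept (rcons u x); rewrite {2}/v kept_rcons pmap_cat.
have -> : pmap (fun i => obind (fun y => omap (fun n =>
      (n, skip_pointer (size (rcons u x)) v (rcons u x) y.2)) (f y.1))
      (onth (rcons u x) i)) (kept u) = (rst u).1.
  rewrite -IH // /restrict -/(kept u); apply: eq_in_pmap => i /kept_lt iu.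
  rewrite onth_rcons iu; case o: (onth u i) => [[m [j|]]|] //=; last first.
    by rewrite size_rcons; case: (size u).
  have ji := bu _ _ _ o.
  by rewrite (@skip_rcons u x j _ (size u)) // ?size_rcons; lia.
case E: (f x.1) => [n|] /=; last by rewrite cats0.
rewrite onth_last /= E /= cats1; congr (rcons _ (_, _)).
rewrite {}/v; move: b E; case: x => m [i|] /= b E; last by case: (size _).
have iu : i < size u by apply: (b _ m); rewrite onth_last.
by rewrite size_rcons (@skip_rcons u _ i _ (size u)) ?skip_rst //; lia.
Qed.

End Rst.

(** * Legality *)

Section Skeleton.

(** Alternation, bracketing and visibility see a play only through this data; justification alone
    looks at the moves. *)
Definition skeleton (A : arena) (s : jseq (move A)) :=
  [seq (label x.1, x.2) | x <- s].

Lemma size_skeleton (A : arena) (s : jseq (move A)) : size (skeleton s) = size s.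
Proof. exact: size_map. Qed.

Lemma skeleton_take (A : arena) (s : jseq (move A)) n :
  skeleton (take n s) = take n (skeleton s).
Proof. exact: map_take. Qed.

Variables (A B : arena).
Implicit Types (s : jseq (move A)) (t : jseq (move B)).

Lemma onth_skeleton s t i m p :
    onth (skeleton s) i = onth (skeleton t) i -> onth s i = Some (m, p) ->
  exists2 n, onth t i = Some (n, p) & label m = label n.
Proof.
rewrite !onth_map => /esym + h; rewrite h /=.
by case: (onth t i) => //= -[n q] /= [<- <-]; exists n.
Qed.

(** A view only looks backwards, so agreement below [n] is enough. Leaving both fuels free lets the
    lemma compare a play with its prefixes as well as plays of different arenas. *)
Lemma view_upto_skeleton X s t k k' n : backward s ->
    (forall i, i < n -> onth (skeleton s) i = onth (skeleton t) i) ->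
    n <= k -> n <= k' ->
  view_upto X s k n = view_upto X t k' n.
Proof.
move=> b; elim/ltn_ind: n k k' => -[|n] IH [|k] [|k'] // E hk hk' /=.
have := E n (ltnSn n); rewrite !onth_map.
case o: (onth s n) => [[m p]|] /=; case: (onth t n) => [[m' p']|] //= [<- <-].
case: ifP => _; first by rewrite (IH n _ k k') // => i hi; apply: E; lia.
case: p o => [j|] // /b jn.
by rewrite (IH j _ k k') //; try lia; move=> i hi; apply: E; lia.
Qed.

Lemma unanswered_skeleton s t j :
  skeleton s = skeleton t -> unanswered s j -> unanswered t j.
Proof.
move=> E [[m [p [h q]]] na]; split.
  have [|n hn l] := onth_skeleton (t := t) _ h; first by rewrite E.
  by exists n, p; rewrite hn -l.
case=> k [n [hn an]]; apply: na; exists k.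
case o: (onth s k) => [[m' p']|]; last first.
  by have := congr1 (fun z => onth z k) E; rewrite !onth_map o hn.
have [|n' hn' l] := onth_skeleton (t := t) _ o; first by rewrite E.
by move: hn'; rewrite hn => -[en ep]; exists m'; rewrite l ep -en.
Qed.

End Skeleton.

Section Relabel.
Variables (A B : arena).
Implicit Types (s : jseq (move A)) (t : jseq (move B)).

Lemma view_take (C : arena) X (s : jseq (move C)) i : backward s -> i <= size s ->
  view X (take i s) = view_upto X s (size s) i.
Proof.
move=> b hi; rewrite /view size_takel //; apply: view_upto_skeleton => //.
- by move=> j m k; rewrite onth_take; case: ifP => // _; apply: b.
- by move=> j ji; rewrite skeleton_take onth_take ji.
Qed.

(** Transfers legality from one arrow arena to another: with justification checked separately, the
    other three conditions are determined by the skeleton. *)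
Lemma legal_skeleton s t :
  skeleton s = skeleton t -> legal s -> justified t -> legal t.
Proof.
move=> E [js al br vi] jt; have E' := esym E.
have sz : size s = size t by rewrite -size_skeleton E size_skeleton.
split=> //.
- move=> i m p n q h1 h2.
  have [|m1 g1 ->] := onth_skeleton (t := s) _ h1; first by rewrite E.
  have [|n1 g2 ->] := onth_skeleton (t := s) _ h2; first by rewrite E.
  exact: al g1 g2.
- move=> i m p h a.
  have [|m1 g1 l] := onth_skeleton (t := s) _ h; first by rewrite E.
  have [|j -> [un la]] := br _ _ _ g1; first by rewrite -l.
  exists j => //; split.
    by apply: unanswered_skeleton un; rewrite !skeleton_take E.
  by move=> k hk; apply: la; apply: unanswered_skeleton hk; rewrite !skeleton_take E.
- move=> i m j h.
  have [|m1 g1 l] := onth_skeleton (t := s) _ h; first by rewrite E.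
  have := vi _ _ _ g1; have bs := justified_backward js.
  have bt := justified_backward jt.
  have it := ltnW (onth_lt h); have is_ := ltnW (onth_lt g1).
  rewrite !view_take // l sz (@view_upto_skeleton A B _ s t _ (size t)) //.
  by move=> k _; rewrite E.
Qed.

End Relabel.

Section Legal.
Variable A : arena.
Implicit Types (s t : jseq (move A)).

Definition turn (n : nat) : player := if odd n then Proponent else Opponent.

Lemma turn_even n : turn (2 * n) = Opponent.
Proof. by rewrite /turn oddM. Qed.

Lemma turn_odd n : turn (2 * n).+1 = Proponent.
Proof. by rewrite /turn /= oddM. Qed.

(** At position 0 no pointer is possible, so the first move is initial, hence of Opponent;
    alternation does the rest. *)
Lemma turn_player s i m p : justified s -> alternating s ->
  onth s i = Some (m, p) -> (label m).1 = turn i.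
Proof.
move=> js al; elim: i m p => [|i IH] m p h.
  by have := js _ _ _ h; case: p h => [j _ [n [q []]]|_ /initial_label ->].
have [|[n q] hn] := @onth_ex _ s i; first by have := onth_lt h; lia.
have := al _ _ _ _ _ hn h; rewrite (IH _ _ hn) /turn /=.
by case: (odd i); case: (label m).1.
Qed.

Lemma legal_turn s i m p : legal s -> onth s i = Some (m, p) ->
  (label m).1 = turn i.
Proof. by case=> js al _ _; apply: turn_player. Qed.

(** Every condition constrains an occurrence by what precedes it, so legality can be established and
    used one occurrence at a time. *)
Lemma legal_rcons s m p : legal (rcons s (m, p)) <->
  [/\ legal s,
      match p with
      | None => enables A None m
      | Some j => exists n q, onth s j = Some (n, q) /\ enables A (Some n) m
      end,
      (label m).1 = turn (size s),
      (label m).2 = Answer -> exists2 j, p = Some j & last_unanswered s j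
    & forall j, p = Some j -> j \in view (label m).1 s].
Proof.
have tk i : i < size s -> take i (rcons s (m, p)) = take i s.
  by move=> h; rewrite -cats1 take_cat h.
have tk' : take (size s) (rcons s (m, p)) = s by rewrite -cats1 take_size_cat.
split=> [[js al br vi]|[[js al br vi] en tn an vs]].
  have o := onth_last s (m, p); split.
  - split.
    + move=> i n q h; have := js i n q; rewrite onth_rcons (onth_lt h) => /(_ h).
      case: q h => // j h [n' [q [ji hj e]]]; exists n', q; split=> //.
      by move: hj; rewrite onth_rcons (ltn_trans ji (onth_lt h)).
    + move=> i m1 p1 n q h1 h2; apply: (al i m1 p1 n q).
        by rewrite onth_rcons (onth_lt h1).
      by rewrite onth_rcons (onth_lt h2).
    + move=> i m1 p1 h a; have := br i m1 p1; rewrite onth_rcons (onth_lt h).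
      by case=> // j -> lu; exists j; rewrite // -tk ?(onth_lt h).
    + move=> i m1 j h; have := vi i m1 j.
      by rewrite onth_rcons (onth_lt h) tk ?(onth_lt h) //; apply.
  - have := js _ _ _ o; case: {o al br vi tk tk'} p js => // j js [n [q [jl h e]]].
    by exists n, q; split=> //; move: h; rewrite onth_rcons jl.
  - exact: turn_player o.
  - by move=> a; have := br _ _ _ o a; rewrite tk'.
  - by move=> j pj; have := vi _ m j; rewrite pj in o *; move=> /(_ _ o); rewrite -pj tk'.
have cs i x : onth (rcons s (m, p)) i = Some x ->
    (i < size s /\ onth s i = Some x) \/ (i = size s /\ x = (m, p)).
  by rewrite onth_rcons; case: ltnP => [|_]; [left|case: eqP => // -> [<-]; right].
split.
- move=> i n q /cs[[hi h]|[-> [-> ->]]].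
    have := js _ _ _ h; case: q h => // j h [n' [q [ji hj e]]].
    by exists n', q; split=> //; rewrite onth_rcons (onth_lt hj).
  case: p en {an vs tk tk' cs} => // j [n' [q' [h e]]]; exists n', q'; split=> //.
    exact: onth_lt h.
  by rewrite onth_rcons (onth_lt h).
- move=> i m1 p1 n q h1 /cs[[hi h2]|[hi [-> _]]].
    have h1' : onth s i = Some (m1, p1) by move: h1; rewrite onth_rcons (ltnW hi).
    exact: al h1' h2.
  have h1' : onth s i = Some (m1, p1) by move: h1; rewrite onth_rcons -hi ltnSn.
  by rewrite tn (turn_player js al h1') -hi /turn /=; case: (odd i).
- move=> i m1 p1 /cs[[hi h]|[-> [-> ->]]] a; last by rewrite tk'; apply: an.
  by have [j -> lu] := br _ _ _ h a; exists j; rewrite // tk.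
- move=> i m1 j /cs[[hi h]|[-> [-> pj]]]; last by rewrite tk'; apply: vs.
  by rewrite tk //; apply: vi h.
Qed.

Lemma legal_nil : legal (A := A) [::].
Proof. by split=> i m ?; rewrite onth0n. Qed.

Lemma legal_prefix s t : legal (s ++ t) -> legal s.
Proof.
elim/last_ind: t => [|t [m p] IH]; first by rewrite cats0.
by rewrite -rcons_cat => /legal_rcons[/IH].
Qed.

Lemma legal_backward s : legal s -> backward s.
Proof. by case=> /justified_backward. Qed.

Lemma strategy_prefix (sigma : set (jseq (move A))) s t :
  strategy sigma -> sigma (s ++ t) -> ~~ odd (size s) -> sigma s.
Proof. by case=> _ _; apply. Qed.

Lemma strategy_legal (sigma : set (jseq (move A))) s :
  strategy sigma -> sigma s -> legal s.
Proof. by case=> _ h _ /h[]. Qed.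

End Legal.

(** * Threads and zigzag plays *)

(* An entry [(d, r, x)] stands for a block of consecutive moves [x], one in each
   component: [d] says that the block starts in the rightmost component, and [r]
   is the index of the block whose moves justify those of the entry. *)
Definition thread (X : Type) := seq (bool * option nat * X).

Definition tmap (X Y : Type) (g : X -> Y) (L : thread X) : thread Y :=
  [seq (e.1, g e.2) | e <- L].

(** Opponent opens every tree in the rightmost component. Afterwards an Opponent move points to a
    Proponent move of its own component, that is, to the last move of a block. So a block starts
    where its justifying block ended, hence the negated direction. *)
Definition wf (X : Type) (L : thread X) : Prop :=
  forall i d r x, onth L i = Some (d, r, x) ->
    match r with
    | None => d
    | Some j => j < i /\ exists r' x', onth L j = Some (~~ d, r', x')
    end.

Section Thread.
Variables (X Y : Type) (g : X -> Y).
Implicit Types L : thread X.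

Lemma onth_tmap L i d r x :
  onth L i = Some (d, r, x) -> onth (tmap g L) i = Some (d, r, g x).
Proof. by move=> h; rewrite onth_map h. Qed.

Lemma onth_tmap_inv L i d r y : onth (tmap g L) i = Some (d, r, y) ->
  exists2 x, onth L i = Some (d, r, x) & y = g x.
Proof.
rewrite onth_map; case: (onth L i) => //= -[[d' r'] x] /= [-> -> <-].
by exists x.
Qed.

Lemma wf_rcons L d r x : wf (rcons L (d, r, x)) <->
  wf L /\ match r with
          | None => d
          | Some j => exists r' x', onth L j = Some (~~ d, r', x')
          end.
Proof.
split=> [w|[w h] i d' r' x'].
  split=> [i d' r' x' h|].
    have := w i d' r' x'; rewrite onth_rcons (onth_lt h) => /(_ h).
    case: r' h => // j h [ji [r' [x'' h']]]; split=> //; exists r', x''.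
    by move: h'; rewrite onth_rcons (ltn_trans ji (onth_lt h)).
  have := w _ _ _ _ (onth_last L (d, r, x)); case: r {w} => // j [jl [r' [x' h]]].
  by exists r', x'; move: h; rewrite onth_rcons jl.
rewrite onth_rcons; case: ltnP => [hi h'|_].
  have := w _ _ _ _ h'; case: r' h' => // j h' [ji [r' [x'' h'']]].
  by split=> //; exists r', x''; rewrite onth_rcons (onth_lt h'').
case: eqP => // -> [<- <- _]; case: r h => // j [r1 [x1 h]].
by split; [exact: onth_lt h | exists r1, x1; rewrite onth_rcons (onth_lt h)].
Qed.

Lemma wf_tmap L : wf L -> wf (tmap g L).
Proof.
move=> w i d r y /onth_tmap_inv[x h _]; have := w _ _ _ _ h.
case: r {h} => // j [ji [r' [x' h]]]; split=> //.
by exists r', (g x'); apply: onth_tmap.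
Qed.

Lemma wf_cat L L' : wf (L ++ L') -> wf L.
Proof.
elim/last_ind: L' => [|L' [[d r] x] IH]; first by rewrite cats0.
by rewrite -rcons_cat => /wf_rcons[/IH].
Qed.

Lemma wf_take L n : wf L -> wf (take n L).
Proof. by rewrite -{1}(cat_take_drop n L); apply: wf_cat. Qed.

Lemma tmap_rcons L e : tmap g (rcons L e) = rcons (tmap g L) (e.1, g e.2).
Proof. exact: map_rcons. Qed.

Lemma size_tmap L : size (tmap g L) = size L.
Proof. exact: size_map. Qed.

Lemma tmap_take L n : tmap g (take n L) = take n (tmap g L).
Proof. exact: map_take. Qed.

End Thread.

Lemma tmap_comp (X Y Z : Type) (g : X -> Y) (h : Y -> Z) (L : thread X) :
  tmap h (tmap g L) = tmap (fun x => h (g x)) L.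
Proof. by rewrite /tmap -map_comp. Qed.

(** Block [j] occupies positions 2j and 2j+1. A child traverses the components in the opposite
    order, so its first move points to the second move of [j] and its second move to the first. At a
    root, the second move is an initial left move, justified by the initial right move at position
    [n] of its own block. *)
Definition fst_ptr (r : option nat) : option nat := omap (fun j => (2 * j).+1) r.

Definition snd_ptr (n : nat) (r : option nat) : option nat :=
  Some (if r is Some j then 2 * j else n).

Section Zig.
Variables M N : Type.
Implicit Types L : thread (M * N).

Definition zfst (d : bool) (x : M * N) : M + N := if d then inr x.2 else inl x.1.
Definition zsnd (d : bool) (x : M * N) : M + N := if d then inl x.1 else inr x.2.

Definition zblock (n : nat) (e : bool * option nat * (M * N)) : jseq (M + N) :=
  [:: (zfst e.1.1 e.2, fst_ptr e.1.2); (zsnd e.1.1 e.2, snd_ptr n e.1.2)].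

Definition zig L : jseq (M + N) :=
  foldl (fun s e => s ++ zblock (size s) e) [::] L.

Lemma zig_rcons' L e : zig (rcons L e) = zig L ++ zblock (size (zig L)) e.
Proof. by rewrite /zig foldl_rcons. Qed.

Lemma size_zig L : size (zig L) = 2 * size L.
Proof.
by elim/last_ind: L => // L e IH; rewrite zig_rcons' size_cat IH size_rcons /=; lia.
Qed.

Lemma zig_rcons L e : zig (rcons L e) = zig L ++ zblock (2 * size L) e.
Proof. by rewrite zig_rcons' size_zig. Qed.

Lemma zig_rcons2 L d r x : zig (rcons L (d, r, x)) =
  rcons (rcons (zig L) (zfst d x, fst_ptr r)) (zsnd d x, snd_ptr (2 * size L) r).
Proof. by rewrite zig_rcons -!cats1 -catA. Qed.

Lemma zig_cat L L' : exists w, zig (L ++ L') = zig L ++ w.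
Proof.
elim/last_ind: L' => [|L' e [w IH]]; first by exists [::]; rewrite !cats0.
rewrite -rcons_cat zig_rcons IH -catA; by eexists.
Qed.

Lemma take_zig L n : take (2 * n) (zig L) = zig (take n L).
Proof.
case: (leqP (size L) n) => h; first by rewrite !take_oversize ?size_zig //; lia.
have [w E] := zig_cat (take n L) (drop n L).
rewrite cat_take_drop in E; rewrite E take_cat size_zig size_takel; last lia.
by rewrite ltnn subnn take0 cats0.
Qed.

Lemma odd_size_zig L : ~~ odd (size (zig L)).
Proof. by rewrite size_zig oddM. Qed.

Lemma onth_zig L i d r x : onth L i = Some (d, r, x) ->
  onth (zig L) (2 * i) = Some (zfst d x, fst_ptr r) /\
  onth (zig L) (2 * i).+1 = Some (zsnd d x, snd_ptr (2 * i) r).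
Proof.
elim/last_ind: L => [|L e IH]; first by rewrite onth0n.
rewrite onth_rcons zig_rcons !onth_cat size_zig.
case: ltnP => [hi /IH[h1 h2]|_].
  have -> : 2 * i < 2 * size L by lia.
  by have -> : (2 * i).+1 < 2 * size L by lia.
case: eqP => // -> [->].
by rewrite ltnn subnn ltnNge leqnSn /= subSn // subnn.
Qed.

Lemma onth_zig_inv L k y : onth (zig L) k = Some y ->
  exists i d r x, onth L i = Some (d, r, x) /\
    ((k = 2 * i /\ y = (zfst d x, fst_ptr r)) \/
     (k = (2 * i).+1 /\ y = (zsnd d x, snd_ptr (2 * i) r))).
Proof.
move=> h; have := onth_lt h; rewrite size_zig => hk.
have [|[[d r] x] e] := @onth_ex _ L k./2; first by lia.
exists k./2, d, r, x; split=> //; have [h1 h2] := onth_zig e.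
have := odd_double_half k; rewrite -mul2n; case: (odd k) => /= ek.
  have Ek : k = (2 * k./2).+1 by rewrite -add1n.
  by right; split=> //; rewrite Ek h2 in h; case: h.
have Ek : k = 2 * k./2 by rewrite -[LHS]ek.
by left; split=> //; rewrite Ek h1 in h; case: h.
Qed.

Lemma zblock_inj n n' e e' : zblock n e = zblock n' e' -> e = e'.
Proof.
case: e e' => [[d r] [m1 n1]] [[d' r'] [m2 n2]].
rewrite /zblock /zfst /zsnd /fst_ptr /=.
case: d; case: d' => //= -[-> E] -> _; case: r r' E => [j|] [j'|] //= -[E];
by have -> : j = j' by lia.
Qed.

(** A block is determined by its moves and its first pointer, so a zigzag play can be parsed back;
    statements about plays of a strategy thus become statements about threads. *)
Lemma zig_inj : injective zig.
Proof.
move=> L; elim/last_ind: L => [|L e IH] L'.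
  by case/lastP: L' => // L' e; rewrite zig_rcons => /(congr1 size); rewrite size_cat addnC.
case/lastP: L' => [|L' e']; rewrite !zig_rcons.
  by move=> /(congr1 size); rewrite size_cat addnC.
move=> E; have h : size (zig L') = size (zig L).
  by have := congr1 size E; rewrite !size_cat /= => /addIn ->.
have E1 : zig L = zig L'.
  by have := congr1 (take (size (zig L))) E; rewrite take_size_cat // -{1}h take_size_cat.
have E2 := congr1 (drop (size (zig L))) E.
rewrite drop_size_cat // -{1}h drop_size_cat // in E2.
by rewrite (IH _ E1) (zblock_inj E2).
Qed.

Lemma zig_prefix L L' w : zig L ++ w = zig L' -> exists L'', L' = L ++ L''.
Proof.
move=> E; exists (drop (size L) L'); rewrite -{1}(cat_take_drop (size L) L').
by congr (_ ++ _); apply: zig_inj; rewrite -take_zig -E take_size_cat // size_zig.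
Qed.

Lemma zig_next L L' x y w : zig L ++ x :: y :: w = zig L' ->
  exists e L'', L' = rcons L e ++ L'' /\ [:: x; y] = zblock (2 * size L) e.
Proof.
move=> E; have [[|e L''] EL] := zig_prefix E.
  by move/(congr1 size): E; rewrite EL cats0 size_cat /=; lia.
rewrite -cat_rcons in EL; exists e, L''; split=> //.
move: E; rewrite EL; have [w' ->] := zig_cat (rcons L e) L''.
rewrite zig_rcons -catA => /(congr1 (drop (size (zig L)))).
by rewrite !drop_size_cat //= => -[-> -> _].
Qed.

(** Right moves point only to right moves, so their table entries are [None]. This is what erases
    the pointer of the left move of a root and makes block indices the pointers of the
    restriction. *)
Lemma rst_left_zig L : wf L ->
  (rst (@in_left M N) (zig L)).1 = [seq (e.2.1, e.1.2) | e <- L] /\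
  forall i d r x, onth L i = Some (d, r, x) ->
    let T := (rst (@in_left M N) (zig L)).2 in
    nth None T (2 * i + d) = Some i /\ nth None T (2 * i + ~~ d) = None.
Proof.
elim/last_ind: L => [_|L [[d r] x] IH /wf_rcons[w hr]].
  by split=> // i d r x; rewrite onth0n.
have [E1 E2] := IH w; split.
  rewrite zig_rcons2 !rst_rcons map_rcons -E1.
  set R := rst _ _ in E1 E2 *; have sR : size R.2 = 2 * size L by rewrite size_rst2 size_zig.
  rewrite /rst_step /=; case: d hr => hr /=; last first.
    case: r hr => // j [r' [x' h]] /=; congr (rcons _ (_, _)).
    by have [<- _] := E2 _ _ _ _ h; rewrite addn1.
  case: r hr => [j [r' [x' h]]|_] /=; congr (rcons _ (_, _)).
    rewrite nth_rcons sR; have := onth_lt h => hj.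
    have -> : 2 * j < 2 * size L by lia.
    by have [<- _] := E2 _ _ _ _ h; rewrite addn0.
  by rewrite nth_rcons sR ltnn eqxx.
move=> i d' r' x'; rewrite onth_rcons; case: ltnP => [hi h|_].
  by rewrite /= zig_rcons !rst2_cat ?size_zig; first exact: E2 h; lia.
case: eqP => // -> [<- _ _] /=.
rewrite zig_rcons2 !rst_rcons.
set R := rst _ _ in E1 E2 *; have sR : size R.2 = 2 * size L by rewrite size_rst2 size_zig.
rewrite /rst_step /=; case: d hr => hr /=; last first.
  rewrite addn0 addn1 !nth_rcons !size_rcons E1 sR ltnn ltnSn ltnn !eqxx size_map.
  case: r hr => // j [r1 [x1 h]] /=; split=> //; rewrite ?nth_rcons ?sR.
  have hj := onth_lt h; have -> : 2 * j < 2 * size L by lia.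
  by have [_] := E2 _ _ _ _ h; rewrite addn0.
rewrite addn0 addn1 !nth_rcons !size_rcons E1 sR ltnn ltnSn ltnn !eqxx size_map; split=> //.
case: r hr => // j [r1 [x1 h]] /=.
by have [_] := E2 _ _ _ _ h; rewrite addn1.
Qed.

Lemma rst_right_zig L : wf L ->
  (rst (@in_right M N) (zig L)).1 = [seq (e.2.2, e.1.2) | e <- L] /\
  forall i d r x, onth L i = Some (d, r, x) ->
    let T := (rst (@in_right M N) (zig L)).2 in
    nth None T (2 * i + ~~ d) = Some i.
Proof.
elim/last_ind: L => [_|L [[d r] x] IH /wf_rcons[w hr]].
  by split=> // i d r x; rewrite onth0n.
have [E1 E2] := IH w; split.
  rewrite zig_rcons2 !rst_rcons map_rcons -E1.
  set R := rst _ _ in E1 E2 *; have sR : size R.2 = 2 * size L by rewrite size_rst2 size_zig.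
  rewrite /rst_step /=; case: d hr => hr /=; last first.
    case: r hr => // j [r' [x' h]] /=; congr (rcons _ (_, _)).
    rewrite nth_rcons sR; have := onth_lt h => hj.
    have -> : 2 * j < 2 * size L by lia.
    by have <- := E2 _ _ _ _ h; rewrite addn0.
  case: r hr => [j [r' [x' h]]|_] /=; congr (rcons _ (_, _)).
  by have <- := E2 _ _ _ _ h; rewrite addn1.
move=> i d' r' x'; rewrite onth_rcons; case: ltnP => [hi h|_].
  by rewrite /= zig_rcons !rst2_cat ?size_zig; first exact: E2 h; lia.
case: eqP => // -> [<- _ _] /=.
rewrite zig_rcons2 !rst_rcons.
set R := rst _ _ in E1 E2 *; have sR : size R.2 = 2 * size L by rewrite size_rst2 size_zig.
rewrite /rst_step /=; case: d hr => hr /=;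
by rewrite ?addn0 ?addn1 !nth_rcons !size_rcons E1 sR ?ltnn ?ltnSn ?ltnn !eqxx size_map.
Qed.

Lemma wf_backward_zig L : wf L -> backward (zig L).
Proof.
move=> w k m j /onth_zig_inv[i [d [r [x [h]]]]].
have := w _ _ _ _ h; rewrite /fst_ptr /snd_ptr.
case: r {h} => [i' [hi _]|_] [[-> []]|[-> []]] //= _; try case; lia.
Qed.

End Zig.

Lemma nth_rcons_old (T : Type) (x0 x : T) s i :
  i < size s -> nth x0 (rcons s x) i = nth x0 s i.
Proof. by move=> h; rewrite nth_rcons h. Qed.

Lemma nth_rcons_new (T : Type) (x0 x : T) s i : i = size s -> nth x0 (rcons s x) i = x.
Proof. by move=> ->; rewrite nth_rcons ltnn eqxx. Qed.

(** Reads a table extended by the moves of the current block; [lia] decides whether a position is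
    old or the one just appended. *)
Ltac push_nth := repeat first
  [ rewrite -> nth_rcons_old by (rewrite ?size_rcons; lia)
  | rewrite -> nth_rcons_new by (rewrite ?size_rcons; lia) ].

(** * Blocks of three moves and their restrictions to two components *)

Section Tri.
Variables A B C : arena.
Let M := (move A * move B * move C)%type.
Implicit Types L : thread M.

(** A block and its justifier have opposite directions, so the move at place k points to the
    mirrored place 2-k of block [j]. In a root, each later move is justified by the one just before
    it, from C down to A. *)
Definition tri_ptrs (n : nat) (r : option nat) : seq (option nat) :=
  if r is Some j then [:: Some (3 * j).+2; Some (3 * j).+1; Some (3 * j)]
  else [:: None; Some n; Some n.+1].

Definition tri_moves (d : bool) (x : M) : seq (move A + move B + move C) :=
  let s := [:: inr x.2; inl (inr x.1.2); inl (inl x.1.1)] in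
  if d then s else rev s.

Definition tblock (n : nat) (e : bool * option nat * M) :
  jseq (move A + move B + move C) := zip (tri_moves e.1.1 e.2) (tri_ptrs n e.1.2).

Definition tri L : jseq (move A + move B + move C) :=
  foldl (fun s e => s ++ tblock (size s) e) [::] L.

Lemma size_tri L : size (tri L) = 3 * size L.
Proof.
elim/last_ind: L => // L [[d r] x] IH.
rewrite /tri foldl_rcons size_cat -/(tri L) IH size_rcons /tblock size_zip /tri_ptrs /tri_moves.
by case: d; case: r => /=; lia.
Qed.

Lemma tri_rcons L e : tri (rcons L e) = tri L ++ tblock (3 * size L) e.
Proof. by rewrite -size_tri /tri foldl_rcons. Qed.

Lemma onth_tri L i d r x k : onth L i = Some (d, r, x) -> k < 3 ->
  onth (tri L) (3 * i + k) = onth (tblock (3 * i) (d, r, x)) k.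
Proof.
move=> + hk; elim/last_ind: L => [|L e IH]; first by rewrite onth0n.
rewrite onth_rcons tri_rcons onth_cat size_tri.
case: ltnP => [hi /IH h|_]; first by have -> : 3 * i + k < 3 * size L by lia.
case: eqP => // -> [->]; rewrite addKn ltnNge leq_addr //=.
Qed.

Lemma onth_tri_inv L k y : onth (tri L) k = Some y ->
  exists i d r x l, [/\ onth L i = Some (d, r, x), l < 3, k = 3 * i + l &
     onth (tblock (3 * i) (d, r, x)) l = Some y].
Proof.
move=> h; have := onth_lt h; rewrite size_tri => hk.
have [|[[d r] x] e] := @onth_ex _ L (k %/ 3); first by lia.
have El := divn_eq k 3; have hl : k %% 3 < 3 by lia.
exists (k %/ 3), d, r, x, (k %% 3); split=> //; first by lia.
by rewrite -(onth_tri e hl) -h; congr onth; lia.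
Qed.

Definition pAB (x : M) : move A * move B := x.1.
Definition pBC (x : M) : move B * move C := (x.1.2, x.2).
Definition pAC (x : M) : move A * move C := (x.1.1, x.2).

Let rst_tblock (N : Type) (f : move A + move B + move C -> option N) L n e :
  rst f (tri L ++ tblock n e) = foldl (rst_step f) (rst f (tri L)) (tblock n e).
Proof. by rewrite /rst foldl_cat. Qed.

(** C-moves point only to C-moves, so they lead nowhere in this restriction. The middle entry
    depends on the direction because the B-move precedes the A-move exactly when the block starts in
    C. *)
Lemma rst_tri_AB L : wf L ->
  (rst (@in_AB A B C) (tri L)).1 = zig (tmap pAB L) /\
  forall i d r x, onth L i = Some (d, r, x) ->
    let T := (rst (@in_AB A B C) (tri L)).2 in
    [/\ nth None T (3 * i) = if d then None else Some (2 * i),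
        nth None T (3 * i).+1 = Some (2 * i + ~~ d)
      & nth None T (3 * i).+2 = if d then Some (2 * i).+1 else None].
Proof.
elim/last_ind: L => [_|L [[d r] x] IH /wf_rcons[w hr]].
  by split=> // i d r x; rewrite onth0n.
have [E1 E2] := IH w.
have sR : size (rst (@in_AB A B C) (tri L)).2 = 3 * size L.
  by rewrite size_rst2 size_tri.
have sR1 : size (rst (@in_AB A B C) (tri L)).1 = 2 * size L.
  by rewrite E1 size_zig size_tmap.
suff [E3 E4] : (rst (@in_AB A B C) (tri L ++ tblock (3 * size L) (d, r, x))).1 =
     (rst (@in_AB A B C) (tri L)).1 ++ zblock (2 * size L) (d, r, pAB x) /\
    let T := (rst (@in_AB A B C) (tri L ++ tblock (3 * size L) (d, r, x))).2 in
    [/\ nth None T (3 * size L) = if d then None else Some (2 * size L),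
        nth None T (3 * size L).+1 = Some (2 * size L + ~~ d)
      & nth None T (3 * size L).+2 = if d then Some (2 * size L).+1 else None].
  rewrite tri_rcons tmap_rcons zig_rcons size_tmap -E1; split=> // i d' r' x'.
  rewrite onth_rcons; case: ltnP => [hi h|_]; last first.
    by case: eqP => // -> [<- _ _].
  by rewrite /= !rst2_cat ?size_tri; first exact: E2 h; lia.
rewrite rst_tblock; move: E2; move: (rst _ _) E1 sR sR1 => -[R1 R2] /= E1 sR sR1 E2.
case: r hr => [j [r' [x' h]]|hd].
  have hj := onth_lt h; have [h0 h1 h2] := E2 _ _ _ _ h.
  case: d h h0 h1 h2 => h h0 h1 h2 /=; rewrite /rst_step /=; push_nth;
    rewrite /= in h0 h1 h2; rewrite ?h0 ?h1 ?h2 ?size_rcons ?sR1 ?E ?addn0 ?addn1 -!cats1 -!catA /=;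
    split=> //; (split=> //; try (congr Some; lia)).
rewrite hd /= /rst_step /=; push_nth; rewrite ?size_rcons ?sR1 ?addn0 ?addn1 -!cats1 -!catA /=.
split=> //; (split=> //; try (congr Some; lia)).
Qed.

Lemma rst_tri_BC L : wf L ->
  (rst (@in_BC A B C) (tri L)).1 = zig (tmap pBC L) /\
  forall i d r x, onth L i = Some (d, r, x) ->
    let T := (rst (@in_BC A B C) (tri L)).2 in
    [/\ d -> nth None T (3 * i) = Some (2 * i),
        nth None T (3 * i).+1 = Some (2 * i + d)
      & ~~ d -> nth None T (3 * i).+2 = Some (2 * i).+1].
Proof.
elim/last_ind: L => [_|L [[d r] x] IH /wf_rcons[w hr]].
  by split=> // i d r x; rewrite onth0n.
have [E1 E2] := IH w.
have sR : size (rst (@in_BC A B C) (tri L)).2 = 3 * size L.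
  by rewrite size_rst2 size_tri.
have sR1 : size (rst (@in_BC A B C) (tri L)).1 = 2 * size L.
  by rewrite E1 size_zig size_tmap.
suff [E3 E4] : (rst (@in_BC A B C) (tri L ++ tblock (3 * size L) (d, r, x))).1 =
     (rst (@in_BC A B C) (tri L)).1 ++ zblock (2 * size L) (d, r, pBC x) /\
    let T := (rst (@in_BC A B C) (tri L ++ tblock (3 * size L) (d, r, x))).2 in
    [/\ d -> nth None T (3 * size L) = Some (2 * size L),
        nth None T (3 * size L).+1 = Some (2 * size L + d)
      & ~~ d -> nth None T (3 * size L).+2 = Some (2 * size L).+1].
  rewrite tri_rcons tmap_rcons zig_rcons size_tmap -E1; split=> // i d' r' x'.
  rewrite onth_rcons; case: ltnP => [hi h|_]; last first.
    by case: eqP => // -> [<- _ _].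
  by rewrite /= !rst2_cat ?size_tri; first exact: E2 h; lia.
rewrite rst_tblock; move: E2; move: (rst _ _) E1 sR sR1 => -[R1 R2] /= E1 sR sR1 E2.
case: r hr => [j [r' [x' h]]|hd].
  have hj := onth_lt h; have [h0 h1 h2] := E2 _ _ _ _ h.
  case: d h h0 h1 h2 => h h0 h1 h2 /=; rewrite /rst_step /=; push_nth;
    rewrite /= in h0 h1 h2; rewrite ?h1; try rewrite (h0 isT); try rewrite (h2 isT);
    rewrite ?size_rcons ?sR1 ?E ?addn0 ?addn1 -!cats1 -!catA /=;
    split=> //; (split=> //; try (congr Some; lia)).
rewrite hd /= /rst_step /=; push_nth; rewrite ?size_rcons ?sR1 ?addn0 ?addn1 -!cats1 -!catA /=.
split=> //; (split=> //; try (congr Some; lia)).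
Qed.

(** A hidden B-move leads, through its B-ancestors, to the C-move that opens its tree. Thus an
    initial A-move pointing to the B-move of its root block ends up pointing to the C-move, as
    [snd_ptr] prescribes. *)
Lemma rst_tri_AC L : wf L ->
  (rst (@in_AC A B C) (tri L)).1 = zig (tmap pAC L) /\
  forall i d r x, onth L i = Some (d, r, x) ->
    let T := (rst (@in_AC A B C) (tri L)).2 in
    [/\ nth None T (3 * i) = Some (2 * i),
        exists i0 x0, onth L i0 = Some (true, None, x0) /\
          nth None T (3 * i).+1 = Some (2 * i0)
      & nth None T (3 * i).+2 = Some (2 * i).+1].
Proof.
elim/last_ind: L => [_|L [[d r] x] IH /wf_rcons[w hr]].
  by split=> // i d r x; rewrite onth0n.
have [E1 E2] := IH w.
have sR : size (rst (@in_AC A B C) (tri L)).2 = 3 * size L.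
  by rewrite size_rst2 size_tri.
have sR1 : size (rst (@in_AC A B C) (tri L)).1 = 2 * size L.
  by rewrite E1 size_zig size_tmap.
suff [E3 E4] : (rst (@in_AC A B C) (tri L ++ tblock (3 * size L) (d, r, x))).1 =
     (rst (@in_AC A B C) (tri L)).1 ++ zblock (2 * size L) (d, r, pAC x) /\
    let T := (rst (@in_AC A B C) (tri L ++ tblock (3 * size L) (d, r, x))).2 in
    [/\ nth None T (3 * size L) = Some (2 * size L),
        exists i0 x0, onth (rcons L (d, r, x)) i0 = Some (true, None, x0) /\
          nth None T (3 * size L).+1 = Some (2 * i0)
      & nth None T (3 * size L).+2 = Some (2 * size L).+1].
  rewrite tri_rcons tmap_rcons zig_rcons size_tmap -E1; split=> // i d' r' x'.
  rewrite onth_rcons; case: ltnP => [hi h|_]; last first.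
    by case: eqP => // -> _.
  have [h0 [i0 [x0 [h1 Ei]]] h2] := E2 _ _ _ _ h.
  rewrite /= !rst2_cat ?size_tri; try lia; split=> //.
  by exists i0, x0; rewrite onth_rcons (onth_lt h1).
rewrite rst_tblock; move: E2; move: (rst _ _) E1 sR sR1 => -[R1 R2] /= E1 sR sR1 E2.
case: r hr => [j [r' [x' h]]|hd].
  have hj := onth_lt h; have [h0 [i0 [x0 [h1 E]]] h2] := E2 _ _ _ _ h.
  case: d h h0 h1 h2 => h h0 h1 h2 /=; rewrite /rst_step /=; push_nth;
    rewrite /= in h0 h1 h2; rewrite ?h0 ?h2 ?size_rcons ?sR1 ?E ?addn0 ?addn1 -!cats1 -!catA /=;
    split=> //; (split=> //; try (congr Some; lia));
    by exists i0, x0; rewrite cats1 onth_rcons (onth_lt h1).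
rewrite hd /= /rst_step /=; push_nth; rewrite ?size_rcons ?sR1 ?addn0 ?addn1 -!cats1 -!catA /=.
split=> //; (split=> //; try (congr Some; lia));
by exists (size L), x; rewrite cats1 onth_last.
Qed.

End Tri.

(** * Justification, component by component *)

#[local] Arguments onth : simpl never.

(** For a zigzag play this is justification of its restriction to one component, with block indices
    as pointers. *)
Definition jcomp (A : arena) (X : Type) (g : X -> move A) (L : thread X) : Prop :=
  justified (A := A) [seq (g e.2, e.1.2) | e <- L].

Section Jcomp.
Variables (A : arena) (X : Type) (g : X -> move A).
Implicit Types L : thread X.

Lemma jcompP L : jcomp g L <-> forall i d r x, onth L i = Some (d, r, x) ->
  match r with
  | None => enables A None (g x)
  | Some j => exists d' r' x', [/\ j < i, onth L j = Some (d', r', x') &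
      enables A (Some (g x')) (g x)]
  end.
Proof.
split=> [h i d r x o|h i m p].
  have := h i (g x) r; rewrite onth_map o => /(_ erefl).
  case: r {o} => // j [n [q [ji]]]; rewrite onth_map.
  by case o: (onth L j) => [[[d' r'] x']|] //= [<- _]; exists d', r', x'.
rewrite onth_map; case o: (onth L i) => [[[d r] x]|] //= [<- <-].
have := h _ _ _ _ o; case: r {o} => // j [d' [r' [x' [ji o e]]]].
by exists (g x'), r'; rewrite onth_map o.
Qed.

Lemma jcomp_rcons L d r x : jcomp g (rcons L (d, r, x)) <->
  jcomp g L /\ match r with
  | None => enables A None (g x)
  | Some j => exists d' r' x', onth L j = Some (d', r', x') /\
      enables A (Some (g x')) (g x)
  end.
Proof.
split=> [/jcompP h|[/jcompP h h'] ].
  split.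
    apply/jcompP => i d' r' x' o; have := h i d' r' x'.
    rewrite onth_rcons (onth_lt o) => /(_ o); case: r' o => // j o.
    case=> [d1 [r1 [x1 [ji o' e]]]]; exists d1, r1, x1; split=> //.
    by move: o'; rewrite onth_rcons (ltn_trans ji (onth_lt o)).
  have := h _ _ _ _ (onth_last _ _); case: r {h} => // j [d' [r' [x' [ji o e]]]].
  by exists d', r', x'; split=> //; move: o; rewrite onth_rcons ji.
apply/jcompP => i d' r' x'; rewrite onth_rcons; case: ltnP => [hi o|_].
  have := h _ _ _ _ o; case: r' {o} => // j [d1 [r1 [x1 [ji o e]]]].
  by exists d1, r1, x1; rewrite onth_rcons (onth_lt o).
case: eqP => // -> [_ <- <-]; case: r h' => // j [d1 [r1 [x1 [o e]]]].
by exists d1, r1, x1; rewrite onth_rcons (onth_lt o).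
Qed.

Lemma jcomp_tmap (Y : Type) (h : Y -> X) (L : thread Y) :
  jcomp g (tmap h L) <-> jcomp (fun y => g (h y)) L.
Proof. by rewrite /jcomp /tmap -map_comp. Qed.

(** A root carries an initial, hence Opponent, move and has direction [true]; both the player and
    the direction alternate along pointers. *)
Lemma jcomp_player L i d r x : wf L -> jcomp g L ->
  onth L i = Some (d, r, x) -> (label (g x)).1 = if d then Opponent else Proponent.
Proof.
move=> w /jcompP j; elim/ltn_ind: i d r x => i IH d r x h.
have := w _ _ _ _ h; have := j _ _ _ _ h; case: r {h} => [k|/initial_label ->]; last by case: d.
move=> [d' [r' [x' [ki h e]]]] [_ [r1 [x1]]]; rewrite h => -[E _ _].
have := enables_alternates e; rewrite (IH _ ki _ _ _ h) E.
by case: d {E} => /=; case: (label (g x)).1.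
Qed.

End Jcomp.

Section ZigPlays.
Variables A B : arena.

(** Pointers stay within a component, except at a root, where the pointer from left to right needs
    both moves to be initial. *)
Lemma justified_zig (L : thread (move A * move B)) :
  wf L -> (justified (A := arrow A B) (zig L) <->
           jcomp (@fst _ _) L /\ jcomp (@snd _ _) L).
Proof.
move=> w; split=> [j|[/jcompP j1 /jcompP j2] k m p].
  split; apply/jcompP => i d r x h; have [h1 h2] := onth_zig h; have := w _ _ _ _ h;
  have := j _ _ _ h1; have := j _ _ _ h2; move: h1; clear h2; case: r {h} => [k|] z1 /=.
  - move=> [n2 [q2 [_ o2 e2]]] [n1 [q1 [_ o1 e1]]] [ki [r' [x' h]]].
    exists (~~ d), r', x'; split=> //; have [h1 h2] := onth_zig h.
    move: o2 o1; rewrite h1 h2 /zfst /zsnd => -[E2 _] [E1 _].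
    by move: e1 e2; rewrite -E1 -E2; case: (d).
  - move=> [n2 [q2 [_ o2 e2]]] _ dT; move: e2 o2 z1; rewrite dT /zsnd /zfst /=.
    by move=> + -> [E _]; rewrite E => -[].
  - move=> [n2 [q2 [_ o2 e2]]] [n1 [q1 [_ o1 e1]]] [ki [r' [x' h]]].
    exists (~~ d), r', x'; split=> //; have [h1 h2] := onth_zig h.
    move: o2 o1; rewrite h1 h2 /zfst /zsnd => -[E2 _] [E1 _].
    by move: e1 e2; rewrite -E1 -E2; case: (d).
  - by move=> _ + dT; rewrite dT.
move=> /onth_zig_inv[i [d [r [x [h]]]]].
have := w _ _ _ _ h; have := j1 _ _ _ _ h; have := j2 _ _ _ _ h.
have [z1 z2] := onth_zig h.
case: r h z1 z2 => [j|] h z1 z2 /=.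
  move=> [d2 [r2 [x2 [_ h2 e2]]]] [d1 [r1 [x1 [_ h1 e1]]]] [ji [r3 [x3 h3]]].
  rewrite h1 in h2 h3; case: h2 => ? ? ?; case: h3 => ? ? ?; subst.
  have [y1 y2] := onth_zig h1.
  case=> -[-> [-> ->]] /=.
    by exists (zsnd (~~ d) x3); rewrite y2; eexists; split=> //; [lia|case: (d) e1 e2].
  by exists (zfst (~~ d) x3); rewrite y1; eexists; split=> //; [lia|case: (d) e1 e2].
move=> e2 e1 dT; rewrite dT in z1 *.
case=> -[-> [-> ->]] //=.
by exists (inr x.2), None; split.
Qed.

End ZigPlays.

Section SkeletonZig.
Variables (A B A' B' : arena) (X : Type).
Variables (g1 : X -> move A) (g2 : X -> move B) (h1 : X -> move A') (h2 : X -> move B').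

(** Players are forced by the directions ([jcomp_player]), so the question/answer kinds are all that
    has to be compared when a component of a play is replaced. *)
Lemma skeleton_zig (L : thread X) : wf L ->
    jcomp g1 L -> jcomp g2 L -> jcomp h1 L -> jcomp h2 L ->
    (forall i d r x, onth L i = Some (d, r, x) ->
      (label (g1 x)).2 = (label (h1 x)).2 /\ (label (g2 x)).2 = (label (h2 x)).2) ->
  skeleton (A := arrow A B) (zig (tmap (fun x => (g1 x, g2 x)) L)) =
  skeleton (A := arrow A' B') (zig (tmap (fun x => (h1 x, h2 x)) L)).
Proof.
elim/last_ind: L => // L [[d r] x] IH w j1 j2 k1 k2 K.
have o := onth_last L (d, r, x).
have [K1 K2] := K _ _ _ _ o.
have p1 := jcomp_player w j1 o; have p2 := jcomp_player w j2 o.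
have q1 := jcomp_player w k1 o; have q2 := jcomp_player w k2 o.
rewrite !tmap_rcons !zig_rcons /skeleton !map_cat !size_tmap; congr (_ ++ _).
  have [w' _] := (wf_rcons _ _ _ _).1 w.
  move/jcomp_rcons: j1 => [j1 _]; move/jcomp_rcons: j2 => [j2 _].
  move/jcomp_rcons: k1 => [k1 _]; move/jcomp_rcons: k2 => [k2 _].
  apply: IH => // i d' r' x' h; apply: (K i d' r').
  by rewrite onth_rcons (onth_lt h).
have E1 : label (g1 x) = label (h1 x).
  by move: p1 q1 K1; case: (label (g1 x)) (label (h1 x)) => [? ?] [? ?] /= -> -> ->.
have E2 : label (g2 x) = label (h2 x).
  by move: p2 q2 K2; case: (label (g2 x)) (label (h2 x)) => [? ?] [? ?] /= -> -> ->.
by rewrite /= /zfst /zsnd; case: (d) => /=; rewrite E1 E2.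
Qed.

End SkeletonZig.

(** * Copycat plays are zigzag *)

Section Copycat.
Variable A : arena.
Let dup (a : move A) := (a, a).

Lemma zig_copycat (L : thread (move A)) : wf L ->
  legal (A := arrow A A) (zig (tmap dup L)) -> copycat A (zig (tmap dup L)).
Proof.
move=> w l; split=> //; first exact: odd_size_zig.
move=> n en; have En : n = 2 * n./2 by rewrite mul2n even_halfK.
rewrite En take_zig -tmap_take; set L' := take _ L.
have w' : wf (tmap dup L') by apply/wf_tmap/wf_take.
have b := wf_backward_zig w'.
rewrite !restrict_rst //.
have [-> _] := rst_left_zig w'; have [-> _] := rst_right_zig w'.
by rewrite -!map_comp.
Qed.

(** Comparing the two restrictions at consecutive even prefixes forces every new pair to consist of
    one move played in both components, with the same justifying block. *)
Lemma copycat_zig s : copycat A s -> exists2 L, wf L & s = zig (tmap dup L).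
Proof.
have [n] := ubnP (size s); elim: n s => // n IH s ns [l es R].
case: (posnP (size s)) => [/size0nil ->|s0]; first by exists [::] => // i d r x; rewrite onth0n.
have sz : size s = (size s).-2.+2 by move: es s0; case: (size s) => [|[]].
have [s' [x [p [y [q E]]]]] : exists s' x p y q, s = rcons (rcons s' (x, p)) (y, q).
  case/lastP: s sz {IH ns l es R s0} => // s [y q]; case/lastP: s => // s [x p] _.
  by exists s, x, p, y, q.
rewrite {}E {s s0 sz} in ns l es R *.
rewrite !size_rcons /= negbK in es.
have [||L w E] := IH s'.
- by rewrite !size_rcons in ns; lia.
- split=> //.
    by move: l; rewrite -!cats1 -catA; apply: legal_prefix.
  move=> k ek; case: (leqP k (size s')) => h.
    by have := R k ek; rewrite -!cats1 -catA takel_cat.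
  rewrite !take_oversize //; try exact: ltnW.
  by have := R (size s') es; rewrite -!cats1 -catA take_size_cat.
subst s'; set L' := tmap dup L in l es R *.
have w' : wf L' by apply: wf_tmap.
have b : backward (zig L') := wf_backward_zig w'.
have [l1 jy ty _ vy] := (legal_rcons _ _ _).1 l.
have [l0 jx tx _ _] := (legal_rcons _ _ _).1 l1.
have := R (size (zig L')).+2; rewrite take_oversize ?size_rcons //= negbK => /(_ es).
have bl := legal_backward l; rewrite !restrict_rst //.
rewrite !rst_rcons; have [EL TL] := rst_left_zig w'; have [ER TR] := rst_right_zig w'.
have sL : size (rst (@in_left (move A) (move A)) (zig L')).2 = 2 * size L'.
  by rewrite size_rst2 size_zig.
have sR : size (rst (@in_right (move A) (move A)) (zig L')).2 = 2 * size L'.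
  by rewrite size_rst2 size_zig.
move: TL TR; move: (rst _ _) EL sL => -[L1 TL] /= EL sL.
move: (rst _ _) ER sR => -[R1 TR] /= ER sR HL HR.
have ELR : L1 = R1 by rewrite EL ER -!map_comp.
have ss : size L' = size L by rewrite size_tmap.
move: tx jx ty jy; rewrite size_rcons size_zig.
have -> : turn (2 * size L') = Opponent by rewrite /turn oddM.
have -> : turn (2 * size L').+1 = Proponent by rewrite /turn /= oddM.
clear ns; case: x l1 l bl R vy => a l1 l bl R vy; case: y l bl R vy => a' l bl R vy /=.
(* Two moves in the same component would make the two restrictions of different sizes. *)
- by move=> _ _ _ _; rewrite /rst_step /= ELR => /(congr1 size); rewrite !size_rcons; lia.
- move=> tx jx ty jy; rewrite /rst_step /= ELR => /rcons_inj[<- Epq].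
  clear vy; case: p l1 l bl R jx jy Epq => [j|//] l1 l bl R [[c|c] [q' [o e]]] jy Epq; last first.
    by case: e => _ /initial_label E; rewrite E in tx.
  have [i [d [r [x [h]]]]] := onth_zig_inv o.
  case=> -[Ej [Ec _]].
    have lc := legal_turn l0 o; rewrite Ej /turn oddM /= in lc.
    have := enables_alternates e; move: lc tx => /=.
    by case: (label c).1; case: (label a).1.
  case: d h Ec => // h _.
  case: q l bl R jy Epq => [k|] l bl R jy Epq; last by rewrite (initial_label jy) in ty.
  case: jy => -[c'|c'] [q'' [o' e']] //.
  rewrite onth_rcons size_zig in o'; move: o'; case: ltnP => [hk o'|_]; last by case: eqP.
  have [i' [d' [r1 [x1 [h']]]]] := onth_zig_inv o'.
  have [HL1 _] := HL _ _ _ _ h; rewrite /= addn1 -Ej in HL1.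
  have Hk := HR _ _ _ _ h'.
  have {Epq} : Some i = nth None TR k.
    by rewrite /= in Epq; rewrite -HL1 Epq nth_rcons sR hk.
  move=> E [] [Ek [Ec' _]].
    case: d' h' Ec' Hk => // h' _; rewrite /= addn0 -Ek -E => -[Ei]; subst i'.
    exists (rcons L (false, Some i, a)).
      apply/wf_rcons; split=> //; have [z hz _] := onth_tmap_inv h.
      by exists r, z.
    rewrite tmap_rcons zig_rcons2 /= /zfst /zsnd /fst_ptr /snd_ptr /=.
    by rewrite Ej Ek.
  case: d' h' Ec' Hk => // h' _; rewrite /= addn1 -Ek -E => -[Ei]; subst i'.
  by move: h'; rewrite h.
- move=> tx jx ty jy; rewrite /rst_step /= ELR => /rcons_inj[<- Epq].
  case: q l bl R jy Epq vy => [k|] l bl R // jy Epq vy.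
  have [r [Ep hr]] : exists r, p = fst_ptr r /\
      match r with None => True | Some j => exists r' x', onth L j = Some (false, r', x') end.
    case: p l1 l bl R jx Epq jy vy => [j|] l1 l bl R jx Epq jy vy; last by exists None.
    case: jx => -[c|c] [q' [o e]] //.
    have [i [d [r [x [h]]]]] := onth_zig_inv o.
    case=> -[Ej [Ec _]].
      have lc := legal_turn l0 o; rewrite Ej /turn oddM /= in lc.
      have := enables_alternates e; move: lc tx => /=.
      by case: (label c).1; case: (label a).1.
    case: d h Ec => // h _.
    by exists (Some i); rewrite Ej; split=> //; have [z hz _] := onth_tmap_inv h; exists r, z.
  suff Ek : Some k = snd_ptr (2 * size L) r.
    exists (rcons L (true, r, a')); first by apply/wf_rcons; split=> //; case: (r) hr.
    by rewrite tmap_rcons zig_rcons2 /= size_tmap /zfst /zsnd /= -Ek -Ep.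
  subst p.
  (* At a root the left restriction erases the pointer, so comparing restrictions does not determine
     it. Visibility does: the Proponent view after an initial move is that move alone. *)
  case: r hr l1 l bl R vy jx jy Epq => [i [r' [z h]]|_] l1 l bl R vy jx jy Epq; last first.
    have : k \in view (A := arrow A A) Proponent (rcons (zig L') (inr a, None)).
      by rewrite -ty; apply: vy.
    rewrite /view size_rcons size_zig /= onth_rcons size_zig ltnn eqxx /=.
    by rewrite tx /= inE => /eqP ->; rewrite size_tmap.
  have h' := onth_tmap dup h; rewrite /= in Epq.
  have Ei : nth None TR (2 * i).+1 = Some i by have := HR _ _ _ _ h'; rewrite /= addn1.
  rewrite Ei in Epq; case: jy => [n' [q' [o e]]].
  move: o Epq; rewrite onth_rcons size_zig nth_rcons sL; case: ltnP => [hk o|_]; last first.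
    case: eqP => // _ _.
    by have [_ /=] := HL _ _ _ _ h'; rewrite addn1 => ->.
  have [i' [d [r1 [x1 [h1]]]]] := onth_zig_inv o.
  have [k1 k2] := HL _ _ _ _ h1.
  by case: d h1 k1 k2 => h1 /=; rewrite ?addn0 ?addn1 => k1 k2 [] [-> _];
    rewrite ?k1 ?k2 // => -[E]; subst i'; rewrite h' in h1.
- by move=> _ _ _ _; rewrite /rst_step /= ELR => /(congr1 size); rewrite !size_rcons; lia.
Qed.

End Copycat.

(** * Interactions *)

Lemma justified_rcons (A : arena) (s : jseq (move A)) m p :
  justified (rcons s (m, p)) <-> justified s /\
    match p with
    | None => enables A None m
    | Some j => exists n q, onth s j = Some (n, q) /\ enables A (Some n) m
    end.
Proof.
split=> [j|[j h] i n q].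
  split=> [i n q h|].
    have := j i n q; rewrite onth_rcons (onth_lt h) => /(_ h).
    case: q h => // k h [n' [q [ki hk e]]]; exists n', q; split=> //.
    by move: hk; rewrite onth_rcons (ltn_trans ki (onth_lt h)).
  have := j _ _ _ (onth_last s (m, p)); case: p j => // k j [n [q [jl h e]]].
  by exists n, q; split=> //; move: h; rewrite onth_rcons jl.
rewrite onth_rcons; case: ltnP => [hi o|_].
  have := j _ _ _ o; case: q o => // k o [n' [q [ki hk e]]].
  by exists n', q; split=> //; rewrite onth_rcons (onth_lt hk).
case: eqP => // -> [<- <-]; case: p h => // k [n' [q' [o e]]].
exists n', q'; split=> //; first exact: onth_lt o.
by rewrite onth_rcons (onth_lt o).
Qed.

Lemma cat3 (T : Type) (s : seq T) x y z :
  s ++ [:: x; y; z] = rcons (rcons (rcons s x) y) z.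
Proof. by rewrite -!cats1 -!catA. Qed.

Lemma rcons2 (M : Type) (s : jseq M) x y : rcons (rcons s x) y = s ++ [:: x; y].
Proof. by rewrite -!cats1 -catA. Qed.

Section TriPlays.
Variables A B C : arena.
Let M := (move A * move B * move C)%type.
Implicit Types L : thread M.

Lemma onth_triA L i d r (x : M) : onth L i = Some (d, r, x) ->
  exists q, onth (tri L) (3 * i + (if d then 2 else 0)) = Some (inl (inl x.1.1), q).
Proof.
by move=> h; case: d h => h; rewrite (onth_tri h) //; case: r h => *; eexists.
Qed.

Lemma onth_triB L i d r (x : M) : onth L i = Some (d, r, x) ->
  exists q, onth (tri L) (3 * i + 1) = Some (inl (inr x.1.2), q).
Proof.
by move=> h; case: d h => h; rewrite (onth_tri h) //; case: r h => *; eexists.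
Qed.

Lemma onth_triC L i d r (x : M) : onth L i = Some (d, r, x) ->
  exists q, onth (tri L) (3 * i + (if d then 0 else 2)) = Some (inr x.2, q).
Proof.
by move=> h; case: d h => h; rewrite (onth_tri h) //; case: r h => *; eexists.
Qed.

Lemma onth_triA_inv L j a q : onth (tri L) j = Some (inl (inl a), q) ->
  exists i d r x, [/\ onth L i = Some (d, r, x), a = x.1.1 &
    j = 3 * i + (if d then 2 else 0)].
Proof.
move=> /onth_tri_inv[i [d [r [x [l [h]]]]]].
case: l => [|[|[|//]]] _ Ej; case: d h => h; case: r h => [k|] h; rewrite /onth //= => -[E _];
  by do 4 eexists; split; [exact: h|done|].
Qed.

Lemma onth_triB_inv L j b q : onth (tri L) j = Some (inl (inr b), q) ->
  exists i d r x, [/\ onth L i = Some (d, r, x), b = x.1.2 & j = 3 * i + 1].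
Proof.
move=> /onth_tri_inv[i [d [r [x [l [h]]]]]].
case: l => [|[|[|//]]] _ Ej; case: d h => h; case: r h => [k|] h; rewrite /onth //= => -[E _];
  by do 4 eexists; split; [exact: h|done|].
Qed.

Lemma onth_triC_inv L j c q : onth (tri L) j = Some (inr c, q) ->
  exists i d r x, [/\ onth L i = Some (d, r, x), c = x.2 &
    j = 3 * i + (if d then 0 else 2)].
Proof.
move=> /onth_tri_inv[i [d [r [x [l [h]]]]]].
case: l => [|[|[|//]]] _ Ej; case: d h => h; case: r h => [k|] h; rewrite /onth //= => -[E _];
  by do 4 eexists; split; [exact: h|done|].
Qed.

Definition prA (x : M) := x.1.1.
Definition prB (x : M) := x.1.2.
Definition prC (x : M) := x.2.

Lemma justified_tri L : wf L -> jcomp prA L -> jcomp prB L -> jcomp prC L ->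
  justified (A := arrow (arrow A B) C) (tri L).
Proof.
elim/last_ind: L => [|L [[d r] x] IH].
  by move=> _ _ _ _ i m p; rewrite onth0n.
move=> /wf_rcons[w hr] /jcomp_rcons[ja ha] /jcomp_rcons[jb hb] /jcomp_rcons[jc hc].
have {IH} j := IH w ja jb jc; rewrite tri_rcons.
case: r hr ha hb hc => [k [r [y h]]|-> ha hb hc]; last first.
  rewrite /tblock /= cat3.
  apply/justified_rcons; split; [apply/justified_rcons; split;
    [apply/justified_rcons; split=> //|] |].
    by exists (inr x.2), None; rewrite -size_tri onth_last.
  exists (inl (inr x.1.2)), (Some (3 * size L)); split=> //.
  by rewrite onth_rcons !size_rcons size_tri ltnn eqxx.
move=> [d1 [r1 [x1 [h1 ea]]]] [d2 [r2 [x2 [h2 eb]]]] [d3 [r3 [x3 [h3 ec]]]].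
rewrite h in h1 h2 h3; case: h1 => ? ? ?; case: h2 => ? ? ?; case: h3 => ? ? ?; subst.
have [qa oa] := onth_triA h; have [qb ob] := onth_triB h; have [qc oc] := onth_triC h.
rewrite addn1 in ob.
by case: d h oa oc => h; rewrite /= ?addn0 ?addn2 => oa oc;
  rewrite /tblock /= cat3;
  (apply/justified_rcons; split; [apply/justified_rcons; split;
    [apply/justified_rcons; split=> //|] |]);
  do 2 eexists; (split; [rewrite ?onth_rcons ?size_rcons;
    rewrite ?(onth_lt oa) ?(onth_lt ob) ?(onth_lt oc);
    rewrite ?(ltn_trans (onth_lt oa) (ltnSn _)) ?(ltn_trans (onth_lt oc) (ltnSn _));
    by [exact: oa|exact: ob|exact: oc]|]).
Qed.

Lemma restrict_tri L : wf L -> justified (A := arrow (arrow A B) C) (tri L) ->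
  [/\ restrict (@in_AB A B C) (tri L) = zig (tmap (@pAB A B C) L),
      restrict (@in_BC A B C) (tri L) = zig (tmap (@pBC A B C) L)
    & restrict (@in_AC A B C) (tri L) = zig (tmap (@pAC A B C) L)].
Proof.
move=> w /justified_backward b; rewrite !restrict_rst //.
by have [-> _] := rst_tri_AB w; have [-> _] := rst_tri_BC w; have [-> _] := rst_tri_AC w.
Qed.

Variables (sigma : set (jseq (move (arrow A B)))) (tau : set (jseq (move (arrow B C)))).

(** Interactions are built occurrence by occurrence, so their restrictions are given as computed
    folds; legality on the two sides comes with membership in the strategies. *)
Lemma compose_rst (u : jseq (move (arrow (arrow A B) C))) s1 s2 s3 :
    strategy sigma -> strategy tau -> justified u ->
    (rst (@in_AB A B C) u).1 = s1 -> (rst (@in_BC A B C) u).1 = s2 ->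
    (rst (@in_AC A B C) u).1 = s3 ->
    sigma s1 -> tau s2 -> legal (A := arrow A C) s3 ->
  compose sigma tau s3.
Proof.
move=> ss st j <- <- <- h1 h2 h3; exists u; have b := justified_backward j.
rewrite /interaction !restrict_rst //; split=> //; split=> //.
  exact: strategy_legal h1.
exact: strategy_legal h2.
Qed.

Lemma compose_tri L : strategy sigma -> strategy tau ->
    wf L -> jcomp prA L -> jcomp prB L -> jcomp prC L ->
    sigma (zig (tmap (@pAB A B C) L)) -> tau (zig (tmap (@pBC A B C) L)) ->
    legal (A := arrow A C) (zig (tmap (@pAC A B C) L)) ->
  compose sigma tau (zig (tmap (@pAC A B C) L)).
Proof.
move=> ss st w ja jb jc; apply: (compose_rst (u := tri L)) => //.
- exact: justified_tri.
- by have [] := rst_tri_AB w.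
- by have [] := rst_tri_BC w.
- by have [] := rst_tri_AC w.
Qed.

End TriPlays.

Definition isr (M N : Type) (x : M + N) : bool := if x is inr _ then true else false.

(* Proponent answers an Opponent move of direction [d] and justifying block [r]
   in the other component, with the same justifying block. *)
Definition respond (M N : Type) (sigma : set (jseq (M + N)))
    (L : thread (M * N)) (d : bool) (r : option nat) : Prop :=
  forall x y, sigma (zig L ++ [:: (x, fst_ptr r); y]) -> isr x = d ->
    isr y.1 = ~~ d /\ y.2 = snd_ptr (2 * size L) r.

(** * Decomposition of an interaction into triples *)

Section Parse.
Variables A B C : arena.
Variables (sigma : set (jseq (move (arrow A B)))) (tau : set (jseq (move (arrow B C)))).
Hypotheses (ss : strategy sigma) (st : strategy tau).
Variable u : jseq (move (arrow (arrow A B) C)).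
Hypotheses (iu : interaction u) (su : sigma (restrict (@in_AB A B C) u))
  (tu : tau (restrict (@in_BC A B C) u)).
Let M := (move A * move B * move C)%type.
Implicit Types L : thread M.

(** Asked only at stages compatible with [u] and for its next external move [m]: strategies built
    from a path relation always respond in this way, but in the converse direction this is known
    only along the branch under consideration. *)
Hypothesis H : forall L d r m w, wf L ->
  sigma (zig (tmap (@pAB A B C) L)) -> tau (zig (tmap (@pBC A B C) L)) ->
  restrict (@in_AC A B C) u = zig (tmap (@pAC A B C) L) ++ (m, fst_ptr r) :: w ->
  isr m = d ->
  respond sigma (tmap (@pAB A B C) L) d r /\ respond tau (tmap (@pBC A B C) L) d r.

Let bu : backward u.
Proof. by case: iu => /justified_backward. Qed.

Let AB_prefix v w : u = v ++ w -> let s := (rst (@in_AB A B C) v).1 in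
  legal (A := arrow A B) s /\ (~~ odd (size s) -> sigma s).
Proof.
move=> E /=; have := su; rewrite restrict_rst // E.
have [w' -> _] := rst_cat (@in_AB A B C) v w => h; split.
  exact: legal_prefix (strategy_legal ss h).
exact: strategy_prefix ss h.
Qed.

Let BC_prefix v w : u = v ++ w -> let s := (rst (@in_BC A B C) v).1 in
  legal (A := arrow B C) s /\ (~~ odd (size s) -> tau s).
Proof.
move=> E /=; have := tu; rewrite restrict_rst // E.
have [w' -> _] := rst_cat (@in_BC A B C) v w => h; split.
  exact: legal_prefix (strategy_legal st h).
exact: strategy_prefix st h.
Qed.

Let AC_prefix v w : u = v ++ w -> let s := (rst (@in_AC A B C) v).1 in
  legal (A := arrow A C) s /\ exists w', restrict (@in_AC A B C) u = s ++ w'.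
Proof.
move=> E /=; have [_ _ _] := iu; rewrite restrict_rst // E.
have [w' -> _] := rst_cat (@in_AC A B C) v w => h; split; last by exists w'.
exact: legal_prefix h.
Qed.

Let turn_last (D : arena) (s : jseq (move D)) m p :
  legal (rcons s (m, p)) -> (label m).1 = turn (size s).
Proof. by case/legal_rcons. Qed.

(** At the end of a triple all three restrictions have even length. Each component is shared by two
    restrictions, so comparing whose turn it is in both leaves few candidates for the next move, and
    [H] removes the wrong ones. The even length of the plays of [sigma] and [tau] ensures that a
    triple once started is completed. *)
Let step L v : wf L -> u = tri L ++ v -> v <> [::] ->
  exists d r x v', wf (rcons L (d, r, x)) /\ u = tri (rcons L (d, r, x)) ++ v'.
Proof.
move=> w Eu v0.
have ju : justified u by case: iu.
have [EAB TAB] := rst_tri_AB w; have [EBC TBC] := rst_tri_BC w.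
have [EAC TAC] := rst_tri_AC w.
have sAB : size (rst (@in_AB A B C) (tri L)).2 = 3 * size L by rewrite size_rst2 size_tri.
have sBC : size (rst (@in_BC A B C) (tri L)).2 = 3 * size L by rewrite size_rst2 size_tri.
have sAC : size (rst (@in_AC A B C) (tri L)).2 = 3 * size L by rewrite size_rst2 size_tri.
have rc (N : Type) (f : move A + move B + move C -> option N) w' :
  rst f (tri L ++ w') = foldl (rst_step f) (rst f (tri L)) w' by rewrite /rst foldl_cat.
have PAB w' w'' : v = w' ++ w'' -> let s := (foldl (rst_step (@in_AB A B C)) (rst (@in_AB A B C) (tri L)) w').1 in
    legal (A := arrow A B) s /\ (~~ odd (size s) -> sigma s).
  by move=> E; rewrite -rc; apply: (AB_prefix (w := w'')); rewrite Eu E catA.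
have PBC w' w'' : v = w' ++ w'' -> let s := (foldl (rst_step (@in_BC A B C)) (rst (@in_BC A B C) (tri L)) w').1 in
    legal (A := arrow B C) s /\ (~~ odd (size s) -> tau s).
  by move=> E; rewrite -rc; apply: (BC_prefix (w := w'')); rewrite Eu E catA.
have PAC w' w'' : v = w' ++ w'' -> let s := (foldl (rst_step (@in_AC A B C)) (rst (@in_AC A B C) (tri L)) w').1 in
    legal (A := arrow A C) s /\ exists z, restrict (@in_AC A B C) u = s ++ z.
  by move=> E; rewrite -rc; apply: (AC_prefix (w := w'')); rewrite Eu E catA.
have szAB : size (zig (tmap (@pAB A B C) L)) = 2 * size L by rewrite size_zig size_tmap.
have szBC : size (zig (tmap (@pBC A B C) L)) = 2 * size L by rewrite size_zig size_tmap.
have szAC : size (zig (tmap (@pAC A B C) L)) = 2 * size L by rewrite size_zig size_tmap.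
have [lAB hAB] := PAB [::] v erefl; have [lBC hBC] := PBC [::] v erefl.
have [lAC _] := PAC [::] v erefl.
rewrite /= EAB in lAB hAB; rewrite /= EBC in lBC hBC; rewrite /= EAC in lAC.
have {}hAB := hAB (odd_size_zig _); have {}hBC := hBC (odd_size_zig _).
have onu j n q : j < 3 * size L -> onth u j = Some (n, q) -> onth (tri L) j = Some (n, q).
  by move=> hj; rewrite Eu onth_prefix // size_tri.
have uAB := PAB v [::]; have uBC := PBC v [::]; rewrite cats0 in uAB uBC.
have {}uAB : ~~ odd (size (foldl (rst_step (@in_AB A B C)) (rst (@in_AB A B C) (tri L)) v).1).
  by rewrite -rc -Eu -restrict_rst //; have [_ /(_ _ su)[]] := ss.
have {}uBC : ~~ odd (size (foldl (rst_step (@in_BC A B C)) (rst (@in_BC A B C) (tri L)) v).1).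
  by rewrite -rc -Eu -restrict_rst //; have [_ /(_ _ tu)[]] := st.
move: (rst (@in_AB A B C) (tri L)) (rst (@in_BC A B C) (tri L)) (rst (@in_AC A B C) (tri L))
  EAB TAB EBC TBC EAC TAC sAB sBC sAC PAB PBC PAC uAB uBC {rc}.
move=> [sab RAB] [sbc RBC] [sac RAC] /= EAB TAB EBC TBC EAC TAC sAB sBC sAC PAB PBC PAC uAB uBC.
subst sab sbc sac.
case: v v0 Eu PAB PBC PAC uAB uBC => // -[x p] v1 _ Eu PAB PBC PAC uAB uBC.
have ox : onth u (3 * size L) = Some (x, p).
  by rewrite Eu onth_cat size_tri ltnn subnn.
have [lAB1 _] := PAB [:: _] v1 erefl; have [lBC1 _] := PBC [:: _] v1 erefl.
have [lAC1 [z AC1]] := PAC [:: _] v1 erefl.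
have jx := ju _ _ _ ox.
case: x Eu PAB PBC PAC uAB uBC ox lAB1 lBC1 lAC1 AC1 jx => [[a|b]|c]
  Eu PAB PBC PAC uAB uBC ox lAB1 lBC1 lAC1 AC1 jx.
- rewrite /= /rst_step /= in lAB1 lAC1 AC1.
  have ta : dual (label a).1 = Opponent by have := turn_last lAC1; rewrite szAC turn_even.
  case: p Eu PAB PBC PAC uAB uBC ox lAB1 lBC1 lAC1 AC1 jx => [j|//]
      Eu PAB PBC PAC uAB uBC ox lAB1 lBC1 lAC1 AC1 jx.
  have [n [q [jl o e]]] := jx; have o' := onu _ _ _ jl o.
  case: n o o' e => [[a'|b']|c'] o o' e; last by case: e.
  2: {
    have [_ e'] : enables B None b' /\ enables A None a := e.
    by rewrite (initial_label e') in ta. }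
  have [i [d [r [y [h Ec Ej]]]]] := onth_triA_inv o'.
  case: d h Ej => h Ej; last first.
    have [z1 _] := onth_zig (onth_tmap (@pAC A B C) h).
    have := legal_turn lAC z1; rewrite turn_even /= -Ec => ta'.
    have /enables_alternates : enables A (Some a') a := e; move: ta ta'.
    by case: (label a).1; case: (label a').1.
  rewrite addn2 in Ej; subst j.
  have hi := onth_lt h.
  have [AB0 AB1' AB2] := TAB _ _ _ _ h; have [BC0 BC1 _] := TBC _ _ _ _ h.
  have [AC0 _ AC2] := TAC _ _ _ _ h; rewrite /= ?addn0 ?addn1 in AB0 AB1' AB2 BC0 BC1.
  have {}BC0 := BC0 isT.
  rewrite /= AC2 in AC1; rewrite cat_rcons in AC1.
  have [rs rt] := H (r := Some i) (d := false) w hAB hBC AC1 erefl.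
  case: v1 Eu PAB PBC PAC uAB uBC => [|[x2 p2] v2] Eu PAB PBC PAC uAB uBC.
    by move: uAB; rewrite /= /rst_step /= size_rcons szAB /= oddM.
  have ox2 : onth u (3 * size L).+1 = Some (x2, p2).
    by rewrite Eu onth_cat size_tri ltnNge leqnSn /= subSn // subnn.
  have jx2 := ju _ _ _ ox2.
  have [lAB2 sAB2] := PAB [:: _; _] v2 erefl; have [lBC2 _] := PBC [:: _; _] v2 erefl.
  have [lAC2 _] := PAC [:: _; _] v2 erefl.
  rewrite /= /rst_step /= ?AB2 ?AC2 in lAB2 sAB2 lBC2 lAC2.
  case: x2 Eu PAB PBC PAC uAB uBC ox2 jx2 lAB2 sAB2 lBC2 lAC2 => [[a2|b]|c]
    Eu PAB PBC PAC uAB uBC ox2 jx2 lAB2 sAB2 lBC2 lAC2; rewrite /= in lAB2 sAB2 lBC2 lAC2.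
  + rewrite !size_rcons szAB /= negbK oddM rcons2 in sAB2.
    by have [] := rs _ _ (sAB2 isT) erefl.
  + rewrite !size_rcons szAB /= negbK oddM rcons2 in sAB2.
    have [_ /=] := rs _ _ (sAB2 isT) erefl; rewrite size_tmap /snd_ptr => Ep2.
    (* The restriction gives only the image of [p2], namely 2i. Among the B- and C-moves that may
       enable [b], only the B-move of block [i] leads there. *)
    have {Ep2} Ep2 : p2 = Some (3 * i).+1.
      case: p2 Ep2 jx2 {Eu PAB PBC PAC uAB uBC ox2 lAB2 sAB2 lBC2 lAC2} => [j|] //= Ep2.
      move=> [n [q' [jl' o2 e2]]].
      rewrite nth_rcons sAB in Ep2; move: Ep2; case: ltnP => [hj|hj]; last first.
        have -> : j = 3 * size L by lia.
        by rewrite eqxx => -[]; lia.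
      have {o2} := onu _ _ _ hj o2; case: n e2 => [[//|b']|c'] e2.
        move=> /onth_triB_inv[k [d [r' [y' [h' _ Ek]]]]].
        have [_ + _] := TAB _ _ _ _ h'; rewrite -addn1 -Ek => -> [E].
        by congr Some; move: E; case: (d) => /=; lia.
      move=> /onth_triC_inv[k [d [r' [y' [h' _ Ek]]]]].
      have [k0 _ k2] := TAB _ _ _ _ h'; rewrite Ek.
      by case: d h' k0 k2 {Ek} => h' /= k0 k2; rewrite ?addn0 ?addn2 ?k0 ?k2.
    subst p2.
    have hl : (3 * i).+1 < 3 * size L by lia.
    have hl0 : 3 * i < 3 * size L by lia.
    case: v2 Eu PAB PBC PAC uAB uBC => [|[x3 p3] v3] Eu PAB PBC PAC uAB uBC.
      by move: uBC; rewrite /= /rst_step /= size_rcons szBC /= oddM.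
    have ox3 : onth u (3 * size L).+2 = Some (x3, p3).
      by rewrite Eu onth_cat size_tri ltnNge (leq_trans (leqnSn _) (leqnSn _)) /= !subSn // ?subnn.
    have jx3 := ju _ _ _ ox3.
    have [lAB3 _] := PAB [:: _; _; _] v3 erefl; have [_ sBC3] := PBC [:: _; _; _] v3 erefl.
    have [lAC3 _] := PAC [:: _; _; _] v3 erefl.
    rewrite /= /rst_step /= nth_rcons sBC hl BC1 in sBC3.
    rewrite /= /rst_step /= in lAB3 lAC3.
    case: x3 Eu PAB PBC PAC uAB uBC ox3 jx3 lAB3 sBC3 lAC3 => [[a3|b3]|c]
      Eu PAB PBC PAC uAB uBC ox3 jx3 lAB3 sBC3 lAC3; rewrite /= in lAB3 sBC3 lAC3.
    (* An A-move has the same label in both restrictions, but it is Opponent's turn in one and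
       Proponent's in the other. *)
    * have := turn_last lAB3; have := turn_last lAC3.
      rewrite !size_rcons szAB szAC turn_odd /turn /= negbK oddM /=.
      by case: (label a3).1.
    * rewrite !size_rcons szBC /= negbK oddM rcons2 in sBC3.
      by have [] := rt _ _ (sBC3 isT) erefl.
    * rewrite !size_rcons szBC /= negbK oddM rcons2 in sBC3.
      have [_ /=] := rt _ _ (sBC3 isT) erefl; rewrite size_tmap /snd_ptr => Ep3.
      have {Ep3} Ep3 : p3 = Some (3 * i).
        case: p3 Ep3 jx3 {Eu PAB PBC PAC uAB uBC ox3 lAB3 sBC3 lAC3} => [j|] //= Ep3.
        move=> [n [q' [jl' o3 e3]]]; case: n e3 o3 => // c' e3 o3.
        have hj : j < 3 * size L.
          case: (ltnP j (3 * size L)) => // hj; have [Ej|Ej] : j = 3 * size L \/ j = (3 * size L).+1 by lia.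
            by move: o3; rewrite Ej ox.
          by move: o3; rewrite Ej ox2.
        rewrite !nth_rcons size_rcons sBC (ltn_trans hj (ltnSn _)) hj in Ep3.
        have [k [d [r' [y' [h' _ Ek]]]]] := onth_triC_inv (onu _ _ _ hj o3).
        have [k0 _ k2] := TBC _ _ _ _ h'.
        case: d h' k0 k2 Ek => h' /= k0 k2 Ek; subst j.
          by move: Ep3; rewrite addn0 k0 // => -[E]; congr Some; lia.
        by move: Ep3; rewrite addn2 k2 // => -[E]; congr Some; lia.
      subst p3; exists false, (Some i), (a, b, c), v3; split.
        by apply/wf_rcons; split=> //; exists r, y.
      by rewrite tri_rcons -catA.
  + have := turn_last lBC2; have := turn_last lAC2.
    rewrite ?size_rcons szAC szBC turn_even turn_odd /=.
    by case: (label c).1.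
(* A triple cannot start with a B-move: B has opposite labels in the two restrictions, and it is
   Opponent's turn in both. *)
- rewrite /= /rst_step /= in lAB1 lBC1.
  have := turn_last lAB1; have := turn_last lBC1; rewrite szAB szBC turn_even /=.
  by case: (label b).1.
- rewrite /= /rst_step /= in lAC1 lBC1 AC1.
  have tc : (label c).1 = Opponent by have := turn_last lAC1; rewrite szAC turn_even.
  have [r [Ep hr]] : exists r, p = omap (fun j => (3 * j).+2) r /\
      match r with None => True | Some j => exists r' x', onth L j = Some (false, r', x') end.
    case: p Eu PAB PBC PAC uAB uBC ox lAB1 lBC1 lAC1 AC1 jx => [j|]
      Eu PAB PBC PAC uAB uBC ox lAB1 lBC1 lAC1 AC1 jx; last by exists None.
    have [n [q [jl o e]]] := jx; have o' := onu _ _ _ jl o.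
    case: n o o' e => [//|c'] o o' e.
    have [i [d [r [y [h Ec Ej]]]]] := onth_triC_inv o'.
    exists (Some i); case: d h Ej => h Ej; last by rewrite Ej addn2; split=> //; exists r, y.
    have [z1 _] := onth_zig (onth_tmap (@pAC A B C) h).
    have := legal_turn lAC z1; rewrite turn_even /= -Ec => tc'.
    by have /enables_alternates : enables C (Some c') c := e; rewrite tc tc'.
  have hr' : if r is Some j then j < size L else true.
    by case: r hr {Ep} => // j [r' [x' h]]; apply: onth_lt h.
  have pAC : obind (nth None RAC) p = fst_ptr r.
    by rewrite Ep; case: (r) hr => //= j [r' [x' h]]; have [_ _ ->] := TAC _ _ _ _ h.
  have pBC : obind (nth None RBC) p = fst_ptr r.
    by rewrite Ep; case: (r) hr => //= j [r' [x' h]]; have [_ _ ->] := TBC _ _ _ _ h.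
  have pAB : obind (nth None RAB) p = None.
    by rewrite Ep; case: (r) hr => //= j [r' [x' h]]; have [_ _ ->] := TAB _ _ _ _ h.
  rewrite pAC cat_rcons in AC1.
  have [rs rt] := H (r := r) (d := true) w hAB hBC AC1 erefl.
  case: v1 Eu PAB PBC PAC uAB uBC => [|[x2 p2] v2] Eu PAB PBC PAC uAB uBC.
    by move: uBC; rewrite /= /rst_step /= size_rcons szBC /= oddM.
  have ox2 : onth u (3 * size L).+1 = Some (x2, p2).
    by rewrite Eu onth_cat size_tri ltnNge leqnSn /= subSn // subnn.
  have jx2 := ju _ _ _ ox2.
  have [lAB2 _] := PAB [:: _; _] v2 erefl; have [lBC2 sBC2] := PBC [:: _; _] v2 erefl.
  have [lAC2 _] := PAC [:: _; _] v2 erefl.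
  rewrite /= /rst_step /= ?pAC ?pBC in lAB2 sBC2 lBC2 lAC2.
  case: x2 Eu PAB PBC PAC uAB uBC ox2 jx2 lAB2 sBC2 lBC2 lAC2 => [[a|b]|c2]
    Eu PAB PBC PAC uAB uBC ox2 jx2 lAB2 sBC2 lBC2 lAC2; rewrite /= in lAB2 sBC2 lBC2 lAC2.
  + have := turn_last lAB2; have := turn_last lAC2.
    rewrite ?size_rcons szAC szAB turn_even turn_odd /=.
    by case: (label a).1.
  + rewrite !size_rcons szBC /= negbK oddM rcons2 in sBC2.
    have [_ /=] := rt _ _ (sBC2 isT) erefl; rewrite size_tmap /snd_ptr => Ep2.
    have {Ep2} Ep2 : p2 = Some (if r is Some j then (3 * j).+1 else 3 * size L).
      case: p2 Ep2 jx2 {Eu PAB PBC PAC uAB uBC ox2 lAB2 sBC2 lBC2 lAC2} => [j|] //= Ep2.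
      move=> [n [q' [jl' o2 e2]]].
      rewrite nth_rcons sBC in Ep2; move: Ep2; case: ltnP => [hj|hj]; last first.
        have -> : j = 3 * size L by lia.
        by rewrite eqxx ?szBC; case: (r) hr' => [j'|] hj' // -[]; lia.
      have {o2} := onu _ _ _ hj o2; case: n e2 => [[//|b']|c'] e2.
        move=> /onth_triB_inv[k [d [r' [y' [h' _ Ek]]]]].
        have [_ + _] := TBC _ _ _ _ h'; rewrite -addn1 -Ek => -> [E].
        have hk := onth_lt h'.
        by congr Some; move: E; case: (r) hr' => [j'|] /=; case: (d) => /=; lia.
      move=> /onth_triC_inv[k [d [r' [y' [h' _ Ek]]]]].
      have hk := onth_lt h'; have [k0 _ k2] := TBC _ _ _ _ h'; rewrite Ek.
      case: d h' k0 k2 {Ek} => h' /= k0 k2; rewrite ?addn0 ?addn2 ?k0 ?k2 // => -[E].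
        case: (r) hr hr' E => [i [r1 [x1 h1]] hr' E|_ _ E]; last lia.
        by have Ei : i = k by [lia]; subst k; rewrite h' in h1.
      by move: E; case: (r) hr' => [j'|] /=; lia.
    subst p2.
    (* To [sigma] the B-move just played by [tau] is an Opponent move, and its pointer becomes the
       first pointer of a block. *)
    have pAB2 : nth None (rcons RAB None) (if r is Some j then (3 * j).+1 else 3 * size L) = fst_ptr r.
      case: (r) hr hr' => [i [r1 [x1 h1]] hr'|_ _]; last by rewrite nth_rcons sAB ltnn eqxx.
      have [_ + _] := TAB _ _ _ _ h1; rewrite nth_rcons sAB => ->.
      have -> : (3 * i).+1 < 3 * size L by lia.
      by rewrite /= addn1.
    case: v2 Eu PAB PBC PAC uAB uBC => [|[x3 p3] v3] Eu PAB PBC PAC uAB uBC.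
      by move: uAB; rewrite /= /rst_step /= size_rcons szAB /= oddM.
    have ox3 : onth u (3 * size L).+2 = Some (x3, p3).
      by rewrite Eu onth_cat size_tri ltnNge (leq_trans (leqnSn _) (leqnSn _)) /= !subSn // ?subnn.
    have jx3 := ju _ _ _ ox3.
    have [_ sAB3] := PAB [:: _; _; _] v3 erefl; have [lBC3 _] := PBC [:: _; _; _] v3 erefl.
    have [lAC3 _] := PAC [:: _; _; _] v3 erefl.
    rewrite /= /rst_step /= pAB pAB2 in sAB3.
    rewrite /= /rst_step /= in lBC3 lAC3.
    case: x3 Eu PAB PBC PAC uAB uBC ox3 jx3 lBC3 sAB3 lAC3 => [[a|b3]|c3]
      Eu PAB PBC PAC uAB uBC ox3 jx3 lBC3 sAB3 lAC3; rewrite /= in lBC3 sAB3 lAC3.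
    * rewrite !size_rcons szAB /= negbK oddM rcons2 in sAB3.
      have [_ /=] := rs _ _ (sAB3 isT) erefl; rewrite size_tmap /snd_ptr => Ep3.
      have {Ep3} Ep3 : p3 = Some (if r is Some j then 3 * j else (3 * size L).+1).
        case: p3 Ep3 jx3 {Eu PAB PBC PAC uAB uBC ox3 lBC3 sAB3 lAC3} => [j|] //= Ep3.
        move=> [n [q' [jl' o3 e3]]].
        move: Ep3; case: (ltnP j (3 * size L)) => hj; last first.
          have [Ej|Ej] : j = 3 * size L \/ j = (3 * size L).+1 by lia.
            by move: o3 e3; rewrite Ej ox => -[<- _] [].
          rewrite Ej !nth_rcons !size_rcons sAB ltnn eqxx ?szAB.
          by case: (r) hr' => [j'|] hj' // -[]; lia.
        rewrite !nth_rcons size_rcons sAB (ltn_trans hj (ltnSn _)) hj.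
        have {o3} := onu _ _ _ hj o3; case: n e3 => [[a'|b']|c'] e3; last by case: e3.
          move=> /onth_triA_inv[k [d [r' [y' [h' _ Ek]]]]].
          have hk := onth_lt h'; have [k0 _ k2] := TAB _ _ _ _ h'; rewrite Ek.
          case: d h' k0 k2 {Ek} => h' /= k0 k2; rewrite ?addn0 ?addn2 ?k0 ?k2 // => -[E];
          by congr Some; move: E; case: (r) hr' => [j'|] /=; lia.
        move=> /onth_triB_inv[k [d [r' [y' [h' _ Ek]]]]].
        have hk := onth_lt h'; have [_ + _] := TAB _ _ _ _ h'; rewrite -addn1 -Ek => -> [E].
        case: d h' E => h' /= E; last by move: E; case: (r) hr' => [j'|] /=; lia.
        case: (r) hr hr' E => [i [r1 [x1 h1]] hr' E|_ _ E]; last lia.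
        by have Ei : i = k by [lia]; subst k; rewrite h' in h1.
      subst p3; exists true, r, (a, b, c), v3; split.
        by apply/wf_rcons; split=> //; case: (r) hr.
      by rewrite tri_rcons -catA Eu Ep; case: (r).
    * rewrite !size_rcons szAB /= negbK oddM rcons2 in sAB3.
      by have [] := rs _ _ (sAB3 isT) erefl.
    * have := turn_last lBC3; have := turn_last lAC3.
      rewrite !size_rcons szBC szAC turn_odd /turn /= negbK oddM /=.
      by case: (label c3).1.
  + rewrite !size_rcons szBC /= negbK oddM rcons2 in sBC2.
    by have [] := rt _ _ (sBC2 isT) erefl.
Qed.

Lemma parse_tri : exists2 L, wf L & u = tri L.
Proof.
suff: forall n L v, size v < n -> wf L -> u = tri L ++ v -> exists2 L, wf L & u = tri L.
  by move/(_ (size u).+1 [::] u); apply=> // i d r x; rewrite onth0n.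
elim=> // n IH L v sv w Eu; case: v sv Eu => [|x v] sv Eu.
  by exists L => //; rewrite Eu cats0.
have [//|d [r [y [v' [w' Eu']]]]] := step w Eu.
apply: (IH _ v' _ w' Eu'); have := congr1 size Eu'; rewrite {1}Eu !size_cat !size_tri size_rcons /=.
by move: sv => /=; lia.
Qed.

End Parse.

Definition same_kinds (A B : arena) (L : thread (move A * move B)) : Prop :=
  forall i d r x, onth L i = Some (d, r, x) -> (label x.1).2 = (label x.2).2.

(** * Legality of a zigzag play extended by a block *)

Section LegalZig.
Variables A B : arena.
Implicit Types L : thread (move A * move B).

Lemma kind_zfst (d : bool) (x : move A * move B) : (label x.1).2 = (label x.2).2 ->
  (label (a := arrow A B) (zfst d x)).2 = (label x.2).2 /\
  (label (a := arrow A B) (zsnd d x)).2 = (label x.2).2.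
Proof. by case: d => /= ->. Qed.

Lemma jcomp_zig L d r x : wf (rcons L (d, r, x)) ->
    jcomp (@fst _ _) (rcons L (d, r, x)) -> jcomp (@snd _ _) (rcons L (d, r, x)) ->
  (label (a := arrow A B) (zfst d x)).1 = Opponent /\
  (label (a := arrow A B) (zsnd d x)).1 = Proponent.
Proof.
move=> w j1 j2; have o := onth_last L (d, r, x).
have := jcomp_player w j1 o; have := jcomp_player w j2 o.
by rewrite /zfst /zsnd; case: (d) => /= -> ->.
Qed.

(** Bracketing is the difficulty. If the first move is an answer, it answers the last open question,
    the second move of the justifying block. Once this is closed, the first move of that block
    becomes the last open question, and it is the one that the second move answers. *)
Lemma legal_zig_snd L d r x : wf (rcons L (d, r, x)) ->
    jcomp (@fst _ _) (rcons L (d, r, x)) -> jcomp (@snd _ _) (rcons L (d, r, x)) ->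
    same_kinds (rcons L (d, r, x)) ->
    legal (A := arrow A B) (rcons (zig L) (zfst d x, fst_ptr r)) ->
    (forall j, r = Some j -> 2 * j \in
       view (A := arrow A B) Proponent (rcons (zig L) (zfst d x, fst_ptr r))) ->
  legal (A := arrow A B) (zig (rcons L (d, r, x))).
Proof.
move=> w j1 j2 K l hv; have j : justified (A := arrow A B) (zig (rcons L (d, r, x))).
  by apply/justified_zig.
have [t1 t2] := jcomp_zig w j1 j2.
rewrite zig_rcons2 in j *; apply/legal_rcons; split=> //.
- by have [_] := (justified_rcons _ _ _).1 j.
- by rewrite t2 size_rcons size_zig /turn /= oddM.
- have [l0 jf _ bf _] := (legal_rcons _ _ _).1 l.
  have [k1 k2] := kind_zfst d (K _ _ _ _ (onth_last _ _)).
  have KL i d' r' x' : onth L i = Some (d', r', x') -> (label x'.1).2 = (label x'.2).2.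
    by move=> h; apply: (K i d' r'); rewrite onth_rcons (onth_lt h).
  have [w0 hr] := (wf_rcons _ _ _ _).1 w.
  rewrite k2 => an; rewrite k1 in bf; have [j'] := bf an.
  case: r w j1 j2 K l hv j bf jf hr => //= rho w j1 j2 K l hv j bf jf hr [<-] [un mx].
  exists (2 * rho) => //; have [r' [x' h]] := hr.
  have [z1 z2] := onth_zig h; have [g1 g2] := kind_zfst (~~ d) (KL _ _ _ _ h).
  have hrho := onth_lt h.
  have onz i y : i < 2 * size L -> onth (rcons (zig L) (zfst d x, Some (2 * rho).+1)) i = Some y ->
      onth (zig L) i = Some y.
    by move=> hi; rewrite onth_rcons size_zig hi.
  split; first split.
  + exists (zfst (~~ d) x'), (fst_ptr r'); rewrite onth_rcons size_zig z1.
    have -> : 2 * rho < 2 * size L by lia.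
    split=> //; rewrite g1 -g2; have [[m [p [om qm]]] _] := un.
    by move: om qm; rewrite z2 => -[<- _].
  + case=> k [m [o am]]; case: (ltnP k (2 * size L)) => hk; last first.
      have : k = 2 * size L by have := onth_lt o; rewrite size_rcons size_zig; lia.
      by move=> E; move: o; rewrite E -size_zig onth_last => -[_]; lia.
    (* An earlier answer to 2 rho would be the second move of a block whose first move answers 2 rho
       + 1, which is still open, or of a root, which consists of questions. *)
    have [i [d1 [r1 [x1 [h1]]]]] := onth_zig_inv (onz _ _ hk o).
    have [_ jj] := (justified_rcons _ _ _).1 j.
    case=> -[Ek [Em]]; first by case: (r1) => //= ? []; lia.
    rewrite /snd_ptr => -[]; have [f1 f2] := kind_zfst d1 (KL _ _ _ _ h1).
    rewrite Em f2 -f1 in am.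
    case: r1 h1 => [i' h1 E|h1 E].
      have Ei : i' = rho by lia.
      case: un => _; apply; exists (2 * i), (zfst d1 x1); split=> //.
      by have [-> _] := onth_zig h1; rewrite Ei.
    have /initial_label E' : enables B None x1.2.
      have := (jcompP _ _).1 j2 i d1 None x1.
      by rewrite onth_rcons (onth_lt h1) => /(_ h1).
    by rewrite f1 E' in am.
  + move=> k [[m [p [o qm]]] nk].
    have hk : k < 2 * size L.
      have := onth_lt o; rewrite size_rcons size_zig ltnS leq_eqVlt => /predU1P[E|//].
      by move: o qm; rewrite E -size_zig onth_last => -[<- _]; rewrite k1 an.
    case: (leqP k (2 * rho)) => // hk'.
    have [Ek|hk2] : k = (2 * rho).+1 \/ (2 * rho).+1 < k by lia.
      case: nk; exists (2 * size L), (zfst d x); rewrite Ek -size_zig onth_last.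
      by rewrite k1 an.
    suff /mx : unanswered (A := arrow A B) (zig L) k by lia.
    split; first by exists m, p; split=> //; apply: onz.
    case=> k' [m' [o' am']]; apply: nk; exists k', m'; split=> //.
    by rewrite onth_rcons (onth_lt o').
- move=> j' [<-]; rewrite t2; case: (r) hv => [j2'|] // hv; first exact: hv.
  by rewrite /view size_rcons size_zig /= onth_rcons size_zig ltnn eqxx t1 /=;
    case: (r) hv => [k|] hv; rewrite ?mem_cat ?inE ?eqxx ?orbT.
Qed.

(** An Opponent move points to a Proponent move, and these are the second moves of the blocks. *)
Lemma zig_fst_ptr L m p : wf L ->
    legal (A := arrow A B) (rcons (zig L) (m, p)) ->
  exists2 r, p = fst_ptr r & if r is Some j
    then exists r' x', onth L j = Some (~~ isr m, r', x') else isr m.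
Proof.
move=> w /legal_rcons[l j t _ _]; rewrite size_zig /turn oddM /= in t.
case: p j => [k [n [q [o e]]]|]; last first.
  by case: m {t} => // b _; exists None.
have [i [d [r [x [h]]]]] := onth_zig_inv o.
have nb : isr m = isr n.
  case: m n t e o => [a|b] [a'|b'] //= t.
  by case=> _ /initial_label E; rewrite E in t.
case=> -[-> [En _]].
  have := enables_alternates e; rewrite t; have [z _] := onth_zig h.
  by have := legal_turn l z; rewrite /turn oddM -En /= => ->.
by exists (Some i) => //; exists r, x; rewrite nb En; case: (d) h.
Qed.

End LegalZig.

(** * Paths of a thread *)

(** The branch from a root down to a block, or the empty branch for [None]. A relation avoids
    recursion through pointers; it is functional by [tp_fun] and total on well-formed threads by
    [tp_ex]. *)
Inductive tp (X : Type) (L : thread X) : option nat -> seq X -> Prop :=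
| tp_nil : tp L None [::]
| tp_rcons i d r x p : onth L i = Some (d, r, x) -> tp L r p ->
    tp L (Some i) (rcons p x).

Section Tp.
Variable X : Type.
Implicit Types L : thread X.

Lemma tp_None L p : tp L None p -> p = [::].
Proof. by move=> h; inversion h. Qed.

Lemma tp_Some L i p : tp L (Some i) p -> exists d r x q,
  [/\ onth L i = Some (d, r, x), tp L r q & p = rcons q x].
Proof. by move=> h; inversion h; subst; exists d, r, x, p0. Qed.

Lemma tp_fun L r p q : tp L r p -> tp L r q -> p = q.
Proof.
move=> h; elim: h q => [q /tp_None //|i d r' x p' o _ IH q /tp_Some].
by case=> [d1 [r1 [x1 [q1 [o1 /[swap] ->]]]]]; rewrite o1 in o; case: o => _ -> -> /IH ->.
Qed.

Lemma tp_ex L r : wf L -> (if r is Some i then i < size L else true) ->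
  exists p, tp L r p.
Proof.
move=> w; case: r => [i|_]; last by exists [::]; constructor.
elim/ltn_ind: i => i IH hi; have [[[d r] x] o] := onth_ex hi.
have := w _ _ _ _ o; case: r o => [j|] o.
  move=> [ji _]; have [|p hp] := IH _ ji; first exact: ltn_trans ji hi.
  by exists (rcons p x); apply: tp_rcons hp; exact: o.
by move=> _; exists (rcons [::] x); apply: tp_rcons o _; constructor.
Qed.

Lemma tp_cat L L' r p : tp L r p -> tp (L ++ L') r p.
Proof.
elim=> [|i d r' x q o _ IH]; first by constructor.
by apply: tp_rcons IH; apply: onth_catl o.
Qed.

Lemma tp_dir L i d r x p : wf L -> onth L i = Some (d, r, x) ->
  tp L (Some i) p -> d = odd (size p).
Proof.
move=> w; elim/ltn_ind: i d r x p => i IH d r x p o /tp_Some.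
case=> [d' [r' [x' [q [o' t ->]]]]]; rewrite o in o'; case: o' => _ E _; subst r'.
have := w _ _ _ _ o; rewrite size_rcons /=; case: r o t => [j|] o t.
  by move=> [ji [r1 [x1 o1]]]; rewrite -(IH _ ji _ _ _ _ o1 t) negbK.
by rewrite (tp_None t) => ->.
Qed.

End Tp.

Lemma tp_tmap (X Y : Type) (g : X -> Y) (L : thread X) r p :
  tp L r p -> tp (tmap g L) r (map g p).
Proof.
elim=> [|i d r' x q o _ IH]; first by constructor.
by rewrite map_rcons; apply: tp_rcons IH; apply: onth_tmap o.
Qed.

(** * The Proponent view of a zigzag play *)

Section ZigView.
Variables A B : arena.
Implicit Types L : thread (move A * move B).

(** The moves of a branch in the order of the Proponent view; by [zmoves_inj] they determine the
    branch. *)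
Fixpoint zmoves (d : bool) (p : seq (move A * move B)) : seq (move A + move B) :=
  if p is x :: p' then zfst d x :: zsnd d x :: zmoves (~~ d) p' else [::].

Lemma zmoves_rcons d p x : zmoves d (rcons p x) =
  zmoves d p ++ [:: zfst (d (+) odd (size p)) x; zsnd (d (+) odd (size p)) x].
Proof. by elim: p d => [|y p IH] d /=; rewrite ?addbF // IH addNb addbN. Qed.

Lemma zmoves_inj d p q : zmoves d p = zmoves d q -> p = q.
Proof.
elim: p d q => [|[a b] p IH] d [|[a' b'] q] //=.
by case: d => -[-> ->] /IH ->.
Qed.

Let mv (S : jseq (move A + move B)) j := omap fst (onth S j).

(** From the second move of block [i] the view steps to its first move, whose pointer jumps to the
    second move of the justifying block, and so on up the branch. The bounds on [V] and its size
    serve to compute ranks in the view, which innocence compares. *)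
Lemma view_zig_block L (S w : jseq (move A + move B)) i p k : wf L ->
    legal (A := arrow A B) (zig L) -> S = zig L ++ w ->
    i < size L -> tp L (Some i) p -> (2 * i).+2 <= k ->
  exists V, [/\ view_upto (A := arrow A B) Proponent S k (2 * i).+2 = V ++ [:: 2 * i; (2 * i).+1],
    all (fun j => j < 2 * i) V, (size V).+2 = 2 * size p
    & pmap (mv S) (V ++ [:: 2 * i; (2 * i).+1]) = zmoves true p].
Proof.
move=> wL l ES; elim/ltn_ind: i p k => i IH p [|[|k]] // hi t hk.
have [d [r [x [q [o tq Ep]]]]] := tp_Some t.
have [z1 z2] := onth_zig o.
have s1 : onth S (2 * i) = Some (zfst d x, fst_ptr r) by rewrite ES; apply: onth_catl.
have s2 : onth S (2 * i).+1 = Some (zsnd d x, snd_ptr (2 * i) r).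
  by rewrite ES; apply: onth_catl.
have l1 := legal_turn l z1; have l2 := legal_turn l z2.
rewrite /turn oddM /= in l1; rewrite /turn /= oddM /= in l2.
have dq : d = true (+) odd (size q).
  by rewrite (tp_dir wL o t) Ep size_rcons.
have E : view_upto (A := arrow A B) Proponent S k.+2 (2 * i).+2 =
  rcons (view_upto (A := arrow A B) Proponent S k.+1 (2 * i).+1) (2 * i).+1.
  by rewrite /= s2 [X in same_player X]l2.
rewrite E /= s1 [X in same_player X]l1 /=.
have wo := wL _ _ _ _ o; case: r o tq s1 s2 z1 z2 wo => [j|] o tq s1 s2 z1 z2 wo /=.
  have [ji _] := wo.
  have hj : j < size L by lia.
  have [|V [EV aV sV mV]] := IH j ji q k.+1 hj tq; first lia.
  exists (V ++ [:: 2 * j; (2 * j).+1]); split.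
  - rewrite -EV /= ES.
    have [y oy] : exists y, onth L j = Some y by apply: onth_ex; lia.
    move: oy; case: y => -[d1 r1] x1 oy; have [y1 y2] := onth_zig oy.
    rewrite (onth_catl w y2); have := legal_turn l y2; rewrite /turn /= oddM /= => ty.
    by rewrite [X in same_player X]ty /= -!cats1 -!catA.
  - rewrite all_cat /=; apply/andP; split; last by apply/and3P; split=> //; lia.
    by apply: sub_all aV => j' /=; lia.
  - by rewrite size_cat /= Ep size_rcons; lia.
  - by rewrite pmap_cat mV Ep zmoves_rcons -dq /= /mv s1 s2.
exists [::]; split=> //.
  by rewrite Ep size_rcons (tp_None tq).
by rewrite Ep (tp_None tq) /= /mv s1 s2 /=; rewrite (tp_None tq) in dq; rewrite dq.
Qed.

Lemma view_zig_next L m r p : wf L ->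
    legal (A := arrow A B) (rcons (zig L) (m, fst_ptr r)) -> tp L r p ->
  exists V, [/\ view (A := arrow A B) Proponent (rcons (zig L) (m, fst_ptr r)) =
      rcons V (2 * size L),
    size V = 2 * size p,
    [seq x.1 | x <- view_seq (A := arrow A B) Proponent (rcons (zig L) (m, fst_ptr r))] =
      rcons (zmoves true p) m
    & forall j, r = Some j -> exists2 V', V = V' ++ [:: 2 * j; (2 * j).+1] &
        all (fun i => i < 2 * j) V'].
Proof.
move=> w l t; have [l0 jm tm _ _] := (legal_rcons _ _ _).1 l.
rewrite size_zig /turn oddM /= in tm.
set S := rcons _ _ in l *.
have oS : onth S (2 * size L) = Some (m, fst_ptr r) by rewrite /S -size_zig onth_last.
have vs (h : _ -> option nat) v :
    [seq x.1 | x <- pmap (fun i => omap (fun x => (x.1, h x)) (onth S i)) v] = pmap (mv S) v.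
  elim: v => //= i v <-; rewrite /mv.
  by case: (onth S i).
rewrite /view_seq /= vs /view; have -> : size S = (2 * size L).+1 by rewrite size_rcons size_zig.
rewrite /= oS [X in same_player X]tm /=.
case Er: r => [j|] /=; rewrite Er in t; last first.
  exists [::]; split=> //; first by rewrite (tp_None t).
  by rewrite /mv oS (tp_None t).
have [d [r' [x [q [o _ _]]]]] := tp_Some t; have hj := onth_lt o.
have ES : S = zig L ++ [:: (m, fst_ptr r)] by rewrite /S -cats1.
have [|V [EV aV sV mV]] := view_zig_block (k := (2 * size L).+1) w l0 ES hj t; first lia.
have {}EV : view_upto (A := arrow A B) Proponent S (2 * size L) (2 * j).+1 = V ++ [:: 2 * j].
  have [_ z2] := onth_zig o; have := legal_turn l0 z2; rewrite /turn /= oddM /= => t2.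
  have := EV; rewrite /= {1}ES (onth_catl _ z2) [X in same_player X]t2 /=.
  by rewrite -cats1 -[V ++ [:: _; _]]/(V ++ ([:: _] ++ [:: _])) catA !cats1 => /rcons_inj[].
rewrite EV; exists (V ++ [:: 2 * j; (2 * j).+1]); split.
- by rewrite -cats1 -!catA.
- by rewrite size_cat /= addn2.
- rewrite -catA /= -[[:: _; _; _]]/([:: _; _] ++ [:: _]) catA pmap_cat mV /= /mv oS /=.
  by rewrite cats1.
- by move=> _ [<-]; exists V.
Qed.

End ZigView.

(** * From path isomorphisms to isomorphic arenas *)

Lemma enabled_chain_rcons (A : arena) o (p : seq (move A)) a :
  enabled_chain o (rcons p a) <->
  enabled_chain o p /\ enables A (last o (map Some p)) a.
Proof.
elim: p o => [|b p IH] o /=; first by split=> [[]|[]].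
by rewrite IH; tauto.
Qed.

(** A relational form of path isomorphisms, closed under exchanging the arenas, so that every lemma
    about the strategy of [R] also covers its inverse. *)
Record path_rel (A B : arena) (R : seq (move A) -> seq (move B) -> Prop) : Prop :=
  PathRel {
    rel_nil : R [::] [::];
    rel_paths : forall p q, R p q -> paths A p /\ paths B q;
    rel_kind : forall p q a b, R (rcons p a) (rcons q b) -> (label a).2 = (label b).2;
    rel_forth : forall p q a, R p q -> paths A (rcons p a) ->
      exists b, R (rcons p a) (rcons q b);
    rel_back : forall p q b, R p q -> paths B (rcons q b) ->
      exists a, R (rcons p a) (rcons q b);
    rel_fun : forall p q q', R p q -> R p q' -> q = q';
    rel_inj : forall p p' q, R p q -> R p' q -> p = p'
  }.

Definition rel_flip (X Y : Type) (R : X -> Y -> Prop) y x := R x y.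

Lemma path_rel_flip (A B : arena) (R : seq (move A) -> seq (move B) -> Prop) :
  path_rel R -> path_rel (rel_flip R).
Proof.
case=> h1 h2 h3 h4 h5 h6 h7; split; rewrite /rel_flip //.
- by move=> p q /h2[].
- by move=> p q a b /h3.
- by move=> p q b; apply: h5.
- by move=> p q b; apply: h4.
- by move=> p q q' x y; apply: h7 x y.
- by move=> p p' q x y; apply: h6 x y.
Qed.

Lemma path_isomorphism_rel (A B : arena) (phi : seq (move A) -> seq (move B)) :
  path_isomorphism phi -> path_rel (fun p q => paths A p /\ phi p = q).
Proof.
move=> [[pf pi ps] pip pk].
have ipr (T : Type) (p : seq T) a : ip (rcons p a) = p.
  by rewrite /ip size_rcons -cats1 take_size_cat.
have rn (T : Type) (p : seq T) a : rcons p a <> [::] by case: p.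
have pinj p p' : paths A p -> paths A p' -> phi p = phi p' -> p = p'.
  by move=> hp hp'; apply: pi; rewrite inE.
have prcons (C : arena) (p : seq (move C)) a : paths C (rcons p a) -> paths C p.
  by case/enabled_chain_rcons.
(* [ip] fixes the empty path, so a nonempty preimage of it would have the same image as its own
   immediate prefix. *)
have phi0 : phi [::] = [::].
  have [p hp Ep] := ps [::] I; case/lastP: p hp Ep => [//|p a hp Ep].
  have E : phi p = phi (rcons p a) by rewrite Ep -(ipr _ p a) pip // Ep.
  by have := congr1 size (pinj _ _ (prcons _ _ _ hp) hp E); rewrite size_rcons; lia.
split.
- by split.
- by move=> p q [hp <-]; split=> //; apply: pf.
- by move=> p q a b [hp E]; rewrite (pk _ _ _ _ hp E).
- move=> p q a [hp <-] hpa.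
  have E' : phi p = ip (phi (rcons p a)) by rewrite -pip // ipr.
  have [E0|[q' [b E0]]] : phi (rcons p a) = [::] \/ exists q' b, phi (rcons p a) = rcons q' b.
    by case/lastP: (phi (rcons p a)) => [|q' b]; [left|right; exists q', b].
    by case: (rn _ p a); apply: (pinj _ [::] hpa I); rewrite E0 phi0.
  by rewrite E0 ipr in E'; exists b; rewrite E' E0.
- move=> p q b [hp <-] hqb; have [p' hp' Ep'] := ps _ hqb.
  case/lastP: p' hp' Ep' => [_|p' a hp' Ep']; first by rewrite phi0 => /esym E; case: (rn _ _ _ E).
  have E : phi p' = phi p by rewrite -(ipr _ p' a) pip // Ep' ipr.
  by exists a; have E1 := pinj _ _ (prcons _ _ _ hp') hp E; subst p'.
- by move=> p q q' [_ <-] [_ <-].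
- by move=> p p' q [hp <-] [hp' /esym]; apply: pinj.
Qed.

Section Related.
Variables (A B : arena) (R : seq (move A) -> seq (move B) -> Prop).
Hypothesis HR : path_rel R.
Implicit Types L : thread (move A * move B).

Definition related L : Prop := forall r p, tp L r p -> R (unzip1 p) (unzip2 p).

Lemma related_jcomp L : wf L -> related L -> jcomp (@fst _ _) L /\ jcomp (@snd _ _) L.
Proof.
move=> w h; suff E i d r x : onth L i = Some (d, r, x) ->
    match r with
    | None => enables A None x.1 /\ enables B None x.2
    | Some j => exists d' r' x', [/\ j < i, onth L j = Some (d', r', x') &
       enables A (Some x'.1) x.1 /\ enables B (Some x'.2) x.2]
    end.
  split; apply/jcompP => i d r x /E; case: r => [j|[]] //.
    by move=> [d' [r' [x' [? ? []]]]]; exists d', r', x'.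
  by move=> [d' [r' [x' [? ? []]]]]; exists d', r', x'.
move=> o; have [|q tq] := tp_ex (r := r) w.
  by have := w _ _ _ _ o; case: (r) => // j [ji _]; apply: ltn_trans ji (onth_lt o).
have := h _ _ (tp_rcons o tq); rewrite /unzip1 /unzip2 !map_rcons => /(rel_paths HR)[].
move=> /enabled_chain_rcons[_ e1] /enabled_chain_rcons[_ e2].
case: r o tq => [j|] o tq; last by rewrite (tp_None tq) in e1 e2.
have [ji _] := w _ _ _ _ o; have [d' [r' [x' [q' [o' _ Eq]]]]] := tp_Some tq.
exists d', r', x'; split=> //; move: e1 e2.
by rewrite Eq !map_rcons !last_rcons.
Qed.

Lemma related_kinds L : wf L -> related L -> same_kinds L.
Proof.
move=> w h i d r x o; have [|q tq] := tp_ex (r := r) w.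
  by have := w _ _ _ _ o; case: (r) => // j [ji _]; apply: ltn_trans ji (onth_lt o).
have := h _ _ (tp_rcons o tq); rewrite /unzip1 /unzip2 !map_rcons.
exact: rel_kind.
Qed.

Lemma related_cat L L' : related (L ++ L') -> related L.
Proof. by move=> h r p /(tp_cat L') /h. Qed.

Lemma related_rcons L d r x p : wf (rcons L (d, r, x)) -> related L -> tp L r p ->
  R (unzip1 (rcons p x)) (unzip2 (rcons p x)) -> related (rcons L (d, r, x)).
Proof.
move=> w h t hR; have [w0 _] := (wf_rcons _ _ _ _).1 w.
case=> [i|] q tq; last by rewrite (tp_None tq); apply: rel_nil HR.
have [d' [r' [x' [q' [o t' Eq]]]]] := tp_Some tq.
move: o; rewrite onth_rcons; case: ltnP => [hi o|_].
  have [q1 t1] := tp_ex (r := Some i) w0 hi.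
  have := tp_cat [:: (d, r, x)] t1; rewrite cats1 => /(tp_fun tq) ->; exact: h t1.
case: eqP => // _ [_ E1 E2]; subst r' x'.
by have := tp_cat [:: (d, r, x)] t; rewrite cats1 => /(tp_fun t') E; rewrite Eq E.
Qed.

Definition rel_strategy : set (jseq (move (arrow A B))) :=
  [set s | exists L, [/\ wf L, related L, legal (A := arrow A B) (zig L) & s = zig L]].

Lemma rel_strategyP : strategy (A := arrow A B) rel_strategy.
Proof.
split.
- exists [::], [::]; split=> //.
  + by move=> i d r x; rewrite onth0n.
  + move=> [i|] p t; last by rewrite (tp_None t); apply: rel_nil HR.
    by have [d [r [x [q []]]]] := tp_Some t; rewrite onth0n.
  + exact: legal_nil.
- by move=> s [L [w h l ->]]; split=> //; apply: odd_size_zig.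
- move=> s t [L [w h l E]] es.
  have Es : s = zig (take (size s)./2 L).
    by rewrite -take_zig -E mul2n even_halfK // take_size_cat.
  exists (take (size s)./2 L); split=> //; last 1 first.
  + by rewrite -Es; rewrite -E in l; apply: legal_prefix l.
  + exact: wf_take.
  + by move: h; rewrite -{1}(cat_take_drop (size s)./2 L); apply: related_cat.
Qed.

Lemma rel_strategy_next L x y : rel_strategy (zig L ++ [:: x; y]) ->
  exists e, [/\ wf (rcons L e), related (rcons L e),
    legal (A := arrow A B) (zig (rcons L e)) & [:: x; y] = zblock (2 * size L) e].
Proof.
move=> [L' [w h l E]]; have [e [L'' [E' Exy]]] := zig_next E; exists e.
rewrite E' in w h l; split=> //; [exact: wf_cat w|exact: related_cat h|].
by move: l; have [w' ->] := zig_cat (rcons L e) L''; apply: legal_prefix.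
Qed.

Lemma rel_respond L d r : respond rel_strategy L d r.
Proof.
move=> x y /rel_strategy_next[[[d' r'] z] [_ _ _]]; rewrite /zblock /= => -[-> Er ->] /=.
have <- : r = r'.
  by case: r r' Er => [i|] [j|] //= [E]; congr Some; lia.
by case: d' => <-.
Qed.

(** Equal views give equal branches by [zmoves_inj], and a new block affects only the branch it
    extends, so [related] carries over; legality is rebuilt by [legal_zig_snd]. *)
Lemma rel_innocent : innocent (A := arrow A B) rel_strategy.
Proof.
split; first exact: rel_strategyP.
move=> s a b t [m' p'] sab [L2 [w2 h2 l2 Et]] l2' Ev; subst t => v w.
have [L0 Es] : exists L0, s = zig L0.
  suff [L [_ _ _ ->]] : rel_strategy s by exists L.
  apply: (strategy_prefix rel_strategyP sab).
  by have [_ /(_ _ sab)[_]] := rel_strategyP; rewrite size_cat oddD /= addbF.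
subst s; have [[[d r] x] [w1 h1 l1 Eab]] := rel_strategy_next sab.
have [w0 hr] := (wf_rcons _ _ _ _).1 w1.
have h0 : related L0 by move: h1; rewrite -cats1; apply: related_cat.
case: Eab => Ea Eb; rewrite /= in Ea Eb.
have l1' : legal (A := arrow A B) (rcons (zig L0) (zfst d x, fst_ptr r)).
  by move: l1; rewrite zig_rcons2; case/legal_rcons.
have [r' Ep' hr'] := zig_fst_ptr w2 l2'.
have [|p1 t1] := tp_ex (r := r) w0; first by case: (r) hr => // j [? [? h]]; apply: onth_lt h.
have [|p2 t2] := tp_ex (r := r') w2; first by case: (r') hr' => // j [? [? h]]; apply: onth_lt h.
subst a p'.
have [V1 [EV1 sV1 mV1 cV1]] := view_zig_next w0 l1' t1.
have [V2 [EV2 sV2 mV2 cV2]] := view_zig_next w2 l2' t2.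
have := mV1; rewrite Ev mV2 => /rcons_inj[/zmoves_inj Ep Em]; subst p2 m'.
have dE : isr (zfst d x) = d by case: (d).
rewrite dE in hr'.
suff -> : (b.1, omap (fun j => nth 0 w (index j v)) b.2) =
    (zsnd d x, snd_ptr (2 * size L2) r').
  have w2' : wf (rcons L2 (d, r', x)) by apply/wf_rcons; split=> //; case: (r') hr'.
  have hR : R (unzip1 (rcons p1 x)) (unzip2 (rcons p1 x)).
    apply: (h1 (Some (size L0))); apply: tp_rcons (onth_last _ _) _.
    by rewrite -cats1; apply: tp_cat.
  have h2' := related_rcons w2' h2 t2 hR.
  have [j1 j2] := related_jcomp w2' h2'.
  exists (rcons L2 (d, r', x)); split=> //; last by rewrite zig_rcons.
  apply: legal_zig_snd => //; first exact: related_kinds.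
  move=> j Ej; have [V' E _] := cV2 _ Ej.
  by rewrite EV2 mem_rcons E !(inE, mem_cat) eqxx ?orbT.
rewrite Eb /=; congr (_, Some _).
rewrite /v /w EV1 EV2.
(* The two views have equal size, and this size fixes the rank of the justifier of the second move:
   third from the end, or last at a root. *)
case: (r) (r') t1 t2 cV1 cV2 => [j|] [j'|] t1 t2 cV1 cV2.
- have [V1' E1 a1] := cV1 _ erefl; have [V2' E2 a2] := cV2 _ erefl.
  have n1 : 2 * j \notin V1' by apply/negP => /(allP a1); rewrite ltnn.
  have sV : size V1' = size V2'.
    by move: sV1 sV2; rewrite E1 E2 !size_cat /=; lia.
  rewrite -!cats1 E1 E2 -!catA index_cat (negPf n1) /= eqxx addn0 sV.
  by rewrite nth_cat ltnn subnn.
- have [d1 [r1 [x1 [q [_ _ E]]]]] := tp_Some t1.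
  by rewrite (tp_None t2) in E; case: (q) E.
- have [d1 [r1 [x1 [q [_ _ E]]]]] := tp_Some t2.
  by rewrite (tp_None t1) in E; case: (q) E.
- have E1 : V1 = [::] by apply: size0nil; rewrite sV1 (tp_None t1).
  have E2 : V2 = [::] by apply: size0nil; rewrite sV2 (tp_None t1).
  by rewrite E1 E2 /= eqxx.
Qed.

End Related.

Section RelCompose.
Variables (A B : arena) (R : seq (move A) -> seq (move B) -> Prop).
Hypothesis HR : path_rel R.

Let swap (x : move A * move B) := (x.2, x.1).

Lemma related_swap (L : thread (move A * move B)) :
  related R L -> related (rel_flip R) (tmap swap L).
Proof.
move=> h r p t.
have [q tq ->] : exists2 q, tp L r q & p = map swap q.
  elim: t => [|i d r' x' p' o' _ [q tq ->]]; first by exists [::] => //; constructor.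
  have [x o ->] := onth_tmap_inv o'.
  by exists (rcons q x); rewrite ?map_rcons //; apply: tp_rcons tq; exact: o.
by rewrite /rel_flip /unzip1 /unzip2 -!map_comp; apply: h tq.
Qed.

Let dupl (x : move A * move B) := (x, x.1).

(** The middle move of each triple is supplied by [rel_forth], block by block. The plays of the two
    strategies have the skeleton of the given copycat play, which makes them legal. *)
Lemma copycat_sub_compose :
  (copycat A `<=` compose (rel_strategy R) (rel_strategy (rel_flip R)))%classic.
Proof.
move=> s cs; have [L w Es] := copycat_zig cs; have [l _ _] := cs; subst s.
have HF := path_rel_flip HR.
have [L' [w' h' EL]] : exists L' : thread (move A * move B),
    [/\ wf L', related R L' & L = tmap fst L'].
  have j : jcomp id L.
    have [j _ _ _] := l; have [j1 _] := (justified_zig (wf_tmap w)).1 j.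
    by move/jcomp_tmap: j1.
  elim/last_ind: L w j {l cs} => [|L [[d r] a] IH] w j.
    exists [::]; split=> //; first by move=> i d r x; rewrite onth0n.
    move=> [i|] p t; last by rewrite (tp_None t); apply: rel_nil HR.
    by have [d [r [x [q []]]]] := tp_Some t; rewrite onth0n.
  have [w0 hr] := (wf_rcons _ _ _ _).1 w; have [j0 ja] := (jcomp_rcons _ _ _ _ _).1 j.
  have [L' [w' h' EL]] := IH w0 j0; subst L.
  have [|p t] := tp_ex (r := r) w'.
    by case: (r) hr => // k [? [? h]]; have := onth_lt h; rewrite size_tmap.
  have hp := h' _ _ t.
  have hpa : paths A (rcons (unzip1 p) a).
    apply/enabled_chain_rcons; split; first by have [] := rel_paths HR hp.
    case: r ja t {w j hr} => [k|] ja t; last by rewrite (tp_None t).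
    have [d1 [r1 [x1 [o1 e1]]]] := ja.
    have [y oy Ey] := onth_tmap_inv o1; subst x1.
    have [d2 [r2 [x2 [q [o2 _ ->]]]]] := tp_Some t.
    by rewrite /unzip1 !map_rcons last_rcons; rewrite oy in o2; case: o2 => _ _ <-.
  have [b hb] := rel_forth HR hp hpa.
  have w1 : wf (rcons L' (d, r, (a, b))).
    apply/wf_rcons; split=> //; case: r hr {w j ja t} => // k [r' [x' h]].
    by have [y oy _] := onth_tmap_inv h; exists r', y.
  exists (rcons L' (d, r, (a, b))); split=> //; last by rewrite tmap_rcons.
  by apply: related_rcons t _ => //; rewrite /unzip1 /unzip2 !map_rcons.
have [ja jb] := related_jcomp HR w' h'; have K := related_kinds HR w' h'.
pose T := tmap dupl L'.
have wT : wf T by apply: wf_tmap.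
have EAC : tmap (fun a => (a, a)) L = tmap (@pAC A B A) T by rewrite EL !tmap_comp.
have EAB : tmap (@pAB A B A) T = L'.
  by rewrite tmap_comp /tmap -[RHS]map_id; apply: eq_map => -[[d r] [x y]].
have EBC : tmap (@pBC A B A) T = tmap swap L' by rewrite tmap_comp.
rewrite EAC in l *; apply: compose_tri => //.
- exact: rel_strategyP.
- exact: rel_strategyP.
- by apply/jcomp_tmap.
- by apply/jcomp_tmap.
- by apply/jcomp_tmap.
- rewrite EAB; exists L'; split=> //.
  apply: legal_skeleton l _; last by apply/justified_zig.
  have Eid : tmap (fun x => (x.1, x.2)) L' = L'.
    by rewrite /tmap -[RHS]map_id; apply: eq_map => -[[d r] [x y]].
  rewrite tmap_comp -[in RHS]Eid.
  apply: (@skeleton_zig A A A B _ fst fst fst snd L' w' ja ja ja jb) => i d r x o.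
  by split=> //; exact: K o.
- rewrite EBC; exists (tmap swap L'); split=> //; [exact: wf_tmap|exact: related_swap|].
  apply: legal_skeleton l _; last first.
    by apply/justified_zig; [exact: wf_tmap|split; apply/jcomp_tmap].
  rewrite tmap_comp.
  apply: (@skeleton_zig A A B A _ fst fst snd fst L' w' ja ja jb ja) => i d r x o; split=> //.
  exact: K o.
Qed.

(** Along each branch the two outer paths are related by [R] to the same middle path, so [rel_inj]
    identifies them. *)
Lemma compose_sub_copycat :
  (compose (rel_strategy R) (rel_strategy (rel_flip R)) `<=` copycat A)%classic.
Proof.
move=> s [u [iu su tu ->]]; have HF := path_rel_flip HR.
have [|L w Eu] := parse_tri (rel_strategyP HR) (rel_strategyP HF) iu su tu.
  by move=> L d r m v _ _ _ _ _; split; apply: rel_respond.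
have ju : justified (A := arrow (arrow A B) A) (tri L) by case: iu; rewrite Eu.
have [EAB EBC EAC] := restrict_tri w ju.
have l : legal (A := arrow A A) (zig (tmap (@pAC A B A) L)).
  by have [_ _ _] := iu; rewrite Eu EAC.
rewrite Eu EAC; move: su tu; rewrite Eu EAB EBC.
move=> [L1 [w1 h1 l1 /zig_inj E1]] [L2 [w2 h2 l2 /zig_inj E2]]; subst L1 L2.
suff E : tmap (@pAC A B A) L = tmap (fun a => (a, a)) (tmap (fun x => x.1.1) L).
  by rewrite E in l *; apply: zig_copycat => //; apply: wf_tmap.
rewrite tmap_comp; apply: eq_from_onth => i; rewrite !onth_map.
case o: (onth L i) => [[[d r] x]|] //=; rewrite /pAC /=; congr Some; congr (_, (_, _)).
have [p t] := tp_ex (r := Some i) w (onth_lt o).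
have [d' [r' [x' [q [o' _ Ep]]]]] := tp_Some t.
rewrite o in o'; case: o' => _ _ ?; subst x' p.
have R1 := h1 _ _ (tp_tmap (@pAB A B A) t); have R2 := h2 _ _ (tp_tmap (@pBC A B A) t).
move: R1 R2; rewrite /rel_flip /unzip1 /unzip2 -!map_comp !map_rcons /= => R1 R2.
by have /rcons_inj[_ ->] := rel_inj HR R1 R2.
Qed.

Lemma rel_compose :
  compose (rel_strategy R) (rel_strategy (rel_flip R)) = copycat A.
Proof.
by apply/seteqP; split; [exact: compose_sub_copycat|exact: copycat_sub_compose].
Qed.

End RelCompose.

Lemma path_isomorphism_Inn (A B : arena) (phi : seq (move A) -> seq (move B)) :
  path_isomorphism phi -> Inn_isomorphic A B.
Proof.
move=> /path_isomorphism_rel HR; have HF := path_rel_flip HR.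
exists (rel_strategy (fun p q => paths A p /\ phi p = q)),
  (rel_strategy (rel_flip (fun p q => paths A p /\ phi p = q))).
split; [exact: rel_innocent|exact: rel_innocent|exact: rel_compose|exact: rel_compose HF].
Qed.

(** * Linear threads *)

Definition prev (n : nat) : option nat := if n is j.+1 then Some j else None.

(** The thread with a single branch, in which each block is justified by the previous one: the play
    along a pair of paths. *)
Definition lin (X : Type) (l : seq X) : thread X :=
  foldl (fun L x => rcons L (~~ odd (size L), prev (size L), x)) [::] l.

Section Lin.
Variable X : Type.
Implicit Types l : seq X.

Lemma size_lin l : size (lin l) = size l.
Proof.
elim/last_ind: l => // l x IH; rewrite /lin foldl_rcons -/(lin l).
by rewrite !size_rcons IH.
Qed.

Lemma lin_rcons l x : lin (rcons l x) = rcons (lin l) (~~ odd (size l), prev (size l), x).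
Proof. by rewrite -size_lin /lin foldl_rcons. Qed.

Lemma onth_lin l i x : onth l i = Some x -> onth (lin l) i = Some (~~ odd i, prev i, x).
Proof.
elim/last_ind: l => [|l y IH]; first by rewrite onth0n.
rewrite lin_rcons !onth_rcons size_lin; case: ltnP => // _.
by case: eqP => // -> [->].
Qed.

Lemma onth_lin_inv l i d r x : onth (lin l) i = Some (d, r, x) ->
  [/\ onth l i = Some x, d = ~~ odd i & r = prev i].
Proof.
move=> h; have := onth_lt h; rewrite size_lin => /onth_ex[y hy].
by rewrite (onth_lin hy) in h; case: h => <- <- <-.
Qed.

Lemma wf_lin l : wf (lin l).
Proof.
elim/last_ind: l => [|l x IH]; first by move=> i d r x; rewrite onth0n.
rewrite lin_rcons; apply/wf_rcons; split=> //; case E: (size l) => [//|n] /=.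
have [|y hy] := @onth_ex _ l n; first by lia.
by exists (prev n), y; rewrite (onth_lin hy) negbK.
Qed.

Lemma take_lin l n : take n (lin l) = lin (take n l).
Proof.
apply: eq_from_onth => i; rewrite onth_take; case: ltnP => hi; last first.
  by rewrite onth_default // size_lin size_take; case: ifP; lia.
case: (ltnP i (size l)) => h.
  have [x hx] := onth_ex h; rewrite (onth_lin hx).
  by rewrite (onth_lin (x := x)) // onth_take hi.
by rewrite !onth_default // size_lin ?size_take //; case: ifP; lia.
Qed.

Lemma map_snd_lin l : [seq e.2 | e <- lin l] = l.
Proof. by elim/last_ind: l => // l x IH; rewrite lin_rcons map_rcons IH. Qed.

Lemma lin_inj l l' : lin l = lin l' -> l = l'.
Proof. by move=> E; rewrite -(map_snd_lin l) E map_snd_lin. Qed.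

Lemma tp_lin l i : i < size l -> tp (lin l) (Some i) (take i.+1 l).
Proof.
elim: i => [|i IH] hi; have [x hx] := onth_ex hi; have o := onth_lin hx.
  have -> : take 1 l = rcons [::] x by rewrite (take_nth x) // take0 -odflt_onth hx.
  by apply: tp_rcons o _; constructor.
have -> : take i.+2 l = rcons (take i.+1 l) x.
  by rewrite (take_nth x) // -odflt_onth hx.
by apply: tp_rcons o _; apply: IH; apply: ltnW.
Qed.

End Lin.

Lemma tmap_lin (X Y : Type) (g : X -> Y) (l : seq X) : tmap g (lin l) = lin (map g l).
Proof.
by elim/last_ind: l => // l x IH; rewrite map_rcons !lin_rcons tmap_rcons IH size_map.
Qed.

Lemma tmap_eq_lin (X Y : Type) (g : X -> Y) (L : thread X) (l : seq Y) :
  tmap g L = lin l -> L = lin [seq e.2 | e <- L].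
Proof.
move=> E; apply: eq_from_onth => i; case o: (onth L i) => [[[d r] x]|]; last first.
  have hi : size L <= i by rewrite -onthNE o.
  by rewrite onth_default // size_lin size_map.
have o' := onth_tmap g o; rewrite E in o'; have [_ -> ->] := onth_lin_inv o'.
by rewrite (@onth_lin _ _ _ x) // onth_map o.
Qed.

Lemma jcomp_lin (A : arena) (X : Type) (g : X -> move A) (l : seq X) :
  jcomp g (lin l) <-> paths A (map g l).
Proof.
elim/last_ind: l => [|l x IH]; first by split=> // _ i m p; rewrite onth0n.
rewrite lin_rcons map_rcons jcomp_rcons IH /paths /= enabled_chain_rcons.
case/lastP: l IH => // l y IH; rewrite size_rcons !map_rcons last_rcons /=.
have o : onth (lin (rcons l y)) (size l) = Some (~~ odd (size l), prev (size l), y).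
  by apply: onth_lin; rewrite onth_last.
split=> -[? h]; split=> //.
  by case: h => [d' [r' [x' [o' e]]]]; rewrite o in o'; case: o' e => _ _ <-.
by do 3 eexists; split; [exact: o|].
Qed.

(** * Legality and views of linear plays *)

Section ViewUpto.
Variables (A : arena) (X : player) (s : jseq (move A)) (k n : nat).
Variables (m : move A) (p : option nat).
Hypothesis o : onth s n = Some (m, p).

Lemma view_upto_same : (label m).1 = X ->
  view_upto X s k.+1 n.+1 = rcons (view_upto X s k n) n.
Proof. by move=> E; rewrite /= o E; case: (X). Qed.

Lemma view_upto_other : (label m).1 = dual X ->
  view_upto X s k.+1 n.+1 = if p is Some j then view_upto X s k j ++ [:: j; n] else [:: n].
Proof. by move=> E; rewrite /= o E; case: (X). Qed.

End ViewUpto.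

Section LinPlays.
Variables A B : arena.
Implicit Types l : seq (move A * move B).

Lemma last_in_view (C : arena) X (s : jseq (move C)) n :
  size s = n.+1 -> n \in view X s.
Proof.
move=> E; rewrite /view E /=; have [|[m p] ->] := @onth_ex _ s n; first by rewrite E.
case: ifP => _; first by rewrite mem_rcons inE eqxx.
by case: p => [j|]; rewrite ?mem_cat !inE eqxx ?orbT.
Qed.

(** A first move points to the occurrence just before it, so an answer there meets a question that
    is last and still open; [legal_zig_snd] takes care of the second moves. *)
Lemma legal_lin l : paths A (unzip1 l) -> paths B (unzip2 l) ->
  (forall i x, onth l i = Some x -> (label x.1).2 = (label x.2).2) ->
  legal (A := arrow A B) (zig (lin l)).
Proof.
elim/last_ind: l => [|l x IH]; first by move=> *; apply: legal_nil.
move=> pA pB K.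
have jA : jcomp fst (lin (rcons l x)) by apply/jcomp_lin.
have jB : jcomp snd (lin (rcons l x)) by apply/jcomp_lin.
have w := @wf_lin _ (rcons l x).
have sk : same_kinds (lin (rcons l x)).
  by move=> i d r y o; have [o' _ _] := onth_lin_inv o; apply: K o'.
have {}IH : legal (A := arrow A B) (zig (lin l)).
  apply: IH.
  - by move: pA; rewrite /unzip1 map_rcons => /enabled_chain_rcons[].
  - by move: pB; rewrite /unzip2 map_rcons => /enabled_chain_rcons[].
  - by move=> i y o; apply: (K i); rewrite onth_rcons (onth_lt o).
have j : justified (A := arrow A B) (zig (lin (rcons l x))) by apply/justified_zig.
rewrite lin_rcons in jA jB w sk j *; set d := ~~ _ in jA jB w sk j *.
have [t1 t2] := jcomp_zig w jA jB.
have lf : legal (A := arrow A B) (rcons (zig (lin l)) (zfst d x, fst_ptr (prev (size l)))).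
  rewrite zig_rcons2 in j; have [/justified_rcons[_ jf] _] := (justified_rcons _ _ _).1 j.
  have [k1 k2] := kind_zfst d (sk _ _ _ _ (onth_last _ _)).
  apply/legal_rcons; split=> //.
  - by rewrite t1 size_zig /turn oddM.
  - move=> an; case E: (size l) jf => [|n] /= jf.
      by rewrite (initial_label (a := arrow A B) jf) in an.
    exists (2 * n).+1 => //.
    have sz : size (zig (lin l)) = (2 * n).+2 by rewrite size_zig size_lin E; lia.
    split; last by move=> k [[m [p [o _]]] _]; have := onth_lt o; rewrite sz ltnS.
    split.
      have [m [q [o e]]] := jf; exists m, q; split=> //.
      exact: (answer_enabled (a := arrow A B) e an).
    case=> k [m [o _]]; have := legal_backward IH o; have := onth_lt o.
    by rewrite sz; lia.
  - move=> k; case E: (size l) => [//|n] /= [<-]; apply: last_in_view.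
    by rewrite size_zig size_lin E; lia.
apply: legal_zig_snd => // k; case E: (size l) => [//|n] [<-].
have hn : n < size l by rewrite E.
rewrite E in lf.
have [V [-> _ _ /(_ _ erefl)[V' -> _]]] := view_zig_next (@wf_lin _ l) lf (tp_lin hn).
by rewrite mem_rcons !(inE, mem_cat) eqxx ?orbT.
Qed.

(** Opponent always points to the preceding occurrence, so nothing is hidden from Proponent. Hence
    visibility does not exclude wrong Proponent pointers in composite plays. *)
Lemma view_lin_all l (S w : jseq (move A + move B)) i k :
    legal (A := arrow A B) (zig (lin l)) -> S = zig (lin l) ++ w ->
    i < size l -> (2 * i).+2 <= k -> forall j, j < (2 * i).+2 ->
  j \in view_upto (A := arrow A B) Proponent S k (2 * i).+2.
Proof.
move=> lg ES; elim: i k => [|i IH] [|[|k]] // hi hk j hj.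
  have [x hx] := onth_ex hi; have [z1 z2] := onth_zig (onth_lin hx).
  have l1 := legal_turn lg z1; have l2 := legal_turn lg z2.
  have E1 : view_upto (A := arrow A B) Proponent S k.+2 2 = [:: 0; 1].
    rewrite ES (view_upto_same (A := arrow A B) _ (onth_catl w z2) l2).
    by rewrite (view_upto_other (A := arrow A B) (X := Proponent) _ (onth_catl w z1) l1).
  by rewrite E1 !inE; case: j hj => [|[]].
have [x hx] := onth_ex hi; have [z1 z2] := onth_zig (onth_lin hx).
have [|y hy] := @onth_ex _ l i; first by lia.
have [_ y2] := onth_zig (onth_lin hy).
have l1 := legal_turn lg z1; have l2 := legal_turn lg z2; have l3 := legal_turn lg y2.
rewrite turn_even in l1; rewrite turn_odd in l2; rewrite turn_odd in l3.
have hk' : (2 * i).+2 <= k.+1 by lia.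
have {}IH j' := IH k.+1 (ltnW hi) hk' j'.
have E1 : view_upto (A := arrow A B) Proponent S k.+2 (2 * i.+1).+2 =
    view_upto (A := arrow A B) Proponent S k.+1 (2 * i).+2 ++ [:: 2 * i.+1; (2 * i.+1).+1].
  rewrite ES (view_upto_same (A := arrow A B) _ (onth_catl w z2) l2).
  rewrite (view_upto_other (A := arrow A B) (X := Proponent) _ (onth_catl w z1) l1).
  cbv beta iota delta [fst_ptr prev omap obind oapp].
  by rewrite (view_upto_same (A := arrow A B) _ (onth_catl w y2) l3) -!cats1 -!catA.
rewrite E1 mem_cat !inE.
have [h|[->|->]] : j < (2 * i).+2 \/ j = 2 * i.+1 \/ j = (2 * i.+1).+1 by lia.
- by rewrite IH.
- by rewrite eqxx orbT.
- by rewrite eqxx !orbT.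
Qed.

Lemma view_lin_next l m j :
    legal (A := arrow A B) (rcons (zig (lin l)) (m, fst_ptr (prev (size l)))) ->
    j <= 2 * size l ->
  j \in view (A := arrow A B) Proponent (rcons (zig (lin l)) (m, fst_ptr (prev (size l)))).
Proof.
move=> lg hj; have [l0 _ tm _ _] := (legal_rcons _ _ _).1 lg.
rewrite size_zig size_lin /turn oddM /= in tm.
set S := rcons _ _.
have sz : size S = (2 * size l).+1 by rewrite size_rcons size_zig size_lin.
have oS : onth S (2 * size l) = Some (m, fst_ptr (prev (size l))).
  by rewrite /S -[in 2 * _](size_lin l) -size_zig onth_last.
rewrite /view sz (view_upto_other (A := arrow A B) (X := Proponent) _ oS tm).
case E: (size l) => [|n]; first by move: hj; rewrite E inE; case: (j).
cbv beta iota delta [fst_ptr prev omap obind oapp].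
have hn : n < size l by rewrite E.
have ES : S = zig (lin l) ++ [:: (m, fst_ptr (prev (size l)))] by rewrite /S -cats1.
have Ev : view_upto (A := arrow A B) Proponent S (2 * n.+1).+1 (2 * n).+2 =
    rcons (view_upto (A := arrow A B) Proponent S (2 * n.+1) (2 * n).+1) (2 * n).+1.
  have [x hx] := onth_ex hn; have [_ z2] := onth_zig (onth_lin hx).
  have l2 := legal_turn l0 z2; rewrite turn_odd in l2.
  by rewrite ES (view_upto_same (A := arrow A B) _ (onth_catl _ z2) l2).
have [hj'|->] : j < (2 * n).+2 \/ j = 2 * n.+1 by lia.
  have hk : (2 * n).+2 <= (2 * n.+1).+1 by lia.
  have := view_lin_all l0 ES hn hk hj'; rewrite Ev mem_rcons inE mem_cat !inE.
  by case/orP => ->; rewrite ?orbT.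
by rewrite mem_cat !inE eqxx !orbT.
Qed.

(** The Opponent view jumps from the second move of block m to the first move of block m-1, hence
    next to the second move of block m-2: it contains the second moves of the blocks with the parity
    of the last one. *)
Lemma Oview_lin l i : legal (A := arrow A B) (zig (lin l)) ->
    i < size l -> odd i = odd (size l).-1 ->
  (2 * i).+1 \in view (A := arrow A B) Opponent (zig (lin l)).
Proof.
move=> lg hi oi; set S := zig (lin l).
suff H m k : i <= m -> m < size l -> odd i = odd m -> (2 * m).+2 <= k ->
    (2 * i).+1 \in view_upto (A := arrow A B) Opponent S k (2 * m).+2.
  rewrite /view size_zig size_lin; have E : 2 * size l = (2 * (size l).-1).+2 by lia.
  by rewrite E; apply: H => //; lia.
elim/ltn_ind: m k => m IH [|k] // him hm om hk.
have [x hx] := onth_ex hm; have [_ z2] := onth_zig (onth_lin hx).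
have l2 := legal_turn lg z2; rewrite turn_odd in l2.
have -> : view_upto (A := arrow A B) Opponent S k.+1 (2 * m).+2 =
  let j := if prev m is Some j then 2 * j else 2 * m in
  view_upto (A := arrow A B) Opponent S k j ++ [:: j; (2 * m).+1].
  by rewrite (view_upto_other (A := arrow A B) (X := Opponent) _ z2 l2).
case: (ltngtP i m) him => // [im _|-> _]; last by rewrite /= mem_cat !inE eqxx !orbT.
case: m IH hm om hk hx z2 l2 im => [|[|m]] //= IH hm om hk hx z2 l2 im.
  by move: om im; case: (i) => [|[]].
rewrite mem_cat; have E : 2 * m.+1 = (2 * m).+2 by lia.
by rewrite E IH //; lia.
Qed.

End LinPlays.

Lemma view_upto_lt (A : arena) X (s : jseq (move A)) k n i : backward s ->
  i \in view_upto X s k n -> i < n.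
Proof.
move=> b; elim/ltn_ind: n k => -[|n] IH [|k] //=.
case o: (onth s n) => [[m p]|] //; case: ifP => _.
  by rewrite mem_rcons inE => /predU1P[->|/IH]; lia.
case: p o => [j|] o; last by rewrite inE => /eqP ->.
have jn := b _ _ _ o.
rewrite mem_cat !inE => /or3P[/IH|/eqP ->|/eqP ->]; lia.
Qed.

(** * Replies carried over by innocence *)

Section Extend.
Variables (A : arena) (sigma : set (jseq (move A))).
Hypothesis inn : innocent sigma.

(** The Proponent view after a move pointing to [j] forgets everything played after [j]. The bound
    [i <= j] keeps the pointer of the reply among the positions that the two plays share. *)
Lemma innocent_extend t m j b i : sigma t -> legal (rcons t (m, Some j)) ->
    sigma (take j.+1 t ++ [:: (m, Some j); (b, Some i)]) -> i <= j ->
    (label m).1 = Opponent ->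
  sigma (t ++ [:: (m, Some j); (b, Some i)]).
Proof.
move=> st lt ss ij tm; have [strat H] := inn.
have [_ [n [q [oj _]]] _ _ _] := (legal_rcons _ _ _).1 lt.
have jt := onth_lt oj; set s := take j.+1 t in ss *.
have sz : size s = j.+1 by rewrite size_takel.
have ls := strategy_legal strat ss; rewrite -rcons2 in ls.
have [ls1 _ tb _ vb] := (legal_rcons _ _ _).1 ls.
have es : ~~ odd (size s).
  by have [_ /(_ _ ss)[_]] := strat; rewrite size_cat oddD addbF.
have os : onth (rcons s (m, Some j)) j.+1 = Some (m, Some j) by rewrite -sz onth_last.
have ot : onth (rcons t (m, Some j)) (size t) = Some (m, Some j) by rewrite onth_last.
pose U := rcons (view_upto Proponent (rcons t (m, Some j)) (size t) j) j.
have bt := legal_backward lt.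
have EO k : k < j.+1 -> onth (rcons s (m, Some j)) k = onth (rcons t (m, Some j)) k.
  move=> kj; rewrite !onth_rcons sz kj onth_take kj.
  by have -> : k < size t by lia.
have Ew : view Proponent (rcons t (m, Some j)) = rcons U (size t).
  rewrite /view size_rcons (view_upto_other (X := Proponent) _ ot tm) /U.
  by rewrite -cat_rcons cats1.
have Ev : view Proponent (rcons s (m, Some j)) = rcons U j.+1.
  rewrite /view size_rcons sz (view_upto_other (X := Proponent) _ os tm) /U -cat_rcons cats1.
  congr (rcons (rcons _ _) _); apply: (view_upto_skeleton _ (legal_backward ls1)) => //; last exact: ltnW.
  by move=> k kj; rewrite !onth_map EO //; lia.
have U_le k : k \in U -> k <= j.
  by rewrite mem_rcons inE => /predU1P[->|/(view_upto_lt bt)]; lia.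
have iU : i \in U.
  have := vb _ erefl; rewrite tb size_rcons /turn /= es Ev mem_rcons inE.
  by case/predU1P => // E; move: ij; rewrite E ltnn.
have Ei : nth 0 (rcons U (size t)) (index i (rcons U j.+1)) = i.
  rewrite -!cats1 index_cat iU nth_cat index_mem iU; exact: nth_index.
have ptr_eq q' : (forall q0, q' = Some q0 -> q0 < j.+1) ->
    obind (fun j0 => if j0 \in rcons U j.+1 then Some (index j0 (rcons U j.+1)) else None) q' =
    obind (fun j0 => if j0 \in rcons U (size t) then Some (index j0 (rcons U (size t))) else None) q'.
  case: q' => //= q0 /(_ _ erefl) hq; rewrite !mem_rcons !inE.
  have -> : (q0 == j.+1) = false by lia.
  have -> : (q0 == size t) = false by lia.
  by rewrite /=; case: ifP => // qU; rewrite -!cats1 !index_cat qU.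
have := H s (m, Some j) (b, Some i) t (m, Some j) ss st lt.
rewrite Ev Ew /= Ei; apply.
rewrite /view_seq Ev Ew -!cats1 !pmap_cat; congr (_ ++ _); rewrite !cats1; last first.
  have hj q0 : Some j = Some q0 -> q0 < j.+1 by case=> <-.
  by have /= E := ptr_eq _ hj; rewrite /= os ot /= E.
apply: eq_in_pmap => k /U_le kj; rewrite EO //.
case o: (onth _ k) => [[n' q']|] //=; congr (Some (_, _)).
by apply: ptr_eq => q0 E; have := bt k n' q0; rewrite o E => /(_ erefl); lia.
Qed.

(** After an initial move the view is that move alone, so the reply is the same as at the start of a
    play. *)
Lemma innocent_extend_initial t m b : sigma t -> legal (rcons t (m, None)) ->
    sigma [:: (m, None); (b, Some 0)] -> (label m).1 = Opponent ->
  sigma (t ++ [:: (m, None); (b, Some (size t))]).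
Proof.
move=> st lt ss tm; have [strat H] := inn.
have ot : onth (rcons t (m, None)) (size t) = Some (m, None) by rewrite onth_last.
have os : onth [:: (m, None : option nat)] 0 = Some (m, None) by [].
have Ew : view Proponent (rcons t (m, None)) = [:: size t].
  by rewrite /view size_rcons (view_upto_other (X := Proponent) _ ot tm).
have Ev : view Proponent (rcons [::] (m, None)) = [:: 0].
  by rewrite /view size_rcons (view_upto_other (X := Proponent) _ os tm).
have := H [::] (m, None) (b, Some 0) t (m, None) ss st lt.
rewrite Ev Ew /=; apply.
by rewrite /view_seq Ev Ew /= ot.
Qed.

End Extend.

(** * From isomorphic arenas to path isomorphisms *)

Definition swap (X Y : Type) (x : X * Y) : Y * X := (x.2, x.1).

Lemma map_swapK (X Y : Type) (l : seq (X * Y)) : map (@swap Y X) (map (@swap X Y) l) = l.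
Proof. by rewrite -map_comp -[RHS]map_id; apply: eq_map => -[]. Qed.

Lemma unzip1_swap (X Y : Type) (l : seq (X * Y)) : unzip1 (map (@swap X Y) l) = unzip2 l.
Proof. by rewrite /unzip1 -map_comp. Qed.

Lemma unzip2_swap (X Y : Type) (l : seq (X * Y)) : unzip2 (map (@swap X Y) l) = unzip1 l.
Proof. by rewrite /unzip2 -map_comp. Qed.

Lemma copycat_respond (A : arena) L x r y :
  copycat A (zig L ++ [:: (x, fst_ptr r); y]) ->
  isr y.1 = ~~ isr x /\ y.2 = snd_ptr (2 * size L) r.
Proof.
move=> /copycat_zig[L' _ E]; have [[[d r'] z] [L'' [_]]] := zig_next E.
rewrite /zblock /= => -[-> Er ->] /=.
have <- : r = r' by case: (r) (r') Er => [i|] [j|] //= [Er]; congr Some; lia.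
by case: d.
Qed.

Definition matched (A B : arena) (sigma : set (jseq (move (arrow A B))))
    (tau : set (jseq (move (arrow B A)))) (l : seq (move A * move B)) : Prop :=
  sigma (zig (lin l)) /\ tau (zig (lin (map (@swap _ _) l))).

Lemma matched_swap (A B : arena) sigma tau (l : seq (move A * move B)) :
  matched sigma tau l -> matched tau sigma (map (@swap _ _) l).
Proof. by case=> h1 h2; split; rewrite ?map_swapK. Qed.

Lemma matched_take (A B : arena) sigma tau (l : seq (move A * move B)) n :
    strategy (A := arrow A B) sigma -> strategy (A := arrow B A) tau ->
  matched sigma tau l -> matched sigma tau (take n l).
Proof.
move=> ss st [h1 h2]; split; rewrite ?map_take -take_lin -take_zig.
  rewrite -[X in sigma X](cat_take_drop (2 * n)) in h1.
  by apply: (strategy_prefix ss h1); rewrite take_zig odd_size_zig.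
rewrite -[X in tau X](cat_take_drop (2 * n)) in h2.
by apply: (strategy_prefix st h2); rewrite take_zig odd_size_zig.
Qed.

Lemma lin_paths (A B : arena) (l : seq (move A * move B)) :
  legal (A := arrow A B) (zig (lin l)) -> paths A (unzip1 l) /\ paths B (unzip2 l).
Proof.
by case=> /justified_zig - /(_ (@wf_lin _ _))[/jcomp_lin ? /jcomp_lin ?].
Qed.

(* A Proponent answer justified before the preceding question would violate
   bracketing. *)
Lemma lin_answer (A B : arena) (l : seq (move A * move B)) i x :
    legal (A := arrow A B) (zig (lin l)) -> onth l i = Some x ->
    (label (a := arrow A B) (zsnd (~~ odd i) x)).2 = Answer ->
  (label (a := arrow A B) (zfst (~~ odd i) x)).2 = Answer.
Proof.
move=> lg o an; have [z1 z2] := onth_zig (onth_lin o).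
case E: (label _).2 => //; have [_ _ br _] := lg.
have [j Ej [_ mx]] := br _ _ _ z2 an.
have : unanswered (A := arrow A B) (take (2 * i).+1 (zig (lin l))) (2 * i).
  split; first by exists (zfst (~~ odd i) x), (fst_ptr (prev i)); rewrite onth_take ltnSn z1.
  case=> k [m [ok _]]; rewrite onth_take in ok; move: ok; case: ltnP => // hk ok.
  by have := legal_backward lg ok; lia.
move=> /mx; move: Ej; rewrite /snd_ptr => -[<-]; case: i o an z1 z2 E mx => [|i] o an z1 z2 E mx /=; last by lia.
have [j1 _] := (justified_zig (@wf_lin _ l)).1 (let: And4 j _ _ _ := lg in j).
have := (jcompP _ _).1 j1 _ _ _ _ (onth_lin o) => /= /initial_label E'.
by rewrite /= E' in an.
Qed.

(** Within a block, [sigma] and [tau] end in different components, so [lin_answer] applied to each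
    of them gives the two implications between the kinds. *)
Lemma matched_kinds (A B : arena) sigma tau (l : seq (move A * move B)) i x :
    strategy (A := arrow A B) sigma -> strategy (A := arrow B A) tau ->
    matched sigma tau l -> onth l i = Some x ->
  (label x.1).2 = (label x.2).2.
Proof.
move=> ss st [h1 h2] o.
have K1 := lin_answer (strategy_legal ss h1) o.
have o' : onth (map (@swap _ _) l) i = Some (swap x) by rewrite onth_map o.
have K2 := lin_answer (strategy_legal st h2) o'.
move: K1 K2; rewrite /zfst /zsnd /swap; case: (odd i) => /=.
  by case: (label x.1).2; case: (label x.2).2 => // K1 K2; [have := K1 erefl|have := K2 erefl].
by case: (label x.1).2; case: (label x.2).2 => // K1 K2; [have := K2 erefl|have := K1 erefl].
Qed.

(** Two linear plays sharing their middle path form an interaction of triples, whose composite must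
    be a copycat play. This is the source of the uniqueness of branches. *)
Lemma compose_lin (A B : arena) sigma tau (l1 : seq (move A * move B)) (l2 : seq (move B * move A)) :
    strategy (A := arrow A B) sigma -> strategy (A := arrow B A) tau ->
    compose sigma tau = copycat A ->
    sigma (zig (lin l1)) -> tau (zig (lin l2)) -> unzip2 l1 = unzip1 l2 ->
    (forall i x, onth l2 i = Some x -> (label x.1).2 = (label x.2).2) ->
  unzip1 l1 = unzip2 l2.
Proof.
move=> ss st Hc h1 h2 E K.
have [l3 [E1 E2]] : exists l3, map (@pAB A B A) l3 = l1 /\ map (@pBC A B A) l3 = l2.
  elim: l1 l2 E {h1 h2 K} => [|[a b] l1 IH] [|[b' a'] l2] //= => [_|[-> /IH[l3 [<- <-]]]].
    by exists [::].
  by exists ((a, b', a') :: l3).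
have [pA pB] := lin_paths (strategy_legal ss h1).
have [_ pC] := lin_paths (strategy_legal st h2).
have jA : jcomp (@prA A B A) (lin l3).
  by apply/jcomp_lin; move: pA; rewrite -E1 /unzip1 -map_comp.
have jB : jcomp (@prB A B A) (lin l3).
  by apply/jcomp_lin; move: pB; rewrite -E1 /unzip2 -map_comp.
have jC : jcomp (@prC A B A) (lin l3).
  by apply/jcomp_lin; move: pC; rewrite -E2 /unzip2 -map_comp.
have w := @wf_lin _ l3.
have := compose_tri ss st w jA jB jC; rewrite !tmap_lin E1 E2 => /(_ h1 h2).
have lg : legal (A := arrow A A) (zig (lin (map (@pAC A B A) l3))).
  have l1g := strategy_legal ss h1; rewrite -E1 in l1g.
  apply: legal_skeleton l1g _.
    rewrite -!tmap_lin; have Eid : tmap (@pAB A B A) (lin l3) = tmap (fun x => (prA x, prB x)) (lin l3).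
      by apply: eq_map => -[[d r] [[a b] c]].
    rewrite Eid; apply: (@skeleton_zig A B A A _ (@prA A B A) (@prB A B A) (@prA A B A) (@prC A B A)) => //.
    move=> i d r x o; split=> //; have [o' _ _] := onth_lin_inv o.
    by have := K i (pBC x); rewrite -E2 onth_map o' => /(_ erefl).
  by rewrite -tmap_lin; apply/justified_zig; [exact: wf_tmap|split; apply/jcomp_tmap].
move=> /(_ lg); rewrite Hc => /copycat_zig[L' _ /zig_inj E'].
have : map (@pAC A B A) l3 = map (fun a => (a, a)) [seq e.2 | e <- L'].
  by rewrite -[LHS]map_snd_lin E' /tmap -!map_comp.
move: (map snd L') => l4 E4.
have -> : unzip1 l1 = unzip1 (map (@pAC A B A) l3) by rewrite -E1 /unzip1 -!map_comp.
have -> : unzip2 l2 = unzip2 (map (@pAC A B A) l3) by rewrite -E2 /unzip2 -!map_comp.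
by rewrite E4 /unzip1 /unzip2 -!map_comp.
Qed.

Definition inverse_pair (A B : arena) (sigma : set (jseq (move (arrow A B))))
    (tau : set (jseq (move (arrow B A)))) : Prop :=
  [/\ innocent (A := arrow A B) sigma, innocent (A := arrow B A) tau,
      compose sigma tau = copycat A & compose tau sigma = copycat B].

Lemma inverse_pair_sym (A B : arena) sigma tau :
  @inverse_pair A B sigma tau -> @inverse_pair B A tau sigma.
Proof. by case. Qed.

Lemma matched_unzip2_inj (A B : arena) sigma tau (l l' : seq (move A * move B)) :
    inverse_pair sigma tau -> matched sigma tau l -> matched sigma tau l' ->
  unzip2 l = unzip2 l' -> l = l'.
Proof.
move=> [[ss _] [st _] Hc _] m m' E; rewrite -(zip_unzip l) -(zip_unzip l') E; congr zip.
rewrite -[RHS]unzip2_swap; apply: compose_lin Hc m.1 m'.2 _ _ => //.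
  by rewrite unzip1_swap.
by move=> i x; apply: matched_kinds (matched_swap m').
Qed.

Lemma matched_unzip1_inj (A B : arena) sigma tau (l l' : seq (move A * move B)) :
    inverse_pair sigma tau -> matched sigma tau l -> matched sigma tau l' ->
  unzip1 l = unzip1 l' -> l = l'.
Proof.
move=> inv m m' E; rewrite -(map_swapK l) -(map_swapK l'); congr map.
apply: matched_unzip2_inj (inverse_pair_sym inv) (matched_swap m) (matched_swap m') _.
by rewrite !unzip2_swap.
Qed.

Definition total_upto (A B : arena) (sigma : set (jseq (move (arrow A B))))
    (tau : set (jseq (move (arrow B A)))) (k : nat) : Prop :=
  forall p, paths A p -> size p <= k -> exists2 l, unzip1 l = p & matched sigma tau l.

Definition responds_at (A B : arena) (sigma : set (jseq (move (arrow A B))))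
    (tau : set (jseq (move (arrow B A)))) (k : nat) : Prop :=
  forall l, size l = k -> matched sigma tau l ->
    respond sigma (lin l) (~~ odd k) (prev k).

(** [parse_tri] applies because every stage that it asks about is a matched branch of length less
    than [k], after which the answers are known. *)
Lemma total_step (A B : arena) sigma tau k : @inverse_pair A B sigma tau ->
    (forall i, i < k -> responds_at sigma tau i /\ responds_at tau sigma i) ->
  total_upto sigma tau k.
Proof.
move=> [[ss _] [st _] Hc _] HR p pp sp.
pose dp := map (fun a : move A => (a, a)) p.
have lg : legal (A := arrow A A) (zig (lin dp)).
  apply: legal_lin; rewrite /unzip1 /unzip2 -?map_comp ?map_id //.
  by move=> i x; rewrite onth_map; case: (onth p i) => // a [<-].
have : copycat A (zig (lin dp)).
  by rewrite /dp -tmap_lin in lg *; apply: zig_copycat lg; apply: wf_lin.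
rewrite -Hc => -[u [iu su tu Eu]].
have ju : justified u by case: iu.
(* When the outer moves of all triples agree, the two inner restrictions are one branch and its
   swap, which is the shape required by [matched]. *)
have recover L p' : tmap (@pAC A B A) L = lin (map (fun a => (a, a)) p') ->
    exists l, [/\ tmap (@pAB A B A) L = lin l,
      tmap (@pBC A B A) L = lin (map (@swap _ _) l) & unzip1 l = p'].
  move=> E; have EL := tmap_eq_lin E; move: [seq e.2 | e <- L] EL E => l3 ->.
  rewrite !tmap_lin => /lin_inj E; exists (map (@pAB A B A) l3); split=> //.
    congr lin; elim: l3 p' E => [|[[a b] c] l3 IH] [|a' p'] //= [-> -> /IH E].
    by rewrite -map_comp in E *; rewrite E.
  have := congr1 unzip1 E; rewrite /unzip1 -!map_comp => ->.
  by rewrite -[RHS]map_id; apply: eq_map.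
have szu : size (restrict (@in_AC A B A) u) = 2 * size p.
  by rewrite -Eu size_zig size_lin size_map.
have [|L w EL] := parse_tri ss st iu su tu.
  move=> L d r m v w sL tL E Ed.
  case: v E => [|y v] E; first by move: szu; rewrite E size_cat size_zig /=; lia.
  rewrite -Eu in E; have [[[d' r'] x] [L'' [E1 E2]]] := zig_next (esym E).
  have EAC : tmap (@pAC A B A) L = lin (map (fun a => (a, a)) (take (size L) p)).
    rewrite map_take -take_lin -/dp E1 cat_rcons take_size_cat //.
    by rewrite size_tmap.
  have o : onth (lin dp) (size L) = Some (d', r', x).
    rewrite E1; apply: onth_catl.
    by have := onth_last (tmap (@pAC A B A) L) (d', r', x); rewrite size_tmap.
  have [op Ed' Er'] := onth_lin_inv o.
  have hL : size L < size p by have := onth_lt op; rewrite size_map.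
  have Er : r = prev (size L).
    rewrite -Er'; case: E2 => _ + _.
    by case: (r) (r') => [i|] [j|] //= [?]; congr Some; lia.
  have {}Ed : d = ~~ odd (size L).
    by rewrite -Ed' -Ed; case: E2 => -> _ _; case: (d').
  have [l [lAB lBC ul]] := recover _ _ EAC.
  have sl : size l = size L by rewrite -(size_lin l) -lAB size_tmap.
  have ml : matched sigma tau l by rewrite /matched -lAB -lBC.
  have [R1 R2] := HR (size L) (leq_trans hL sp).
  rewrite lAB lBC Er Ed; split; first exact: R1 sl ml.
  by apply: R2 (matched_swap ml); rewrite size_map.
rewrite EL in ju; have [EAB EBC EAC] := restrict_tri w ju.
have EL' : tmap (@pAC A B A) L = lin (map (fun a => (a, a)) p).
  by apply: zig_inj; rewrite -EAC -EL -Eu.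
have [l [lAB lBC ul]] := recover _ _ EL'.
exists l => //; split; first by rewrite -lAB -EAB -EL.
by rewrite -lBC -EBC -EL.
Qed.

(** * Faulty answers contradict the copycat composite *)

Section Zigzag.
Variables (A B : arena) (sigma : set (jseq (move (arrow A B))))
  (tau : set (jseq (move (arrow B A)))).
Hypothesis inv : inverse_pair sigma tau.

Let ss : strategy sigma. Proof. by case: inv => -[]. Qed.
Let st : strategy tau. Proof. by case: inv => _ []. Qed.
Let Hc : compose sigma tau = copycat A. Proof. by case: inv. Qed.

Variable l : seq (move A * move B).
Hypothesis ml : matched sigma tau l.

Let legS : legal (A := arrow A B) (zig (lin l)).
Proof. by apply: strategy_legal ss _; case: ml. Qed.
Let pA : paths A (unzip1 l). Proof. by case: (lin_paths legS). Qed.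
Let pB : paths B (unzip2 l). Proof. by case: (lin_paths legS). Qed.

Let dup (x : move A * move B) := (x.1, x.1).
Let trip (x : move A * move B) := (x.1, x.2, x.1).
Let L := lin (map trip l).
Let k := size l.

Let wL : wf L. Proof. exact: wf_lin. Qed.

Let onL i x : onth l i = Some x -> onth L i = Some (~~ odd i, prev i, trip x).
Proof. by move=> h; apply: onth_lin; rewrite onth_map h. Qed.

Let sL : size L = k. Proof. by rewrite size_lin size_map. Qed.

Let jT : justified (A := arrow (arrow A B) A) (tri L).
Proof.
by apply: justified_tri => //; apply/jcomp_lin; rewrite -map_comp.
Qed.

Let AB_lin : tmap (@pAB A B A) L = lin l.
Proof.
by rewrite /L tmap_lin -map_comp; congr lin; rewrite -[RHS]map_id; apply: eq_map => -[].
Qed.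

Let BC_lin : tmap (@pBC A B A) L = lin (map (@swap _ _) l).
Proof. by rewrite /L tmap_lin -map_comp. Qed.

Let AC_lin : tmap (@pAC A B A) L = lin (map dup l).
Proof. by rewrite /L tmap_lin -map_comp. Qed.

Let skel_dup : skeleton (A := arrow A B) (zig (lin l)) =
  skeleton (A := arrow A A) (zig (lin (map dup l))).
Proof.
have jA : jcomp fst (lin l) by apply/jcomp_lin.
have jB : jcomp snd (lin l) by apply/jcomp_lin.
have Eid : lin l = tmap (fun x => (x.1, x.2)) (lin l).
  by rewrite /tmap -[LHS]map_id; apply: eq_map => -[[d r] []].
rewrite {1}Eid -tmap_lin.
apply: (@skeleton_zig A B A A _ fst snd fst fst) => // [|i d r x o]; first exact: wf_lin.
split=> //; have [o' _ _] := onth_lin_inv o.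
by have := matched_kinds ss st ml o'.
Qed.

Let skel_swap : skeleton (A := arrow B A) (zig (lin (map (@swap _ _) l))) =
  skeleton (A := arrow A A) (zig (lin (map dup l))).
Proof.
have jA : jcomp fst (lin l) by apply/jcomp_lin.
have jB : jcomp snd (lin l) by apply/jcomp_lin.
rewrite -!tmap_lin.
apply: (@skeleton_zig B A A A _ snd fst fst fst) => // [|i d r x o]; first exact: wf_lin.
split=> //; have [o' _ _] := onth_lin_inv o.
by have := matched_kinds ss st ml o'.
Qed.

Let legC : legal (A := arrow A A) (zig (lin (map dup l))).
Proof.
apply: legal_skeleton skel_dup legS _; apply/justified_zig; first exact: wf_lin.
by split; apply/jcomp_lin; rewrite -map_comp.
Qed.

Let rT (N : Type) (f : move A + move B + move A -> option N) w :
  rst f (tri L ++ w) = foldl (rst_step f) (rst f (tri L)) w.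
Proof. by rewrite /rst foldl_cat. Qed.

(** The data needed to append moves to the interaction along the branch. There is only one root, so
    every hidden B-move leads to occurrence 0 of the composite. *)
Let tables : exists TAB TBC TAC,
  [/\ rst (@in_AB A B A) (tri L) = (zig (lin l), TAB),
      rst (@in_BC A B A) (tri L) = (zig (lin (map (@swap _ _) l)), TBC),
      rst (@in_AC A B A) (tri L) = (zig (lin (map dup l)), TAC),
      [/\ size TAB = 3 * k, size TBC = 3 * k & size TAC = 3 * k]
    & forall i, i < k ->
     [/\ [/\ nth None TAB (3 * i) = (if odd i then Some (2 * i) else None),
             nth None TAB (3 * i).+1 = Some (2 * i + odd i)
           & nth None TAB (3 * i).+2 = (if odd i then None else Some (2 * i).+1)],
         [/\ ~~ odd i -> nth None TBC (3 * i) = Some (2 * i),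
             nth None TBC (3 * i).+1 = Some (2 * i + ~~ odd i)
           & odd i -> nth None TBC (3 * i).+2 = Some (2 * i).+1]
       & [/\ nth None TAC (3 * i) = Some (2 * i),
             nth None TAC (3 * i).+1 = Some 0
           & nth None TAC (3 * i).+2 = Some (2 * i).+1]]].
Proof.
have [EAB TAB] := rst_tri_AB wL; have [EBC TBC] := rst_tri_BC wL.
have [EAC TAC] := rst_tri_AC wL.
exists (rst (@in_AB A B A) (tri L)).2, (rst (@in_BC A B A) (tri L)).2,
  (rst (@in_AC A B A) (tri L)).2.
rewrite -AB_lin -BC_lin -AC_lin -EAB -EBC -EAC !size_rst2 size_tri sL.
split=> //; try exact: surjective_pairing.
move=> i hi; have [x hx] := onth_ex hi; have o := onL hx; split.
- by have [h0 h1 h2] := TAB _ _ _ _ o; move: h0 h1 h2; case: (odd i).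
- by have [h0 h1 h2] := TBC _ _ _ _ o; split=> //; move: h2; case: (odd i).
- have [h0 [i0 [x0 [o0 h1]]] h2] := TAC _ _ _ _ o; split=> //; rewrite h1.
  by have [_ _] := onth_lin_inv o0; case: (i0).
Qed.

Let szS : size (zig (lin l)) = 2 * k. Proof. by rewrite size_zig size_lin. Qed.
Let szT : size (zig (lin (map (@swap _ _) l))) = 2 * k.
Proof. by rewrite size_zig size_lin size_map. Qed.
Let szC : size (zig (lin (map dup l))) = 2 * k.
Proof. by rewrite size_zig size_lin size_map. Qed.

Let legal_first (x : move A + move B) (y : move A + move A) p :
    legal (A := arrow A B) (rcons (zig (lin l)) (x, p)) ->
    label (a := arrow A B) x = label (a := arrow A A) y ->
    justified (A := arrow A A) (rcons (zig (lin (map dup l))) (y, p)) ->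
  legal (A := arrow A A) (rcons (zig (lin (map dup l))) (y, p)).
Proof.
move=> lx E; apply: legal_skeleton lx.
by rewrite /skeleton !map_rcons -!/(skeleton _) skel_dup; congr (rcons _ (_, _)).
Qed.

(** After hiding [b], the move [z] answers [a] with pointer 2i, whereas copycat points to 2(k-1). As
    [z] is a question, bracketing cannot make this composite play illegal. *)
Lemma left_pointer a b z i : odd k -> ~~ odd i -> i.+1 < k ->
    sigma (zig (lin l) ++ [:: (inl a, fst_ptr (prev k)); (inr b, Some (2 * i))]) ->
    tau (zig (lin (map (@swap _ _) l)) ++ [:: (inl b, Some (2 * i).+1); (inr z, Some (2 * i))]) ->
    (label z).2 = Question ->
  False.
Proof.
move=> ok oi hi hs ht qz.
case Ek : k ok => [//|n] /= on.
have hn : n < k by rewrite Ek.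
have hi' : i < k by lia.
have [TAB [TBC [TAC [EAB EBC EAC [s1 s2 s3] T]]]] := tables.
have [[n0 n1 n2] [m0 m1 m2] [q0 q1 q2]] := T _ hn.
have [[i0 i1 i2] [j0 j1 j2] [r0 r1 r2]] := T _ hi'.
rewrite (negPf on) ?(negPf oi) /= in n2 i1 j1; rewrite addn0 in i1; rewrite addn1 in j1.
have {}j0 := j0 oi.
have [[xa xb] ox] := onth_ex hn; have [[ya yb] oy] := onth_ex hi'.
have ls := strategy_legal ss hs; rewrite -rcons2 in ls.
have [ls1 jb tb _ _] := (legal_rcons _ _ _).1 ls.
have [_ ja ta _ _] := (legal_rcons _ _ _).1 ls1.
have lt := strategy_legal st ht; rewrite -rcons2 in lt.
have [lt1 jz tz _ _] := (legal_rcons _ _ _).1 lt.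
have [_ z2] := onth_zig (onth_lin ox); have [y1 _] := onth_zig (onth_lin oy).
have oys : onth (map (@swap _ _) l) i = Some (yb, ya) by rewrite onth_map oy.
have [w1 _] := onth_zig (onth_lin oys).
rewrite (negPf on) in z2; rewrite oi in y1 w1; rewrite /zfst /zsnd /= in z2 y1 w1.
have ea : enables A (Some xa) a.
  by move: ja; rewrite Ek /= => -[n' [q []]]; rewrite z2 => -[<- _].
have eb : enables B (Some yb) b.
  move: jb => [n' [q []]]; rewrite onth_rcons szS.
  have -> : 2 * i < 2 * k by lia.
  by rewrite y1 => -[<- _].
have ez : enables A (Some ya) z.
  move: jz => [n' [q []]]; rewrite onth_rcons szT.
  have -> : 2 * i < 2 * k by lia.
  by rewrite w1 => -[<- _].
have lc1 : legal (A := arrow A A) (rcons (zig (lin (map dup l))) (inl a, fst_ptr (prev k))).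
  apply: legal_first ls1 _ _ => //.
  apply/justified_rcons; split; first by case: legC.
  have oxd : onth (map dup l) n = Some (xa, xa) by rewrite onth_map ox.
  have [_ v2] := onth_zig (onth_lin oxd); rewrite (negPf on) in v2.
  by rewrite Ek /=; do 2 eexists; split; [exact: v2|].
have lc : legal (A := arrow A A) (zig (lin (map dup l)) ++
    [:: (inl a, fst_ptr (prev k)); (inr z, Some (2 * i))]).
  rewrite -rcons2; apply/legal_rcons; split=> //.
  - have oyd : onth (map dup l) i = Some (ya, ya) by rewrite onth_map oy.
    have [v1 _] := onth_zig (onth_lin oyd); rewrite oi in v1.
    exists (inr ya), (fst_ptr (prev i)); rewrite onth_rcons szC v1.
    by have -> : 2 * i < 2 * k by lia.
  - rewrite size_rcons szC turn_odd; move: tz; rewrite size_rcons szT turn_odd.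
    by [].
  - by rewrite qz.
  - move=> j [<-]; rewrite tz size_rcons szT turn_odd /k -(size_map dup).
    by apply: view_lin_next; rewrite size_map //; lia.
pose u := tri L ++ [:: (inl (inl a), Some (3 * n).+2); (inl (inr b), Some (3 * i).+1);
    (inr z, Some (3 * i))].
have ju : justified (A := arrow (arrow A B) A) u.
  have [qa oa] := onth_triA (onL ox); have [qb ob] := onth_triB (onL oy).
  have [qc oc] := onth_triC (onL oy).
  rewrite (negPf on) addn2 in oa; rewrite addn1 in ob; rewrite oi addn0 in oc.
  rewrite /u cat3; apply/justified_rcons; split; [apply/justified_rcons; split;
    [apply/justified_rcons; split=> //|] |].
  - by do 2 eexists; split; [exact: oa|].
  - by do 2 eexists; split; [rewrite onth_rcons (onth_lt ob); exact: ob|].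
  - do 2 eexists; split; [rewrite !onth_rcons size_rcons (leqW (onth_lt oc)) (onth_lt oc); exact: oc|].
    exact: ez.
have := @compose_rst A B A sigma tau u _ _ _ ss st ju _ _ _ hs ht lc.
rewrite /u !rT EAB EBC EAC /= /rst_step /=; push_nth.
rewrite n2 q2 i1 j0 j1 r0 !rcons2 Ek.
move=> /(_ erefl erefl erefl).
rewrite Hc => /(copycat_respond (r := Some n))[_] /= [].
by lia.
Qed.

Let legal_first_swap (x : move B + move A) (y : move A + move A) p :
    legal (A := arrow B A) (rcons (zig (lin (map (@swap _ _) l))) (x, p)) ->
    label (a := arrow B A) x = label (a := arrow A A) y ->
    justified (A := arrow A A) (rcons (zig (lin (map dup l))) (y, p)) ->
  legal (A := arrow A A) (rcons (zig (lin (map dup l))) (y, p)).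
Proof.
move=> lx E; apply: legal_skeleton lx.
by rewrite /skeleton !map_rcons -!/(skeleton _) skel_swap; congr (rcons _ (_, _)).
Qed.

(** The same contradiction when the external move is in the right component: now [tau] errs and
    [sigma] replies. *)
Lemma right_pointer a b z i : ~~ odd k -> odd i -> i.+1 < k ->
    tau (zig (lin (map (@swap _ _) l)) ++ [:: (inr a, fst_ptr (prev k)); (inl b, Some (2 * i))]) ->
    sigma (zig (lin l) ++ [:: (inr b, Some (2 * i).+1); (inl z, Some (2 * i))]) ->
    (label z).2 = Question ->
  False.
Proof.
move=> ok oi hi ht hs qz.
case Ek : k ok hi => [//|n] /=; rewrite negbK => on hi.
have hn : n < k by rewrite Ek.
have hi' : i < k by lia.
have [TAB [TBC [TAC [EAB EBC EAC [s1 s2 s3] T]]]] := tables.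
have [[n0 n1 n2] [m0 m1 m2] [q0 q1 q2]] := T _ hn.
have [[i0 i1 i2] [j0 j1 j2] [r0 r1 r2]] := T _ hi'.
rewrite oi /= in i0 i1 j1; rewrite addn1 in i1; rewrite addn0 in j1.
have {}m2 := m2 on.
have [[xa xb] ox] := onth_ex hn; have [[ya yb] oy] := onth_ex hi'.
have ls := strategy_legal ss hs; rewrite -rcons2 in ls.
have [ls1 jz tz _ _] := (legal_rcons _ _ _).1 ls.
have lt := strategy_legal st ht; rewrite -rcons2 in lt.
have [lt1 jb tb _ _] := (legal_rcons _ _ _).1 lt.
have [_ ja ta _ _] := (legal_rcons _ _ _).1 lt1.
have oxs : onth (map (@swap _ _) l) n = Some (xb, xa) by rewrite onth_map ox.
have oys : onth (map (@swap _ _) l) i = Some (yb, ya) by rewrite onth_map oy.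
have [_ z2] := onth_zig (onth_lin oxs); have [y1 _] := onth_zig (onth_lin oy).
have [w1 _] := onth_zig (onth_lin oys).
rewrite on in z2; rewrite oi in y1 w1; rewrite /zfst /zsnd /= in z2 y1 w1.
have ea : enables A (Some xa) a.
  by move: ja; rewrite Ek /= => -[n' [q []]]; rewrite z2 => -[<- _].
have eb : enables B (Some yb) b.
  move: jb => [n' [q []]]; rewrite onth_rcons szT.
  have -> : 2 * i < 2 * k by lia.
  by rewrite w1 => -[<- _].
have ez : enables A (Some ya) z.
  move: jz => [n' [q []]]; rewrite onth_rcons szS.
  have -> : 2 * i < 2 * k by lia.
  by rewrite y1 => -[<- _].
have lc1 : legal (A := arrow A A) (rcons (zig (lin (map dup l))) (inr a, fst_ptr (prev k))).
  apply: legal_first_swap lt1 _ _ => //.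
  apply/justified_rcons; split; first by case: legC.
  have oxd : onth (map dup l) n = Some (xa, xa) by rewrite onth_map ox.
  have [_ v2] := onth_zig (onth_lin oxd); rewrite on in v2.
  by rewrite Ek /=; do 2 eexists; split; [exact: v2|].
have lc : legal (A := arrow A A) (zig (lin (map dup l)) ++
    [:: (inr a, fst_ptr (prev k)); (inl z, Some (2 * i))]).
  rewrite -rcons2; apply/legal_rcons; split=> //.
  - have oyd : onth (map dup l) i = Some (ya, ya) by rewrite onth_map oy.
    have [v1 _] := onth_zig (onth_lin oyd); rewrite oi in v1.
    exists (inl ya), (fst_ptr (prev i)); rewrite onth_rcons szC v1.
    by have -> : 2 * i < 2 * k by lia.
  - rewrite size_rcons szC turn_odd; move: tz; rewrite size_rcons szS turn_odd.
    by [].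
  - by rewrite /= qz.
  - move=> j [<-]; rewrite [(label _).1]tz size_rcons szS turn_odd /k -(size_map dup).
    by apply: view_lin_next; rewrite size_map //; lia.
pose u := tri L ++ [:: (inr a, Some (3 * n).+2); (inl (inr b), Some (3 * i).+1);
    (inl (inl z), Some (3 * i))].
have ju : justified (A := arrow (arrow A B) A) u.
  have [qa oa] := onth_triC (onL ox); have [qb ob] := onth_triB (onL oy).
  have [qc oc] := onth_triA (onL oy).
  rewrite on addn2 in oa; rewrite addn1 in ob; rewrite oi addn0 in oc.
  rewrite /u cat3; apply/justified_rcons; split; [apply/justified_rcons; split;
    [apply/justified_rcons; split=> //|] |].
  - by do 2 eexists; split; [exact: oa|].
  - by do 2 eexists; split; [rewrite onth_rcons (onth_lt ob); exact: ob|].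
  - do 2 eexists; split; [rewrite !onth_rcons size_rcons (leqW (onth_lt oc)) (onth_lt oc); exact: oc|].
    exact: ez.
have := @compose_rst A B A sigma tau u _ _ _ ss st ju _ _ _ hs ht lc.
rewrite /u !rT EAB EBC EAC /= /rst_step /=; push_nth.
rewrite i0 i1 m2 j1 q2 r0 !rcons2 Ek.
move=> /(_ erefl erefl erefl).
rewrite Hc => /(copycat_respond (r := Some n))[_] /= [].
by lia.
Qed.

(** Here [b] opens a new tree for [sigma], and [z] points to it. After hiding, [z] inherits the
    pointer 2i of [b], with [i] even, whereas copycat points to 2(k-1), with k-1 odd. For i = k the
    move [b] points to [a] itself, which would be correct if [k] were 0. *)
Lemma right_initial a b z i : ~~ odd k -> 0 < k -> ~~ odd i -> i <= k ->
    tau (zig (lin (map (@swap _ _) l)) ++ [:: (inr a, fst_ptr (prev k)); (inl b, Some (2 * i))]) ->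
    sigma (zig (lin l) ++ [:: (inr b, None); (inl z, Some (2 * k))]) ->
  False.
Proof.
move=> ok k0 oi hi ht hs.
case Ek : k ok k0 hi => [//|n] /=; rewrite negbK => on _ hi.
have hn : n < k by rewrite Ek.
have [TAB [TBC [TAC [EAB EBC EAC [s1 s2 s3] T]]]] := tables.
have [[n0 n1 n2] [m0 m1 m2] [q0 q1 q2]] := T _ hn.
have {}m2 := m2 on; rewrite on in n2.
have [[xa xb] ox] := onth_ex hn.
have ls := strategy_legal ss hs; rewrite -rcons2 in ls.
have [ls1 jz tz _ _] := (legal_rcons _ _ _).1 ls.
have lt := strategy_legal st ht; rewrite -rcons2 in lt.
have [lt1 jb tb _ _] := (legal_rcons _ _ _).1 lt.
have [_ ja ta _ _] := (legal_rcons _ _ _).1 lt1.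
have oxs : onth (map (@swap _ _) l) n = Some (xb, xa) by rewrite onth_map ox.
have [_ z2] := onth_zig (onth_lin oxs).
rewrite on in z2; rewrite /zfst /zsnd /= in z2.
have ea : enables A (Some xa) a.
  by move: ja; rewrite Ek /= => -[n' [q []]]; rewrite z2 => -[<- _].
have [ebi ez] : enables B None b /\ enables A None z.
  move: jz => [n' [q []]]; rewrite -szS onth_last => -[<- _].
  by [].
have qz : (label z).2 = Question by rewrite (initial_label ez).
have [e [ee oT oC oU]] : exists e, [/\ enables A None e,
    exists q, onth (rcons (zig (lin (map (@swap _ _) l))) (inr a, fst_ptr (prev k))) (2 * i) = Some (inr e, q),
    exists q, onth (rcons (zig (lin (map dup l))) (inr a, fst_ptr (prev k))) (2 * i) = Some (inr e, q)
    & exists q, onth (rcons (tri L) (inr a, Some (3 * n).+2)) (3 * i) = Some (inr e, q)].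
  have eE e : (exists q, onth (rcons (zig (lin (map (@swap _ _) l))) (inr a, fst_ptr (prev k))) (2 * i) = Some (inr e, q)) ->
      enables A None e.
    by case=> q oe; move: jb => [n' [q' []]]; rewrite oe => -[<- _] [].
  case: (ltnP i k) => hik; last first.
    have Ei : i = k by lia.
    have oa : exists q, onth (rcons (zig (lin (map (@swap _ _) l))) (inr a, fst_ptr (prev k))) (2 * i) = Some (inr a, q).
      by exists (fst_ptr (prev k)); rewrite Ei -szT onth_last.
    exists a; split=> //; first exact: eE.
      by exists (fst_ptr (prev k)); rewrite Ei -szC onth_last.
    by exists (Some (3 * n).+2); rewrite Ei -sL -size_tri onth_last.
  have [[ya yb] oy] := onth_ex hik.
  have oys : onth (map (@swap _ _) l) i = Some (yb, ya) by rewrite onth_map oy.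
  have oyd : onth (map dup l) i = Some (ya, ya) by rewrite onth_map oy.
  have [w1 _] := onth_zig (onth_lin oys); have [v1 _] := onth_zig (onth_lin oyd).
  have [qc oc] := onth_triC (onL oy).
  rewrite oi in w1 v1 oc; rewrite addn0 in oc.
  have h2 : 2 * i < 2 * k by lia.
  have oT : exists q, onth (rcons (zig (lin (map (@swap _ _) l))) (inr a, fst_ptr (prev k))) (2 * i) = Some (inr ya, q).
    by exists (fst_ptr (prev i)); rewrite onth_rcons szT h2 w1.
  exists ya; split=> //; first exact: eE.
    by exists (fst_ptr (prev i)); rewrite onth_rcons szC h2 v1.
  by exists qc; rewrite onth_rcons (onth_lt oc).
have lc1 : legal (A := arrow A A) (rcons (zig (lin (map dup l))) (inr a, fst_ptr (prev k))).
  apply: legal_first_swap lt1 _ _ => //.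
  apply/justified_rcons; split; first by case: legC.
  have oxd : onth (map dup l) n = Some (xa, xa) by rewrite onth_map ox.
  have [_ v2] := onth_zig (onth_lin oxd); rewrite on in v2.
  by rewrite Ek /=; do 2 eexists; split; [exact: v2|].
have lc : legal (A := arrow A A) (zig (lin (map dup l)) ++
    [:: (inr a, fst_ptr (prev k)); (inl z, Some (2 * i))]).
  rewrite -rcons2; apply/legal_rcons; split=> //.
  - by have [q oq] := oC; exists (inr e), q.
  - rewrite size_rcons szC turn_odd; move: tz; rewrite size_rcons szS turn_odd.
    by [].
  - by rewrite /= qz.
  - move=> j [<-]; rewrite [(label _).1]tz size_rcons szS turn_odd /k -(size_map dup).
    by apply: view_lin_next; rewrite size_map //; lia.
pose u := tri L ++ [:: (inr a, Some (3 * n).+2); (inl (inr b), Some (3 * i));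
    (inl (inl z), Some (3 * k).+1)].
have ju : justified (A := arrow (arrow A B) A) u.
  have [qa oa] := onth_triC (onL ox); rewrite on addn2 in oa.
  rewrite /u cat3; apply/justified_rcons; split; [apply/justified_rcons; split;
    [apply/justified_rcons; split=> //|] |].
  - by do 2 eexists; split; [exact: oa|].
  - by have [q oq] := oU; exists (inr e), q.
  - exists (inl (inr b)), (Some (3 * i)); split=> //.
    have -> : (3 * k).+1 = size (rcons (tri L) (inr a, Some (3 * n).+2)).
      by rewrite size_rcons size_tri sL.
    by rewrite onth_last.
have := @compose_rst A B A sigma tau u _ _ _ ss st ju _ _ _ hs ht lc.
rewrite /u !rT EAB EBC EAC /= /rst_step /=; push_nth.
have -> : nth None (rcons TAB (nth None TAB (3 * n).+2)) (3 * i) = None.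
  case: (ltnP i k) => hik; last by have -> : i = k; [lia|]; push_nth.
  by push_nth; have [[-> _ _] _ _] := T _ hik; rewrite (negPf oi).
have -> : nth None (rcons TBC (Some (size (zig (lin (map (@swap _ _) l)))))) (3 * i) = Some (2 * i).
  case: (ltnP i k) => hik; last by have -> : i = k; [lia|]; push_nth; rewrite szT.
  by push_nth; have [_ [j0 _ _] _] := T _ hik; rewrite j0.
have -> : nth None (rcons TAC (Some (size (zig (lin (map dup l)))))) (3 * i) = Some (2 * i).
  case: (ltnP i k) => hik; last by have -> : i = k; [lia|]; push_nth; rewrite szC.
  by push_nth; have [_ _ [-> _ _]] := T _ hik.
push_nth; rewrite m2 q2 !rcons2 szS Ek.
move=> /(_ erefl erefl erefl).
rewrite Hc => /(copycat_respond (r := Some n))[_] /= [].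
by lia.
Qed.

(** [sigma] makes no further move: the composite answers in the component of the Opponent move,
    which copycat never does. The work lies in lifting the pointer [j] to a position [J] of the
    interaction. *)
Lemma right_same a a' p : ~~ odd k ->
  ~ tau (zig (lin (map (@swap _ _) l)) ++ [:: (inr a, fst_ptr (prev k)); (inr a', p)]).
Proof.
move=> ok ht.
have [TAB [TBC [TAC [EAB EBC EAC [s1 s2 s3] T]]]] := tables.
have lt := strategy_legal st ht; rewrite -rcons2 in lt.
have [lt1 jb tb _ _] := (legal_rcons _ _ _).1 lt.
have [_ ja ta _ _] := (legal_rcons _ _ _).1 lt1.
rewrite size_rcons szT turn_odd in tb; rewrite szT turn_even in ta.
pose ptr := omap (fun n => (3 * n).+2) (prev k).
have [ux cx bx abx] : [/\ justified (A := arrow (arrow A B) A) (rcons (tri L) (inr a, ptr)),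
    justified (A := arrow A A) (rcons (zig (lin (map dup l))) (inr a, fst_ptr (prev k))),
    obind (nth None TBC) ptr = fst_ptr (prev k)
  & obind (nth None TAC) ptr = fst_ptr (prev k)].
  rewrite /ptr; case Ek : k ok ja => [|n] /= ok ja.
    by split=> //; apply/justified_rcons; split=> //; case: legC.
  rewrite negbK in ok; have hn : n < k by rewrite Ek.
  have [[xa xb] ox] := onth_ex hn.
  have oxs : onth (map (@swap _ _) l) n = Some (xb, xa) by rewrite onth_map ox.
  have oxd : onth (map dup l) n = Some (xa, xa) by rewrite onth_map ox.
  have [_ z2] := onth_zig (onth_lin oxs); have [_ v2] := onth_zig (onth_lin oxd).
  have [qa oa] := onth_triC (onL ox).
  rewrite ok in z2 v2 oa; rewrite addn2 in oa; rewrite /zfst /zsnd /= in z2 v2.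
  have ea : enables A (Some xa) a.
    by move: ja => -[n' [q []]]; rewrite z2 => -[<- _].
  have [_ [_ _ m2] [_ _ q2]] := T _ hn; split; rewrite ?m2 //.
    by apply/justified_rcons; split=> //; do 2 eexists; split; [exact: oa|].
  by apply/justified_rcons; split; [case: legC|do 2 eexists; split; [exact: v2|]].
case: p ht lt jb => [j|] ht lt jb; last by rewrite (initial_label jb) in tb.
have [e [J [ee oU oC [BJ CJ]]]] : exists e J, [/\ enables A (Some e) a',
    exists q, onth (rcons (tri L) (inr a, ptr)) J = Some (inr e, q),
    exists q, onth (rcons (zig (lin (map dup l))) (inr a, fst_ptr (prev k))) j = Some (inr e, q)
    & nth None (rcons TBC (Some (2 * k))) J = Some j /\
      nth None (rcons TAC (Some (2 * k))) J = Some j].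
  have [n' [q [oj ej]]] := jb; case: n' oj ej => // e oj ej; exists e.
  rewrite onth_rcons szT in oj; move: oj; case: ltnP => [hj oj|_]; last first.
    case: eqP => // -> [Ee _]; exists (3 * k); split=> //.
    - by exists ptr; rewrite -sL -size_tri onth_last Ee.
    - by exists (fst_ptr (prev k)); rewrite -szC onth_last Ee.
    - by split; push_nth.
  have [i [d [r [y [oL Hi]]]]] := onth_zig_inv oj.
  have [os Ed Er] := onth_lin_inv oL; have hi := onth_lt os; rewrite size_map in hi.
  have [[ya yb] oy] := onth_ex hi.
  have Ey : y = (yb, ya) by move: os; rewrite onth_map oy => -[].
  have oyd : onth (map dup l) i = Some (ya, ya) by rewrite onth_map oy.
  have [v1 v2] := onth_zig (onth_lin oyd).
  have [qc oc] := onth_triC (onL oy).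
  have [_ [j0 _ j2] [r0 _ r2]] := T _ hi.
  subst d r y; case oi: (odd i) Hi v1 v2 oc j0 j2; rewrite /zfst /zsnd /= => Hi v1 v2 oc j0 j2.
    case: Hi => -[Ej [E _]] //; subst e j.
    exists (3 * i).+2; rewrite addn2 in oc; split=> //.
    - by exists qc; rewrite onth_rcons (onth_lt oc).
    - by do 1 eexists; rewrite onth_rcons szC hj; exact: v2.
    - by split; push_nth; rewrite ?j2 ?r2.
  case: Hi => -[Ej [E _]] //; subst e j.
  exists (3 * i); rewrite addn0 in oc; split=> //.
  - by exists qc; rewrite onth_rcons (onth_lt oc).
  - by do 1 eexists; rewrite onth_rcons szC hj; exact: v1.
  - by split; push_nth; rewrite ?j0 ?r0.
have lc : legal (A := arrow A A) (zig (lin (map dup l)) ++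
    [:: (inr a, fst_ptr (prev k)); (inr a', Some j)]).
  rewrite -rcons2; apply: legal_skeleton lt _.
    by rewrite /skeleton !map_rcons -!/(skeleton _) skel_swap.
  by apply/justified_rcons; split=> //; have [q oq] := oC; exists (inr e), q.
pose u := tri L ++ [:: (inr a, ptr); (inr a', Some J)].
have ju : justified (A := arrow (arrow A B) A) u.
  rewrite /u -rcons2; apply/justified_rcons; split=> //.
  by have [q oq] := oU; exists (inr e), q.
have := @compose_rst A B A sigma tau u _ _ _ ss st ju _ _ _ ml.1 ht lc.
rewrite /u !rT EAB EBC EAC /= /rst_step /= szT szC BJ CJ bx abx !rcons2.
move=> /(_ erefl erefl erefl).
by rewrite Hc => /copycat_respond[].
Qed.

(** As in [right_same], with one more case: an initial [a'] may be justified by a B-move, which is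
    hidden in the composite, so the pointers [j] and [J'] can differ. *)
Lemma left_same a a' p : odd k ->
  ~ sigma (zig (lin l) ++ [:: (inl a, fst_ptr (prev k)); (inl a', p)]).
Proof.
move=> ok hs.
case Ek : k ok => [//|n] /= on; have hn : n < k by rewrite Ek.
have [TAB [TBC [TAC [EAB EBC EAC [s1 s2 s3] T]]]] := tables.
have [[n0 n1 n2] _ [q0 q1 q2]] := T _ hn; rewrite (negPf on) in n2.
have ls := strategy_legal ss hs; rewrite -rcons2 in ls.
have [ls1 jb tb _ _] := (legal_rcons _ _ _).1 ls.
have [_ ja ta _ _] := (legal_rcons _ _ _).1 ls1.
rewrite size_rcons szS turn_odd in tb.
have [[xa xb] ox] := onth_ex hn.
have oxd : onth (map dup l) n = Some (xa, xa) by rewrite onth_map ox.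
have [_ z2] := onth_zig (onth_lin ox); have [_ v2] := onth_zig (onth_lin oxd).
have [qa oa] := onth_triA (onL ox).
rewrite (negPf on) in z2 v2 oa; rewrite addn2 in oa; rewrite /zfst /zsnd /= in z2 v2.
have ea : enables A (Some xa) a.
  by move: ja; rewrite Ek /= => -[n' [q []]]; rewrite z2 => -[<- _].
have cx : justified (A := arrow A A) (rcons (zig (lin (map dup l))) (inl a, fst_ptr (prev k))).
  rewrite Ek /=; apply/justified_rcons; split; first by case: legC.
  by do 2 eexists; split; [exact: v2|].
have ux : justified (A := arrow (arrow A B) A) (rcons (tri L) (inl (inl a), Some (3 * n).+2)).
  by apply/justified_rcons; split=> //; do 2 eexists; split; [exact: oa|].
have lc1 : legal (A := arrow A A) (rcons (zig (lin (map dup l))) (inl a, fst_ptr (prev k))).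
  exact: legal_first ls1 _ _.
case: p hs ls jb => [j|//] hs ls jb.
suff [J [J' [ju lc BJ CJ]]] : exists J J',
    [/\ justified (A := arrow (arrow A B) A)
          (rcons (rcons (tri L) (inl (inl a), Some (3 * n).+2)) (inl (inl a'), Some J)),
        legal (A := arrow A A) (rcons (rcons (zig (lin (map dup l))) (inl a, fst_ptr (prev k)))
          (inl a', Some J')),
        nth None (rcons TAB (Some (2 * k))) J = Some j
      & nth None (rcons TAC (Some (2 * k))) J = Some J'].
  rewrite !rcons2 in ju lc.
  have := @compose_rst A B A sigma tau _ _ _ _ ss st ju _ _ _ hs ml.2 lc.
  rewrite !rT EAB EBC EAC /= /rst_step /= szS szC BJ CJ n2 q2 !rcons2 Ek.
  move=> /(_ erefl erefl erefl).
  by rewrite Hc => /(copycat_respond (r := Some n))[].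
have lcj e : enables A (Some e) a' ->
    (exists q, onth (rcons (zig (lin (map dup l))) (inl a, fst_ptr (prev k))) j = Some (inl e, q)) ->
    legal (A := arrow A A) (rcons (rcons (zig (lin (map dup l))) (inl a, fst_ptr (prev k))) (inl a', Some j)).
  move=> ee [q oq]; apply: legal_skeleton ls _.
    by rewrite /skeleton !map_rcons -!/(skeleton _) skel_dup.
  by apply/justified_rcons; split=> //; exists (inl e), q.
have [n' [q [oj ej]]] := jb; rewrite onth_rcons szS in oj; move: oj.
case: ltnP => [hj oj|_]; last first.
  case: eqP => // Ej [En _]; rewrite -En in ej; exists (3 * k), j; split.
  - apply/justified_rcons; split=> //; exists (inl (inl a)), (Some (3 * n).+2).
    by rewrite -sL -size_tri onth_last.
  - by apply: (lcj a) => //; exists (fst_ptr (prev k)); rewrite Ej -szC onth_last.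
  - by push_nth; rewrite Ej.
  - by push_nth; rewrite Ej.
have [i [d [r [y [oL Hi]]]]] := onth_zig_inv oj.
have [oy Ed Er] := onth_lin_inv oL; have hi := onth_lt oy.
case: y oL oy Hi => ya yb oL oy Hi.
have oyd : onth (map dup l) i = Some (ya, ya) by rewrite onth_map oy.
have [v1 v2'] := onth_zig (onth_lin oyd).
have [[i0 i1 i2] _ [r0 r1 r2]] := T _ hi.
have [qc oc] := onth_triA (onL oy); have [qb ob] := onth_triB (onL oy).
rewrite addn1 in ob.
case: n' ej oj Hi => [e|e] ej oj Hi.
  subst d r; case oi: (odd i) Hi v1 v2' oc i0 i1 i2; rewrite /zfst /zsnd /= => Hi v1 v2' oc i0 i1 i2.
    case: Hi => -[Ej [E _]] //; subst e j.
    exists (3 * i), (2 * i); rewrite addn0 in oc; split.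
    - apply/justified_rcons; split=> //; do 2 eexists; split.
        by rewrite onth_rcons (onth_lt oc); exact: oc.
      exact: ej.
    - by apply: (lcj ya) => //; eexists; rewrite onth_rcons szC hj; exact: v1.
    - by push_nth.
    - by push_nth.
  case: Hi => -[Ej [E _]] //; subst e j.
  exists (3 * i).+2, (2 * i).+1; rewrite addn2 in oc; split.
  - apply/justified_rcons; split=> //; do 2 eexists; split.
      by rewrite onth_rcons (onth_lt oc); exact: oc.
    exact: ej.
  - by apply: (lcj ya) => //; eexists; rewrite onth_rcons szC hj; exact: v2'.
  - by push_nth.
  - by push_nth.
(* The justifier is a hidden B-move. In the composite the pointer goes to occurrence 0, the move
   opening the only tree, so legality is checked directly instead of through skeletons. *)
have [eb ei] : enables B None e /\ enables A None a' := ej.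
have [Ee Ej] : e = yb /\ j = 2 * i + odd i.
  subst d; case: (odd i) Hi; rewrite /zfst /zsnd /= => -[] [-> [E _]] //.
    by case: E => ->; rewrite addn1.
  by case: E => ->; rewrite addn0.
subst e; exists (3 * i).+1, 0; split.
- apply/justified_rcons; split=> //; do 2 eexists; split.
    by rewrite onth_rcons (onth_lt ob); exact: ob.
  exact: ej.
- apply/legal_rcons; split=> //.
  + have h0 : 0 < k by rewrite Ek.
    have [[ca cb] o0] := onth_ex h0.
    have od : onth (map dup l) 0 = Some (ca, ca) by rewrite onth_map o0.
    have [w1 _] := onth_zig (onth_lin od).
    exists (inr ca), None; rewrite onth_rcons szC Ek w1; split=> //.
    split=> //; have := pA; case: (l) o0 => [|x l'] //= o0 [+ _].
    by case: o0 => ->.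
  + by rewrite size_rcons szC turn_odd.
  + by rewrite /= (initial_label ei).
  + move=> j' [<-]; rewrite [(label _).1]tb /k -(size_map dup).
    by apply: view_lin_next; rewrite size_map.
- by push_nth; rewrite i1 Ej.
- by push_nth.
Qed.

End Zigzag.

(** An answer to 2i would require the question at 2i+1 to be closed already; in a linear play only
    the first move of the next block can do that, and then its partner has already answered 2i. *)
Lemma lin_question (A B : arena) sigma tau (l : seq (move A * move B)) x y i :
    strategy (A := arrow A B) sigma -> strategy (A := arrow B A) tau ->
    matched sigma tau l -> i.+1 < size l ->
    legal (A := arrow A B)
      (rcons (rcons (zig (lin l)) (x, fst_ptr (prev (size l)))) (y, Some (2 * i))) ->
  (label (a := arrow A B) y).2 = Question.
Proof.
move=> ss st ml hi /legal_rcons[lx _ _ br _]; case E: (label (a := arrow A B) y).2 => //.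
have [j [<-] [[[m [p [om qm]]] na] mx]] := br E.
set S := rcons _ _ in om na mx lx.
have szS : size (zig (lin l)) = 2 * size l by rewrite size_zig size_lin.
have onS k z : onth (zig (lin l)) k = Some z -> onth S k = Some z.
  by move=> o; rewrite onth_rcons (onth_lt o).
have [[a b] o] := onth_ex (ltnW hi); have [[a' b'] o'] := onth_ex hi.
have [z1 z2] := onth_zig (onth_lin o); have [y1 y2] := onth_zig (onth_lin o').
have [k1 k2] := kind_zfst (~~ odd i) (matched_kinds ss st ml o).
have [k3 k4] := kind_zfst (~~ odd i.+1) (matched_kinds ss st ml o').
suff /mx : unanswered (A := arrow A B) S (2 * i).+1 by rewrite ltnn.
split.
  do 2 eexists; split; first exact: onS z2.
  by rewrite k2 -k1; move: om; rewrite (onS _ _ z1) => -[-> _].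
case=> k [n [ok an]].
move: ok; rewrite onth_rcons szS; case: ltnP => [hk ok|_]; last first.
  case: eqP => // _ [_]; case Es: (size l) hi => [//|n'] hi [] Ei.
  by lia.
have [i' [d [r [z [oL]]]]] := onth_zig_inv ok; have [oz -> ->] := onth_lin_inv oL.
case=> -[Ek [En]]; last by rewrite /snd_ptr; case: (i') => [|i''] [] /=; lia.
case: i' oL oz Ek En => [//|i'] oL oz Ek En [] Ei.
have Ei' : i' = i by lia.
subst i'; rewrite o' in oz; case: oz => Ez; subst z n.
apply: na; exists (2 * i.+1).+1, (zsnd (~~ odd i.+1) (a', b')); split; first exact: onS y2.
by rewrite k4 -k3.
Qed.

(** The Opponent move of [P] is legal after the whole of [l]: parity puts its justifier in the
    Opponent view, and bracketing does not constrain questions. Its Proponent view is that of the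
    shorter branch, so [innocent_extend] supplies the reply. *)
Lemma extend_matched (A B : arena) sigma tau (l : seq (move A * move B)) P i :
    @inverse_pair A B sigma tau -> matched sigma tau l -> i.+1 < size l ->
    odd i = odd (size l).-1 -> matched sigma tau (rcons (take i.+1 l) P) ->
    (label P.1).2 = Question ->
  let d := ~~ odd i.+1 in
  tau (zig (lin (map (@swap _ _) l)) ++
    [:: (zfst d (swap P), Some (2 * i).+1); (zsnd d (swap P), Some (2 * i))]).
Proof.
move=> [[ss _] it _ _] ml hi oi mP qP d; have [st _] := it.
have K : (label P.1).2 = (label P.2).2.
  apply: (matched_kinds (i := i.+1) ss st mP).
  by have := onth_last (take i.+1 l) P; rewrite size_takel // ltnW.
have sz : size (map (@swap _ _) (take i.+1 l)) = i.+1.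
  by rewrite size_map size_takel // ltnW.
have tP : tau (zig (lin (map (@swap _ _) (take i.+1 l))) ++
    [:: (zfst d (swap P), Some (2 * i).+1); (zsnd d (swap P), Some (2 * i))]).
  by case: mP => _; rewrite map_rcons lin_rcons zig_rcons sz.
have Et : zig (lin (map (@swap _ _) (take i.+1 l))) =
    take (2 * i).+2 (zig (lin (map (@swap _ _) l))).
  by rewrite map_take -take_lin -take_zig; congr take; lia.
have lP := strategy_legal st tP; rewrite -rcons2 in lP.
have [lf _ _ _ _] := (legal_rcons _ _ _).1 lP; have [_ jf tf _ _] := (legal_rcons _ _ _).1 lf.
rewrite size_zig size_lin turn_even in tf.
have [k1 _] := kind_zfst (A := B) (B := A) d (x := swap P) (esym K).
have lT : legal (A := arrow B A) (zig (lin (map (@swap _ _) l))).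
  by apply: strategy_legal st _; case: ml.
suff lg : legal (A := arrow B A) (rcons (zig (lin (map (@swap _ _) l)))
    (zfst d (swap P), Some (2 * i).+1)).
  by apply: (innocent_extend it ml.2 lg _ (leqnSn _) tf); rewrite -Et.
apply/legal_rcons; split=> //.
- have [n [q [o e]]] := jf; exists n, q; split=> //; rewrite Et onth_take in o.
  by move: o; case: ltnP.
- by rewrite tf size_zig turn_even.
- by rewrite k1 /= qP.
- move=> j [<-]; rewrite [(label _).1]tf; apply: Oview_lin; rewrite // size_map //.
  exact: ltnW.
Qed.

(** The bound on [i] keeps the extended path within length [size l], where totality is available;
    uniqueness of branches makes the branch found there extend [take i.+1 l]. *)
Lemma matched_extension (A B : arena) sigma tau (l : seq (move A * move B)) i a :
    @inverse_pair A B sigma tau -> matched sigma tau l -> i.+1 < size l ->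
    total_upto sigma tau (size l) -> paths A (rcons (unzip1 (take i.+1 l)) a) ->
  exists b, matched sigma tau (rcons (take i.+1 l) (a, b)).
Proof.
move=> inv ml hi tot pa; have [[ss _] [st _] _ _] := inv.
have [|l' ul' ml'] := tot _ pa; first by rewrite size_rcons size_map size_takel // ltnW.
case/lastP: l' ul' ml' => [|l' [a' b]] ul' ml'.
  by move/(congr1 size): ul'; rewrite size_rcons.
rewrite /unzip1 map_rcons in ul'; move/rcons_inj: ul' => [ul' Ea].
rewrite /= in Ea; subst a'; exists b.
suff -> : take i.+1 l = l' by [].
apply: matched_unzip1_inj inv _ _ (esym ul'); first exact: matched_take.
by have := matched_take (size l') ss st ml'; rewrite -cats1 take_size_cat.
Qed.

Lemma onth_block (A B : arena) (l : seq (move A * move B)) x p j n q :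
    legal (A := arrow A B) (rcons (zig (lin l)) (x, p)) ->
    onth (rcons (zig (lin l)) (x, p)) j = Some (n, q) ->
    (label (a := arrow A B) n).1 = Opponent ->
  (j = 2 * size l /\ n = x) \/
  exists i y, [/\ onth l i = Some y, j = 2 * i & n = zfst (~~ odd i) y].
Proof.
move=> lg; rewrite onth_rcons size_zig size_lin; case: ltnP => [_ o t|_]; last first.
  by case: eqP => // -> [-> _] _; left.
right; have [i [d [r [y [oL]]]]] := onth_zig_inv o.
have [oy -> ->] := onth_lin_inv oL; case=> -[Ej [-> _]]; first by exists i, y.
have l0 : legal (A := arrow A B) (zig (lin l)) by have [] := (legal_rcons _ _ _).1 lg.
by have := legal_turn l0 o; rewrite t Ej turn_odd.
Qed.

Lemma responds_step (A B : arena) sigma tau k : @inverse_pair A B sigma tau ->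
    total_upto sigma tau k -> total_upto tau sigma k -> responds_at sigma tau k.
Proof.
move=> inv totA totB l sl ml x [ym yp] hs; subst k; have [[ss _] [st _] _ _] := inv.
have inv' := inverse_pair_sym inv; have ml' := matched_swap ml.
have ls := strategy_legal ss hs; rewrite -rcons2 in ls.
have [lx jy ty _ _] := (legal_rcons _ _ _).1 ls.
rewrite size_rcons size_zig size_lin turn_odd in ty; rewrite size_lin.
have [pA pB] := lin_paths (strategy_legal ss ml.1).
have opp n m : enables (arrow A B) (Some n) m -> (label (a := arrow A B) m).1 = Proponent ->
    (label (a := arrow A B) n).1 = Opponent.
  by move=> /enables_alternates + E; rewrite E; case: (label n).1.
have pre (C : arena) (g : move A * move B -> move C) i y c : onth l i = Some y ->
    paths C (map g l) -> enables C (Some (g y)) c -> paths C (rcons (map g (take i.+1 l)) c).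
  move=> o pC e; have hi := onth_lt o.
  apply/enabled_chain_rcons; split.
    have : forall q q' o', enabled_chain o' (q ++ q') -> enabled_chain (A := C) o' q.
      by elim=> //= z q IH q' o' [? /IH].
    by move=> H; apply: (H _ (map g (drop i.+1 l))); rewrite -map_cat cat_take_drop.
  have -> : take i.+1 l = rcons (take i l) y by rewrite (take_nth y) // -odflt_onth o.
  by rewrite !map_rcons last_rcons.
case ok: (odd (size l)); case: x hs ls lx jy => [a|b] hs ls lx jy //= _.
- have k0 : size l = (size l).-1.+1 by case: (size l) ok.
  case: ym hs ls ty jy => [a'|b] hs ls ty jy.
    by case: (left_same inv ml ok hs).
  split=> //; case: yp hs ls jy => [j|] hs ls jy; last by rewrite (initial_label jy) in ty.
  have [n [q [o e]]] := jy.
  have [[_ En]|[i [y [oy Ej En]]]] := onth_block lx o (opp _ _ e ty); first by rewrite En in e.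
  case oi: (odd i) En => /= En; first by rewrite En in e.
  rewrite En in e; subst j; have hi := onth_lt oy.
  rewrite /snd_ptr /= k0 /=; congr (Some (2 * _)).
  (* The correct justifying block is the last one. For an earlier one, totality provides the partner
     of [b] on the branch that leaves [l] after block [i], and innocence lets [tau] play it here. *)
  case: (ltnP i.+1 (size l)) => hi'; last by lia.
  have oi' : odd i = odd (size l).-1 by lia.
  have qb := lin_question ss st ml hi' ls.
  have pb : paths B (rcons (unzip1 (take i.+1 (map (@swap _ _) l))) b).
    by rewrite -map_take unzip1_swap; apply: pre oy pB e.
  have [||z mz] := matched_extension (i := i) inv' ml' _ _ pb; rewrite ?size_map //.
  have mP : matched sigma tau (rcons (take i.+1 l) (z, b)).
    by have := matched_swap mz; rewrite map_rcons -map_take map_swapK.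
  have Kzb : (label z).2 = (label b).2.
    have := @matched_kinds _ _ _ _ (rcons (take i.+1 l) (z, b)) i.+1 (z, b) ss st mP; apply.
    by have := onth_last (take i.+1 l) (z, b); rewrite size_takel // ltnW.
  have qz : (label z).2 = Question by rewrite Kzb.
  have ht := extend_matched inv ml hi' oi' mP qz.
  rewrite /= oi /= in ht.
  by case: (left_pointer inv ml ok (negbT oi) hi' hs ht qz).
(* The external move lies in B, so the contradiction arises in the composite on B: the preceding
   lemmas are used with [sigma] and [tau] exchanged. *)
- have sl' : size (map (@swap _ _) l) = size l by rewrite size_map.
  have ok' : ~~ odd (size (map (@swap _ _) l)) by rewrite sl' ok.
  case: ym hs ls ty jy => [a|b'] hs ls ty jy; last first.
    by case: (right_same (a := b) (a' := b') (p := yp) inv' ml' ok'); rewrite map_swapK sl'.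
  split=> //; case: yp hs ls jy => [j|//] hs ls jy.
  have [n [q [o e]]] := jy.
  (* An answer of [sigma] that is initial in A opens a new tree for [tau], whose reply is known from
     the path of length one. *)
  have init i : i <= size l -> ~~ odd i -> 0 < size l -> j = 2 * i -> enables A None a -> False.
    move=> hi oi k0 Ej ea; subst j.
    have [|l' ul' mz] := totA [:: a] _ k0; first by split.
    case: l' ul' mz => [//|[a' z] [|? ?]] //= [->] [_ mz].
    have ht := innocent_extend_initial (A := arrow B A) _ _ _ mz.
    have lT := strategy_legal st ml.2.
    have := ht (let: And4 _ it _ _ := inv in it) _ ml.2; rewrite size_zig size_lin sl' => {}ht.
    have ta : (label a).1 = Opponent by rewrite (initial_label ea).
    apply: (right_initial (a := b) (b := a) (z := z) (i := i) inv' ml' ok'); rewrite ?sl' ?map_swapK //.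
    apply: ht => //; apply/legal_rcons; split=> //.
      by rewrite size_zig turn_even.
    by rewrite /= (initial_label ea).
  have [[Ej En]|[i [y [oy Ej En]]]] := onth_block lx o (opp _ _ e ty).
    rewrite En in e; case: e => _ ea; case: (posnP (size l)) => k0; last first.
      by case: (init (size l)) => //; rewrite ok.
    by rewrite Ej k0.
  have hi := onth_lt oy.
  case oi: (odd i) En => /= En; last first.
    rewrite En in e; case: e => _ ea; case: (init i) => //; first exact: ltnW.
      by rewrite oi.
    by apply: leq_ltn_trans hi.
  rewrite En in e; subst j.
  have k0 : size l = (size l).-1.+1 by lia.
  rewrite /snd_ptr /= k0 /=; congr (Some (2 * _)).
  case: (ltnP i.+1 (size l)) => hi'; last by lia.
  have oi' : odd i = odd (size l).-1 by lia.
  have qa := lin_question ss st ml hi' ls.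
  have pa : paths A (rcons (unzip1 (take i.+1 l)) a) by apply: pre oy pA e.
  have [z mz] := matched_extension inv ml hi' totA pa.
  have Kzb : (label a).2 = (label z).2.
    have := @matched_kinds _ _ _ _ (rcons (take i.+1 l) (a, z)) i.+1 (a, z) ss st mz; apply.
    by have := onth_last (take i.+1 l) (a, z); rewrite size_takel // ltnW.
  have ht := extend_matched inv ml hi' oi' mz qa.
  rewrite /= oi /= in ht.
  have qz : (label z).2 = Question by rewrite -Kzb.
  case: (right_pointer (a := b) (b := a) (z := z) (i := i) inv' ml' ok'); rewrite ?sl' ?map_swapK //.
Qed.

Lemma responds_total (A B : arena) sigma tau k : @inverse_pair A B sigma tau ->
  total_upto sigma tau k /\ total_upto tau sigma k.
Proof.
move=> inv; have inv' := inverse_pair_sym inv.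
elim/ltn_ind: k => k IH.
have H i : i < k -> responds_at sigma tau i /\ responds_at tau sigma i.
  by move=> /IH[h1 h2]; split; apply: responds_step.
by split; apply: total_step => // i /H[].
Qed.

Lemma Inn_path_isomorphism (A B : arena) : Inn_isomorphic A B ->
  exists phi : seq (move A) -> seq (move B), path_isomorphism phi.
Proof.
move=> [sigma [tau [is_ it h1 h2]]]; have inv : inverse_pair sigma tau by split.
have [ss _] := is_; have [st _] := it.
have ex p : exists q, paths A p -> exists l, [/\ unzip1 l = p, unzip2 l = q & matched sigma tau l].
  case: (pselect (paths A p)) => [pp|np]; last by exists [::].
  have [tot _] := responds_total (size p) inv.
  by have [l ul ml] := tot p pp (leqnn _); exists (unzip2 l) => _; exists l.
have [phi phiP] := choice ex.
have phiE l : matched sigma tau l -> phi (unzip1 l) = unzip2 l.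
  move=> ml; have [pA _] := lin_paths (strategy_legal ss ml.1).
  have [l' [u1 <- ml']] := phiP _ pA.
  by rewrite (matched_unzip1_inj inv ml' ml u1).
exists phi; split.
- split.
  + move=> p pp; have [l [_ <- ml]] := phiP _ pp.
    by case: (lin_paths (strategy_legal ss ml.1)).
  + move=> p q; rewrite !inE => pp pq E.
    have [l [u1 u2 ml]] := phiP _ pp; have [l' [u1' u2' ml']] := phiP _ pq.
    by rewrite -u1 -u1' (matched_unzip2_inj inv ml ml') // u2 u2'.
  + move=> q pq; have [_ tot] := responds_total (size q) inv.
    have [l <- ml] := tot q pq (leqnn _); have ml' := matched_swap ml.
    exists (unzip2 l); last by rewrite -[in LHS]unzip1_swap phiE // unzip2_swap.
    by case: (lin_paths (strategy_legal st ml.1)).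
- move=> p pp _; have [l [u1 u2 ml]] := phiP _ pp.
  have sp : size p = size l by rewrite -u1 size_map.
  have sq : size (phi p) = size l by rewrite -u2 size_map.
  (* Prefixes of matched branches are matched, so [phi] commutes with [ip]. *)
  have := phiE _ (matched_take (size l).-1 ss st ml).
  rewrite /unzip1 /unzip2 !map_take -/(unzip1 l) -/(unzip2 l) u1 u2.
  by rewrite /ip sp sq.
- move=> p a q b pp E; have [l [u1 u2 ml]] := phiP _ pp; rewrite E in u2.
  case/lastP: l u1 u2 ml => [|l [a' b']] u1 u2 ml; first by move/(congr1 size): u1; rewrite size_rcons.
  rewrite /unzip1 /unzip2 !map_rcons in u1 u2.
  move/rcons_inj: u1 => [_ <-]; move/rcons_inj: u2 => [_ <-].
  by rewrite (matched_kinds (i := size l) ss st ml (onth_last _ _)).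
Qed.

Theorem theorem1 (A B : arena) :
  Inn_isomorphic A B <->
  exists phi : seq.seq (move A) -> seq.seq (move B), path_isomorphism phi.
Proof.
split; first exact: Inn_path_isomorphism.
by case=> phi; apply: path_isomorphism_Inn.
Qed.
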